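(* Let $\Lambda$ and $\Lambda'$ be finite-dimensional elementary $k$-algebras of rank $2$ with complete sets of primitive orthogonal idempotents $1=e_1+e_2\in\Lambda$ and $1=e'_1+e'_2\in\Lambda'$ such that $e_2\Lambda e_1=0$, $e'_2\Lambda'e'_1=0$, $\sigma:=\operatorname{cone}\{(0,-1),(1,-1)\}\in\Sigma(\Lambda)$ and $\sigma':=\operatorname{cone}\{(1,-1),(1,0)\}\in\Sigma(\Lambda')$. Then there exists a finite-dimensional elementary $k$-algebra $\Gamma$ of rank $2$ (with a complete set of primitive orthogonal idempotents) such that the set of $2$-dimensional cones of $\Sigma(\Gamma)$ equals $(\Sigma(\Lambda)_2\setminus\{\sigma\})\cup(\Sigma(\Lambda')_2\setminus\{\sigma'\})$, where $\Sigma_2$ denotes the set of $2$-dimensional cones of a fan $\Sigma$.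
   Context: $k$ is a field; elementary means $\Lambda/J_\Lambda$ is a product of copies of $k$. The $g$-fan $\Sigma(\Lambda)$ consists of the cones $\operatorname{cone}\{[T_1],\dots,[T_m]\}$ for basic 2-term presilting complexes $T=\bigoplus T_i$ (indecomposable $T_i$) in $K^b(\operatorname{proj}\Lambda)$ (2-term: concentrated in degrees $-1,0$; presilting: $\operatorname{Hom}(T,T[\ell])=0$ for all $\ell>0$; $[T]=[T^0]-[T^{-1}]$), viewed in $\mathbb{R}^2$ via $[e_1\Lambda]\mapsto(1,0)$, $[e_2\Lambda]\mapsto(0,1)$; similarly for $\Lambda'$ and $\Gamma$. *)

(* Defs.v *)
From HB Require Import structures.
From mathcomp Require Import all_boot all_order all_algebra all_field.
From mathcomp Require Import Rstruct.
From Stdlib Require Rdefinitions.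
Unset Printing Implicit Defensive.
Import Order.TTheory GRing.Theory Num.Theory.
Local Open Scope ring_scope.

Definition plane := 'rV[Rdefinitions.R]_2.
Definition i1 : 'I_2 := @Ordinal 2 0 isT.
Definition i2 : 'I_2 := @Ordinal 2 1 isT.
Definition vec2 (a b : Rdefinitions.R) : plane := \row_(i < 2) (if i == i1 then a else b).

Definition cone (vs : seq plane) : plane -> Prop :=
  fun x => exists c : 'I_(size vs) -> Rdefinitions.R,
    (forall i, 0 <= c i) /\ x = \sum_(i < size vs) c i *: nth 0 vs i.

Definition same_set (C D : plane -> Prop) : Prop := forall x, C x <-> D x.

Definition dim2 (C : plane -> Prop) : Prop :=
  exists u v : plane, C u /\ C v /\ u 0 i1 * v 0 i2 - u 0 i2 * v 0 i1 != 0.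

Section Algebra.
Variables (k : fieldType) (A : falgType k).

Definition idem (x : A) := x * x = x.

Definition jacobson (x : A) : Prop := forall y : A, (1 - y * x) \is a GRing.unit.

(* A / J_A is isomorphic (as a k-algebra) to k^n *)
Definition elementary_rank (n : nat) : Prop :=
  exists phi : A -> {ffun 'I_n -> k},
    (forall x y, phi (x + y) = phi x + phi y) /\
    (forall x y, phi (x * y) = phi x * phi y) /\
    phi 1 = 1 /\
    (forall (c : k) x, phi (c *: x) = [ffun i => c * phi x i]) /\
    (forall f, exists x, phi x = f) /\
    (forall x, phi x = 0 <-> jacobson x).

Definition primitive_idem (x : A) : Prop :=
  idem x /\ x != 0 /\
  forall a b : A, idem a -> idem b -> a * b = 0 -> b * a = 0 -> x = a + b ->
    a = 0 \/ b = 0.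

Definition complete_prim2 (e : 'I_2 -> A) : Prop :=
  primitive_idem (e i1) /\ primitive_idem (e i2) /\
  e i1 * e i2 = 0 /\ e i2 * e i1 = 0 /\ e i1 + e i2 = 1.

Variable e : 'I_2 -> A.

(* 2-term complexes of projectives T^{-1} -> T^0, where
   T^{-1} = (+)_{j} e_{lab1 j} A and T^0 = (+)_{j} e_{lab0 j} A.
   A map (+)_c e_{s c} A -> (+)_r e_{t r} A is a matrix M with
   M r c in e_{t r} A e_{s c} = Hom(e_{s c} A, e_{t r} A) (left mult.);
   composition is matrix product. *)
Record cpx := Cpx {
  n1 : nat; n0 : nat;
  lab1 : 'I_n1 -> 'I_2; lab0 : 'I_n0 -> 'I_2;
  dif : 'M[A]_(n0, n1) }.

Definition wt (q p : nat) (t : 'I_q -> 'I_2) (s : 'I_p -> 'I_2) (M : 'M[A]_(q, p)) :=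
  forall r c, M r c = e (t r) * M r c * e (s c).

Definition is_cpx (T : cpx) := wt _ _ (lab0 T) (lab1 T) (dif T).

Definition idm (n : nat) (lab : 'I_n -> 'I_2) : 'M[A]_n :=
  \matrix_(i, j) ((i == j)%:R * e (lab i)).

Definition chain_map (T U : cpx) (f1 : 'M[A]_(n1 U, n1 T)) (f0 : 'M[A]_(n0 U, n0 T)) :=
  wt _ _ (lab1 U) (lab1 T) f1 /\ wt _ _ (lab0 U) (lab0 T) f0 /\ f0 *m dif T = dif U *m f1.

Definition homotopic (T U : cpx) (f1 g1 : 'M[A]_(n1 U, n1 T)) (f0 g0 : 'M[A]_(n0 U, n0 T)) :=
  exists h : 'M[A]_(n1 U, n0 T), wt _ _ (lab1 U) (lab0 T) h /\
    f0 - g0 = dif U *m h /\ f1 - g1 = h *m dif T.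

Definition isoK (T U : cpx) :=
  exists f1 f0 g1 g0, chain_map T U f1 f0 /\ chain_map U T g1 g0 /\
    homotopic T T (g1 *m f1) (idm _ (lab1 T)) (g0 *m f0) (idm _ (lab0 T)) /\
    homotopic U U (f1 *m g1) (idm _ (lab1 U)) (f0 *m g0) (idm _ (lab0 U)).

Definition zeroK (T : cpx) := homotopic T T (idm _ (lab1 T)) 0 (idm _ (lab0 T)) 0.

Definition lab_sum (m n : nat) (a : 'I_m -> 'I_2) (b : 'I_n -> 'I_2) : 'I_(m + n) -> 'I_2 :=
  fun i => match split i with inl x => a x | inr y => b y end.

Definition dsum (T U : cpx) : cpx :=
  Cpx (n1 T + n1 U) (n0 T + n0 U) (lab_sum _ _ (lab1 T) (lab1 U)) (lab_sum _ _ (lab0 T) (lab0 U))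
    (block_mx (dif T) 0 0 (dif U)).

Definition cpx0 : cpx := Cpx 0 0 (fun i => i1) (fun i => i1) 0.

Definition bigdsum (ts : seq cpx) : cpx := foldr dsum cpx0 ts.

Definition indecK (T : cpx) :=
  is_cpx T /\ ~ zeroK T /\
  forall U V, is_cpx U -> is_cpx V -> isoK T (dsum U V) -> zeroK U \/ zeroK V.

(* presilting for a 2-term complex: Hom_K(T, T[1]) = 0, i.e. every
   f : T^{-1} -> T^0 is null-homotopic (Hom(T,T[l]) = 0 automatically for l >= 2) *)
Definition presilting (T : cpx) :=
  is_cpx T /\
  forall f : 'M[A]_(n0 T, n1 T), wt _ _ (lab0 T) (lab1 T) f ->
    exists (h1 : 'M[A]_(n1 T)) (h0 : 'M[A]_(n0 T)),
      wt _ _ (lab1 T) (lab1 T) h1 /\ wt _ _ (lab0 T) (lab0 T) h0 /\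
      f = dif T *m h1 + h0 *m dif T.

(* g-vector [T] = [T^0] - [T^{-1}], with [e_1 A] = (1,0), [e_2 A] = (0,1) *)
Definition gvec (T : cpx) : plane :=
  \row_(i < 2) ((#|[pred j | lab0 T j == i]|%:Z - #|[pred j | lab1 T j == i]|%:Z)%:~R).

(* C is a cone of the g-fan: C = cone{[T_1],..,[T_m]} for a basic 2-term
   presilting T = T_1 (+) ... (+) T_m with T_i indecomposable *)
Definition in_gfan (C : plane -> Prop) : Prop :=
  exists ts : seq cpx,
    (forall i : 'I_(size ts), indecK (nth cpx0 ts i)) /\
    (forall i j : 'I_(size ts), i != j -> ~ isoK (nth cpx0 ts i) (nth cpx0 ts j)) /\
    presilting (bigdsum ts) /\
    same_set C (cone (map gvec ts)).

End Algebra.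

(* Main.v *)
(** Put X = e_1 L e_2 and Y = e'_1 L' e'_2. That sigma lies in the g-fan of L
    means that X = x (e_2 L e_2) is a nonzero cyclic right module, so X modulo
    its radical is k and L maps onto the path algebra k A_2 of triangular 2x2
    matrices; dually Y is a cyclic left module and L' maps onto k A_2. The
    algebra G is the fibre product of L and L' over k A_2.

    A minimal 2-term presilting complex over L, L' or G either admits no
    nonzero map from degree -1 to degree 0, or is given by a matrix P_2^a ->
    P_1^b; reducing the latter to k A_2 yields a matrix over k of full rank.
    If the rank is b, cyclicity of X lets one split off copies of P_2[1] over L,
    so over L only sigma arises in this way; dually for rank a over L' and
    sigma'. For complexes with no maps between the two degrees and for complexes
    of rank a, base change from G to L is a bijection on isomorphism classes
    compatible with direct sums and presilting, because a matrix with entries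
    in the kernel of G -> L factors through any matrix of rank a, by cyclicity
    of Y. The same holds for rank b and L'. *)

Require Import Defs.
From HB Require Import structures.
From mathcomp Require Import all_boot all_order all_algebra all_field lra.
From mathcomp Require Import Rstruct.
From Stdlib Require Rdefinitions.
From Stdlib Require Import Classical ClassicalEpsilon.
Import Order.TTheory GRing.Theory Num.Theory.
Local Open Scope ring_scope.

Set Implicit Arguments.
Unset Strict Implicit.
Unset Printing Implicit Defensive.

Arguments n1 {k A}.
Arguments n0 {k A}.
Arguments lab1 {k A}.
Arguments lab0 {k A}.
Arguments dif {k A}.
Arguments Cpx {k A n1 n0}.
Arguments wt {k A} e {q p}.
Arguments is_cpx {k A}.
Arguments idm {k A} e {n}.
Arguments chain_map {k A} e {T U}.
Arguments homotopic {k A} e {T U}.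
Arguments isoK {k A}.
Arguments zeroK {k A}.
Arguments lab_sum {m n}.
Arguments dsum {k A}.
Arguments cpx0 {k A}.
Arguments bigdsum {k A}.
Arguments indecK {k A}.
Arguments presilting {k A}.
Arguments gvec {k A}.

(** * Two-term complexes up to homotopy *)

(** The fan hypotheses only provide summands whose g-vectors lie on the two rays of a corner cone:
    for sigma some P_2^m[1] and some square matrix P_2^n -> P_1^n with n unknown. Cyclicity of X is
    therefore obtained by a Nakayama argument on the diagonal matrices y I, not read off a single
    map P_2 -> P_1. The rank over k A_2 is the right invariant because it constrains a whole
    presilting family at once: if Hom(T, U[1]) = 0, then the reduced matrix of U has full row rank
    or that of T has full column rank. Rank a implies a <= b and so selects the half x + y >= 0 of
    the fourth quadrant, rank b the other half; Hom(P_1, P_2) = 0 disposes of the remaining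
    quadrants. Comparison along G -> L meets a single obstruction, a map T^{-1} -> U^0 with entries
    in the kernel. If it is null-homotopic through maps in the kernel, then chain maps, homotopies
    and, the kernel being radical, isomorphisms all lift. The kernel of G -> L sits inside L', which
    is why Y governs the comparison with L, and X the one with L'. *)

Section Complexes.
Variables (k : fieldType) (A : falgType k) (e : 'I_2 -> A).
Hypothesis ee : forall i, e i * e i = e i.

Lemma idm_mulmxE q p (t : 'I_q -> 'I_2) (M : 'M[A]_(q, p)) r c :
  (idm e t *m M) r c = e (t r) * M r c.
Proof.
rewrite mxE (bigD1 r) //= mxE eqxx mul1r big1 ?addr0 // => j ne_jr.
by rewrite mxE eq_sym (negPf ne_jr) mul0r mul0r.
Qed.

Lemma mulmx_idmE q p (s : 'I_p -> 'I_2) (M : 'M[A]_(q, p)) r c :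
  (M *m idm e s) r c = M r c * e (s c).
Proof.
rewrite mxE (bigD1 c) //= mxE eqxx mul1r big1 ?addr0 // => j ne_jc.
by rewrite mxE (negPf ne_jc) mul0r mulr0.
Qed.

Lemma idm_idem n (s : 'I_n -> 'I_2) : idm e s *m idm e s = idm e s.
Proof.
apply/matrixP=> r c; rewrite idm_mulmxE mxE.
by case: eqP => _; rewrite ?mul1r ?ee // !mul0r mulr0.
Qed.

Lemma wtP q p (t : 'I_q -> 'I_2) (s : 'I_p -> 'I_2) (M : 'M[A]_(q, p)) :
  wt e t s M <-> idm e t *m M = M /\ M *m idm e s = M.
Proof.
split=> [wtM | [tM Ms] r c]; last by rewrite -idm_mulmxE tM -mulmx_idmE Ms.
have defM: M = idm e t *m M *m idm e s.
  by apply/matrixP=> r c; rewrite mulmx_idmE idm_mulmxE -wtM.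
by split; rewrite {1}defM ?mulmxA ?idm_idem -?mulmxA ?idm_idem ?mulmxA -defM.
Qed.

Lemma wtL q p (t : 'I_q -> 'I_2) (s : 'I_p -> 'I_2) (M : 'M[A]_(q, p)) :
  wt e t s M -> idm e t *m M = M.
Proof. by case/wtP. Qed.

Lemma wtR q p (t : 'I_q -> 'I_2) (s : 'I_p -> 'I_2) (M : 'M[A]_(q, p)) :
  wt e t s M -> M *m idm e s = M.
Proof. by case/wtP. Qed.

Lemma wt_idm n (s : 'I_n -> 'I_2) : wt e s s (idm e s).
Proof. by apply/wtP; rewrite idm_idem. Qed.

Lemma wt0 q p (t : 'I_q -> 'I_2) (s : 'I_p -> 'I_2) : wt e t s 0.
Proof. by apply/wtP; rewrite mulmx0 mul0mx. Qed.

Lemma wtD q p (t : 'I_q -> 'I_2) (s : 'I_p -> 'I_2) (M N : 'M[A]_(q, p)) :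
  wt e t s M -> wt e t s N -> wt e t s (M + N).
Proof.
move=> /wtP[tM Ms] /wtP[tN Ns].
by apply/wtP; rewrite mulmxDl mulmxDr tM Ms tN Ns.
Qed.

Lemma wtN q p (t : 'I_q -> 'I_2) (s : 'I_p -> 'I_2) (M : 'M[A]_(q, p)) :
  wt e t s M -> wt e t s (- M).
Proof. by move=> /wtP[tM Ms]; apply/wtP; rewrite mulmxN mulNmx tM Ms. Qed.

Lemma wtB q p (t : 'I_q -> 'I_2) (s : 'I_p -> 'I_2) (M N : 'M[A]_(q, p)) :
  wt e t s M -> wt e t s N -> wt e t s (M - N).
Proof. by move=> wM wN; apply: wtD => //; apply: wtN. Qed.

Lemma wtM q p l (t : 'I_q -> 'I_2) (u : 'I_l -> 'I_2) (s : 'I_p -> 'I_2)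
    (M : 'M[A]_(q, l)) (N : 'M[A]_(l, p)) :
  wt e t u M -> wt e u s N -> wt e t s (M *m N).
Proof.
move=> /wtP[tM _] /wtP[_ Ns].
by apply/wtP; rewrite mulmxA tM -mulmxA Ns.
Qed.

Lemma wt_sandwich q p (t : 'I_q -> 'I_2) (s : 'I_p -> 'I_2)
  (M : 'M[A]_(q, p)) : wt e t s (idm e t *m M *m idm e s).
Proof.
by apply/wtP; rewrite -!mulmxA idm_idem !mulmxA idm_idem.
Qed.

Lemma idm_lab_sum m n (a : 'I_m -> 'I_2) (b : 'I_n -> 'I_2) :
  idm e (lab_sum a b) = block_mx (idm e a) 0 0 (idm e b).
Proof.
apply/matrixP=> i j; rewrite mxE /lab_sum /block_mx !mxE.
case: (split_ordP i) => i' ->; rewrite !mxE;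
  case: (split_ordP j) => j' ->; rewrite !mxE ?eq_lrshift ?eq_rlshift ?mul0r //.
by rewrite eq_rshift.
Qed.

Lemma wt_block q q' p p' (t : 'I_q -> 'I_2) (t' : 'I_q' -> 'I_2)
    (s : 'I_p -> 'I_2) (s' : 'I_p' -> 'I_2) M11 M12 M21 M22 :
  wt e (lab_sum t t') (lab_sum s s') (block_mx M11 M12 M21 M22) <->
  [/\ wt e t s M11, wt e t s' M12, wt e t' s M21 & wt e t' s' M22].
Proof.
split=> [/wtP[] | [/wtP[a1 b1] /wtP[a2 b2] /wtP[a3 b3] /wtP[a4 b4]]].
  rewrite !idm_lab_sum !mulmx_block !mulmx0 !mul0mx !addr0 !add0r.
  by move=> /eq_block_mx[? ? ? ?] /eq_block_mx[? ? ? ?]; split; apply/wtP.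
apply/wtP; rewrite !idm_lab_sum !mulmx_block !mulmx0 !mul0mx !addr0 !add0r.
by rewrite a1 a2 a3 a4 b1 b2 b3 b4.
Qed.

Lemma wt_block_row p p' q (t : 'I_q -> 'I_2) (s : 'I_p -> 'I_2)
    (s' : 'I_p' -> 'I_2) M1 M2 :
  wt e t (lab_sum s s') (row_mx M1 M2) <-> wt e t s M1 /\ wt e t s' M2.
Proof.
split=> [/wtP[] | [/wtP[a1 b1] /wtP[a2 b2]]].
  rewrite mul_mx_row idm_lab_sum mul_row_block !mulmx0 addr0 add0r.
  by move=> /eq_row_mx[? ?] /eq_row_mx[? ?]; split; apply/wtP.
apply/wtP; rewrite mul_mx_row idm_lab_sum mul_row_block !mulmx0 addr0 add0r.
by rewrite a1 a2 b1 b2.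
Qed.

Lemma wt_block_col q q' p (t : 'I_q -> 'I_2) (t' : 'I_q' -> 'I_2)
    (s : 'I_p -> 'I_2) M1 M2 :
  wt e (lab_sum t t') s (col_mx M1 M2) <-> wt e t s M1 /\ wt e t' s M2.
Proof.
split=> [/wtP[] | [/wtP[a1 b1] /wtP[a2 b2]]].
  rewrite mul_col_mx idm_lab_sum mul_block_col !mul0mx addr0 add0r.
  by move=> /eq_col_mx[? ?] /eq_col_mx[? ?]; split; apply/wtP.
apply/wtP; rewrite mul_col_mx idm_lab_sum mul_block_col !mul0mx addr0 add0r.
by rewrite a1 a2 b1 b2.
Qed.

Lemma chain_map_id T : is_cpx e T -> @chain_map _ _ e T T (idm e (lab1 T)) (idm e (lab0 T)).
Proof.
move=> cT; split; first exact: wt_idm; split; first exact: wt_idm.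
by rewrite (wtL cT) (wtR cT).
Qed.

Lemma chain_map_comp T U V f1 f0 g1 g0 :
  @chain_map _ _ e T U f1 f0 -> @chain_map _ _ e U V g1 g0 ->
  @chain_map _ _ e T V (g1 *m f1) (g0 *m f0).
Proof.
case=> wf1 [wf0 cf] [wg1 [wg0 cg]]; split; first exact: wtM wg1 wf1.
split; first exact: wtM wg0 wf0.
by rewrite -mulmxA cf mulmxA cg mulmxA.
Qed.

Lemma homotopic_refl T U f1 f0 : @homotopic _ _ e T U f1 f1 f0 f0.
Proof. by exists 0; rewrite mulmx0 mul0mx !subrr; split=> //; apply: wt0. Qed.

Lemma homotopic_sym T U f1 g1 f0 g0 :
  @homotopic _ _ e T U f1 g1 f0 g0 -> homotopic e g1 f1 g0 f0.
Proof.
case=> h [wh [h0 h1]]; exists (- h); split; first exact: wtN.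
by rewrite mulmxN mulNmx -h0 -h1 !opprB.
Qed.

Lemma homotopic_trans T U f1 g1 l1 f0 g0 l0 :
  @homotopic _ _ e T U f1 g1 f0 g0 -> @homotopic _ _ e T U g1 l1 g0 l0 ->
  homotopic e f1 l1 f0 l0.
Proof.
case=> h [wh [h0 h1]] [h' [wh' [h0' h1']]]; exists (h + h').
split; first exact: wtD.
by rewrite mulmxDl mulmxDr -h0 -h1 -h0' -h1' !addrA !subrK.
Qed.

Lemma homotopic_comp T U V W a1 a0 f1 g1 f0 g0 b1 b0 :
  @chain_map _ _ e T U a1 a0 -> @chain_map _ _ e V W b1 b0 ->
  @homotopic _ _ e U V f1 g1 f0 g0 ->
  @homotopic _ _ e T W (b1 *m f1 *m a1) (b1 *m g1 *m a1)
    (b0 *m f0 *m a0) (b0 *m g0 *m a0).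
Proof.
case=> wa1 [wa0 ca] [wb1 [wb0 cb]] [h [wh [h0 h1]]].
exists (b1 *m h *m a0); split; first exact: wtM (wtM wb1 wh) wa0.
rewrite -!mulmxBl -!mulmxBr h0 h1; split; first by rewrite !mulmxA cb.
by rewrite -!mulmxA ca.
Qed.

Lemma isoK_refl T : is_cpx e T -> isoK e T T.
Proof.
move=> cT; exists (idm e (lab1 T)), (idm e (lab0 T)), (idm e (lab1 T)),
  (idm e (lab0 T)).
by rewrite !idm_idem; do !split => //; try exact: (chain_map_id cT).1;
   try exact: (chain_map_id cT).2.1; try exact: (chain_map_id cT).2.2;
   exact: homotopic_refl.
Qed.

Lemma isoK_sym T U : isoK e T U -> isoK e U T.
Proof. by case=> f1 [f0 [g1 [g0 [? [? [? ?]]]]]]; exists g1, g0, f1, f0. Qed.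

Lemma isoK_trans T U V : isoK e T U -> isoK e U V -> isoK e T V.
Proof.
case=> f1 [f0 [g1 [g0 [cf [cg [gf fg]]]]]].
case=> f1' [f0' [g1' [g0' [cf' [cg' [gf' fg']]]]]].
exists (f1' *m f1), (f0' *m f0), (g1 *m g1'), (g0 *m g0').
split; first exact: chain_map_comp cf cf'.
split; first exact: chain_map_comp cg' cg.
split.
  have:= homotopic_comp cf cg gf'.
  rewrite !mulmxA => /homotopic_trans; apply.
  by rewrite -!mulmxA (wtL cf.1) (wtL cf.2.1).
have:= homotopic_comp cg' cf' fg.
rewrite !mulmxA => /homotopic_trans; apply.
by rewrite -!mulmxA (wtL cg'.1) (wtL cg'.2.1).
Qed.

(** With g a left and l a right homotopy inverse of f, one has f g ~ f g f l ~ f l ~ 1. Lifted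
    isomorphisms come with one-sided inverses of this kind. *)
Lemma isoK_of_one_sided T U f1 f0 g1 g0 l1 l0 : is_cpx e U ->
  @chain_map _ _ e T U f1 f0 -> @chain_map _ _ e U T g1 g0 ->
  @chain_map _ _ e U T l1 l0 ->
  homotopic e (g1 *m f1) (idm e (lab1 T)) (g0 *m f0) (idm e (lab0 T)) ->
  homotopic e (f1 *m l1) (idm e (lab1 U)) (f0 *m l0) (idm e (lab0 U)) ->
  isoK e T U.
Proof.
move=> cU cf cg cl gf fl; exists f1, f0, g1, g0; do 3?split => //.
refine (homotopic_trans _ fl).
have fgfl := homotopic_comp cl cf gf.
rewrite (wtR cf.1) (wtR cf.2.1) in fgfl; refine (homotopic_trans _ fgfl).
have := homotopic_sym (homotopic_comp
  (chain_map_id cU) (chain_map_comp cg cf) fl).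
rewrite -!mulmxA (wtR cl.1) (wtR cl.2.1) !idm_idem (wtR cg.1) (wtR cg.2.1).
exact.
Qed.

Lemma dsum_chain_map T U T' U' f1 f0 g1 g0 :
  @chain_map _ _ e T T' f1 f0 -> @chain_map _ _ e U U' g1 g0 ->
  @chain_map _ _ e (dsum T U) (dsum T' U') (block_mx f1 0 0 g1) (block_mx f0 0 0 g0).
Proof.
case=> wf1 [wf0 cf] [wg1 [wg0 cg]].
split; first by apply/wt_block; split=> //; apply: wt0.
split; first by apply/wt_block; split=> //; apply: wt0.
by rewrite /= !mulmx_block !mulmx0 !mul0mx !addr0 !add0r cf cg.
Qed.

Lemma dsum_homotopic T U T' U' f1 f0 g1 g0 a1 a0 b1 b0 :
  @homotopic _ _ e T T' f1 a1 f0 a0 -> @homotopic _ _ e U U' g1 b1 g0 b0 ->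
  @homotopic _ _ e (dsum T U) (dsum T' U') (block_mx f1 0 0 g1)
    (block_mx a1 0 0 b1) (block_mx f0 0 0 g0) (block_mx a0 0 0 b0).
Proof.
case=> h [wh [h0 h1]] [h' [wh' [h0' h1']]]; exists (block_mx h 0 0 h').
split; first by apply/wt_block; split=> //; apply: wt0.
rewrite /= !opp_block_mx !add_block_mx !mulmx_block !mulmx0 !mul0mx.
by rewrite !oppr0 !addr0 !add0r h0 h1 h0' h1'.
Qed.

Lemma dsum_isoK T U T' U' :
  isoK e T T' -> isoK e U U' -> isoK e (dsum T U) (dsum T' U').
Proof.
case=> f1 [f0 [g1 [g0 [cf [cg [gf fg]]]]]].
case=> f1' [f0' [g1' [g0' [cf' [cg' [gf' fg']]]]]].
exists (block_mx f1 0 0 f1'), (block_mx f0 0 0 f0'), (block_mx g1 0 0 g1'),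
  (block_mx g0 0 0 g0').
split; first exact: dsum_chain_map.
split; first exact: dsum_chain_map.
rewrite !mulmx_block !mulmx0 !mul0mx !addr0 !add0r /= !idm_lab_sum.
by split; apply: dsum_homotopic.
Qed.

Lemma is_cpx_dsum T U : is_cpx e (dsum T U) <-> is_cpx e T /\ is_cpx e U.
Proof.
rewrite /is_cpx /= wt_block; split=> [[] // | []]; split=> //; exact: wt0.
Qed.

(* [hom1 T U] says that Hom(T, U[1]) = 0 in the homotopy category. *)
Definition hom1 (T U : cpx k A) :=
  forall f : 'M[A]_(n0 U, n1 T), wt e (lab0 U) (lab1 T) f ->
  exists (h1 : 'M[A]_(n1 U, n1 T)) (h0 : 'M[A]_(n0 U, n0 T)),
    [/\ wt e (lab1 U) (lab1 T) h1, wt e (lab0 U) (lab0 T) h0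
      & f = dif U *m h1 + h0 *m dif T].

Lemma hom1_dsuml T U V : hom1 (dsum T U) V <-> hom1 T V /\ hom1 U V.
Proof.
split=> [hTU | [hT hU] f].
  split=> f wf.
    have [|h1 [h0 []]] := hTU (row_mx f 0).
      by apply/wt_block_row; split=> //; apply: wt0.
    rewrite -(hsubmxK h1) -(hsubmxK h0) => /wt_block_row[w1 _] /wt_block_row[w0 _].
    rewrite /= mul_mx_row mul_row_block !mulmx0 addr0 add0r add_row_mx.
    by move=> /eq_row_mx[-> _]; exists (lsubmx h1), (lsubmx h0).
  have [|h1 [h0 []]] := hTU (row_mx 0 f).
    by apply/wt_block_row; split=> //; apply: wt0.
  rewrite -(hsubmxK h1) -(hsubmxK h0) => /wt_block_row[_ w1] /wt_block_row[_ w0].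
  rewrite /= mul_mx_row mul_row_block !mulmx0 addr0 add0r add_row_mx.
  by move=> /eq_row_mx[_ ->]; exists (rsubmx h1), (rsubmx h0).
rewrite -(hsubmxK f) => /wt_block_row[wl wr].
have [h1 [h0 [w1 w0 ->]]] := hT _ wl.
have [h1' [h0' [w1' w0' ->]]] := hU _ wr.
exists (row_mx h1 h1'), (row_mx h0 h0'); split.
- exact/wt_block_row.
- exact/wt_block_row.
by rewrite /= mul_mx_row mul_row_block !mulmx0 addr0 add0r add_row_mx.
Qed.

Lemma hom1_dsumr T U V : hom1 V (dsum T U) <-> hom1 V T /\ hom1 V U.
Proof.
split=> [hTU | [hT hU] f].
  split=> f wf.
    have [|h1 [h0 []]] := hTU (col_mx f 0).
      by apply/wt_block_col; split=> //; apply: wt0.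
    rewrite -(vsubmxK h1) -(vsubmxK h0) => /wt_block_col[w1 _] /wt_block_col[w0 _].
    rewrite /= mul_block_col mul_col_mx !mul0mx addr0 add0r add_col_mx.
    by move=> /eq_col_mx[-> _]; exists (usubmx h1), (usubmx h0).
  have [|h1 [h0 []]] := hTU (col_mx 0 f).
    by apply/wt_block_col; split=> //; apply: wt0.
  rewrite -(vsubmxK h1) -(vsubmxK h0) => /wt_block_col[_ w1] /wt_block_col[_ w0].
  rewrite /= mul_block_col mul_col_mx !mul0mx addr0 add0r add_col_mx.
  by move=> /eq_col_mx[_ ->]; exists (dsubmx h1), (dsubmx h0).
rewrite -(vsubmxK f) => /wt_block_col[wl wr].
have [h1 [h0 [w1 w0 ->]]] := hT _ wl.
have [h1' [h0' [w1' w0' ->]]] := hU _ wr.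
exists (col_mx h1 h1'), (col_mx h0 h0'); split.
- exact/wt_block_col.
- exact/wt_block_col.
by rewrite /= mul_block_col mul_col_mx !mul0mx addr0 add0r add_col_mx.
Qed.

Lemma hom1_cpx0l V : hom1 cpx0 V.
Proof.
by move=> f _; exists 0, 0; split; try exact: wt0; apply/matrixP=> ? [].
Qed.

Lemma hom1_cpx0r V : hom1 V cpx0.
Proof.
by move=> f _; exists 0, 0; split; try exact: wt0; apply/matrixP=> -[].
Qed.

Lemma hom1_bigdsuml ts V :
  hom1 (bigdsum ts) V <-> forall i, (i < size ts)%N -> hom1 (nth cpx0 ts i) V.
Proof.
elim: ts => [|T ts IH] /=; first by split=> // _; exact: hom1_cpx0l.
rewrite hom1_dsuml IH; split=> [[hT hts] [|i] // /hts // | hts].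
by split=> [|i]; [exact: (hts 0%N) | exact: (hts i.+1)].
Qed.

Lemma hom1_bigdsumr ts V :
  hom1 V (bigdsum ts) <-> forall i, (i < size ts)%N -> hom1 V (nth cpx0 ts i).
Proof.
elim: ts => [|T ts IH] /=; first by split=> // _; exact: hom1_cpx0r.
rewrite hom1_dsumr IH; split=> [[hT hts] [|i] // /hts // | hts].
by split=> [|i]; [exact: (hts 0%N) | exact: (hts i.+1)].
Qed.

Lemma is_cpx_bigdsum ts :
  is_cpx e (bigdsum ts) <-> forall i, (i < size ts)%N -> is_cpx e (nth cpx0 ts i).
Proof.
elim: ts => [|T ts IH] /=; first by split=> // _ [].
rewrite is_cpx_dsum IH; split=> [[hT hts] [|i] // /hts // | hts].
by split=> [|i]; [exact: (hts 0%N) | exact: (hts i.+1)].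
Qed.

(** Hom(-, -[1]) is additive in both arguments, so being presilting is a condition on ordered pairs
    of summands, the form in which base change is applied. *)
Lemma presilting_bigdsum ts :
  presilting e (bigdsum ts) <->
  (forall i, (i < size ts)%N -> is_cpx e (nth cpx0 ts i)) /\
  (forall i j, (i < size ts)%N -> (j < size ts)%N ->
     hom1 (nth cpx0 ts i) (nth cpx0 ts j)).
Proof.
transitivity (is_cpx e (bigdsum ts) /\ hom1 (bigdsum ts) (bigdsum ts)).
  split=> -[cts hts]; split=> // f /hts[h1 [h0]].
    by case=> ? [? ?]; exists h1, h0.
  by case=> ? ? ?; exists h1, h0.
rewrite is_cpx_bigdsum hom1_bigdsuml; split=> -[cts hts]; split=> // i.
  by move=> j /hts/hom1_bigdsumr; apply.
by move=> lti; apply/hom1_bigdsumr=> j; apply: hts.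
Qed.

Lemma hom1_isoK T U T' U' :
  is_cpx e T' -> is_cpx e U' -> isoK e T T' -> isoK e U U' -> hom1 T U -> hom1 T' U'.
Proof.
move=> cT' cU' [f1 [f0 [g1 [g0 [cf [cg [_ [h [wh [fg0 fg1]]]]]]]]]].
case=> a1 [a0 [b1 [b0 [ca [cb [_ [l [wl [ab0 ab1]]]]]]]]] hTU F wF.
have [|h1 [h0 [w1 w0 defF]]] := hTU (b0 *m F *m f1).
  by apply: wtM (wtM cb.2.1 wF) cf.1.
(* Transporting back gives [a0 b0 F f1 g1] instead of [F]; the corrections come from
   [a0 b0 - 1 = dif U' l] and [f1 g1 - 1 = h dif T']. *)
exists (a1 *m h1 *m g1 - l *m F *m (f1 *m g1)), (a0 *m h0 *m g0 - F *m h).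
split.
- apply: wtB; first exact: wtM (wtM ca.1 w1) cg.1.
  exact: wtM (wtM wl wF) (wtM cf.1 cg.1).
- by apply: wtB; [exact: wtM (wtM ca.2.1 w0) cg.2.1 | exact: wtM wF wh].
have: a0 *m (b0 *m F *m f1) *m g1 = dif U' *m (a1 *m h1 *m g1) + a0 *m h0 *m g0 *m dif T'.
  rewrite defF mulmxDr mulmxDl !mulmxA ca.2.2; congr (_ + _).
  by rewrite -!mulmxA cg.2.2.
rewrite mulmxBr mulmxBl addrACA => <-.
have -> : F *m h *m dif T' = F *m (f1 *m g1) - F.
  by rewrite -mulmxA -fg1 mulmxBr (wtR wF).
have -> : dif U' *m (l *m F *m (f1 *m g1)) = a0 *m b0 *m F *m (f1 *m g1) - F *m (f1 *m g1).
  by rewrite !mulmxA -ab0 !mulmxBl (wtL wF).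
by rewrite -opprD !mulmxA addrA subrK opprB subrKC.
Qed.

Lemma zeroK_isoK T U : isoK e T U -> zeroK e T -> zeroK e U.
Proof.
case=> f1 [f0 [g1 [g0 [cf [cg [_ fg]]]]]] zT.
have fzg := homotopic_comp cg cf zT.
apply: homotopic_trans (homotopic_sym fg) _.
move: fzg; rewrite !mulmx0 !mul0mx.
by rewrite (wtR cf.1) (wtR cf.2.1).
Qed.

Lemma indecK_isoK T U : is_cpx e U -> isoK e T U -> indecK e T -> indecK e U.
Proof.
move=> cU isoTU [cT [nzT decT]]; split=> //; split.
  by move=> zU; apply: nzT; apply: zeroK_isoK zU; apply: isoK_sym.
move=> V W cV cW isoU; apply: decT => //; exact: isoK_trans isoTU isoU.
Qed.

End Complexes.

(** * Residues and minimal complexes *)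

Section Residue.
Variables (k : fieldType) (A : falgType k) (e : 'I_2 -> A).
Variable rho : 'I_2 -> {rmorphism A -> k}.

Definition in_rad (x : A) := forall i, rho i x = 0.

(** The two characters of an elementary algebra of rank 2, labelled compatibly with the idempotents.
    With nilpotency of their joint kernel, this form of elementarity passes easily to a fibre
    product. *)
Record residue_system : Prop := ResidueSystem {
  rs_idem : forall i, e i * e i = e i;
  rs_sum : e i1 + e i2 = 1;
  rs_tri : forall x, e i2 * x * e i1 = 0;
  rs_scale : forall i c x, rho i (c *: x) = c * rho i x;
  rs_rho_e : forall i j, rho i (e j) = (i == j)%:R;
  rs_nil : exists n, forall s : seq A, size s = n ->
    (forall x, x \in s -> in_rad x) -> \prod_(x <- s) x = 0 }.

Definition rad_mx q p (M : 'M[A]_(q, p)) := forall i, map_mx (rho i) M = 0.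

Lemma rad_mxP q p (M : 'M[A]_(q, p)) :
  rad_mx M <-> forall r c, in_rad (M r c).
Proof.
split=> [radM r c i | radM i].
  by have /matrixP/(_ r c) := radM i; rewrite !mxE.
by apply/matrixP=> r c; rewrite !mxE radM.
Qed.

Lemma rad_mxMl q p l (M : 'M[A]_(q, p)) (N : 'M[A]_(p, l)) :
  rad_mx N -> rad_mx (M *m N).
Proof. by move=> radN i; rewrite map_mxM radN mulmx0. Qed.

Lemma rad_mxMr q p l (M : 'M[A]_(q, p)) (N : 'M[A]_(p, l)) :
  rad_mx M -> rad_mx (M *m N).
Proof. by move=> radM i; rewrite map_mxM radM mul0mx. Qed.

Definition minimal (T : cpx k A) := rad_mx (dif T).

Section System.
Hypothesis rs : residue_system.
Let ee := rs_idem rs.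

Lemma rad_mx_nilpotent n (E : 'M[A]_n) : rad_mx E -> exists m, E ^+ m = 0.
Proof.
move=> /rad_mxP radE; have [N nilN] := rs_nil rs; exists N.
(* Induction on the power needs the radical entries split off so far; they are collected in [s], and
   N bounds both counts together. *)
suff E0: forall m s i j, (size s + m = N)%N -> (forall x, x \in s -> in_rad x) ->
    (E ^+ m) i j * \prod_(x <- s) x = 0.
  apply/matrixP=> i j; rewrite mxE -[LHS]mulr1.
  by have := E0 N [::] i j (erefl _); rewrite big_nil; apply.
elim=> [|m IH] s i j szs rads.
  by rewrite nilN ?mulr0 // -szs addn0.
rewrite exprSr mxE mulr_suml big1 // => l _.
rewrite -mulrA; have := IH (E l j :: s) i l; rewrite big_cons; apply.
  by rewrite /= addSnnS.
by move=> x; rewrite inE => /predU1P[-> | /rads].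
Qed.

(** Geometric series for 1 - E, cut down by the idempotent [idm e s], the identity among matrices
    with labels [s]. *)
Lemma idm_sub_rad_inv n (s : 'I_n -> 'I_2) (E : 'M[A]_n) :
  wt e s s E -> rad_mx E ->
  exists S, [/\ wt e s s S, (idm e s - E) *m S = idm e s
              & S *m (idm e s - E) = idm e s].
Proof.
move=> wE /rad_mx_nilpotent[m Em0].
pose S := \sum_(i < m) E ^+ i : 'M[A]_n.
have ES1: (1 - E) *m S = 1.
  have := subrX1 (E : 'M[A]_n) m; rewrite Em0 sub0r => /(congr1 -%R).
  by rewrite opprK -mulNr opprB.
have SE1: S *m (1 - E) = 1.
  rewrite -[RHS]ES1; rewrite /S mulmx_suml mulmx_sumr; apply: eq_bigr => i _.
  rewrite mulmxBr mulmxBl mulmx1 mul1mx; congr (_ - _).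
  by rewrite -[LHS]/(E ^+ i * E) -[RHS]/(E * E ^+ i) -exprSr exprS.
have defE: idm e s - E = idm e s *m (1 - E) by rewrite mulmxBr mulmx1 (wtL ee wE).
have defE': idm e s - E = (1 - E) *m idm e s by rewrite mulmxBl mul1mx (wtR ee wE).
exists (idm e s *m S *m idm e s); split; first exact: wt_sandwich.
  have XI: (idm e s - E) *m idm e s = idm e s - E.
    by rewrite defE' -mulmxA idm_idem.
  by rewrite !mulmxA XI defE -(mulmxA _ _ S) ES1 mulmx1 idm_idem.
have IX: idm e s *m (idm e s - E) = idm e s - E.
  by rewrite defE mulmxA idm_idem.
by rewrite -!mulmxA IX defE' (mulmxA S) SE1 mul1mx idm_idem.
Qed.

Lemma idm_near_inv n (s : 'I_n -> 'I_2) (F : 'M[A]_n) :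
  wt e s s F -> rad_mx (idm e s - F) ->
  exists S, [/\ wt e s s S, F *m S = idm e s & S *m F = idm e s].
Proof.
move=> wF radF.
have [S []] := idm_sub_rad_inv (wtB ee (wt_idm ee s) wF) radF.
by rewrite subKr; exists S.
Qed.

Lemma near_inv q p (t : 'I_q -> 'I_2) (s : 'I_p -> 'I_2) F G :
  wt e t s F -> wt e s t G ->
  rad_mx (idm e t - F *m G) -> rad_mx (idm e s - G *m F) ->
  exists F', [/\ wt e s t F', F *m F' = idm e t & F' *m F = idm e s].
Proof.
move=> wF wG /(idm_near_inv (wtM ee wF wG)) [S [wS FGS _]].
move=> /(idm_near_inv (wtM ee wG wF)) [S' [wS' _ SGF]].
have eqGS : S' *m G = G *m S.
  by rewrite -(wtR ee (wtM ee wS' wG)) -FGS !mulmxA -(mulmxA S') SGF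
     (wtL ee wG).
exists (G *m S); split; first exact: wtM wS.
  by rewrite mulmxA.
by rewrite -eqGS -mulmxA.
Qed.

End System.
End Residue.

Lemma mx_choice (R : Type) q p (P : 'I_q -> 'I_p -> R -> Prop) :
  (forall r c, exists x, P r c x) -> exists M : 'M[R]_(q, p), forall r c, P r c (M r c).
Proof.
move=> exP; have /fin_all_exists[F FP] :
    forall rc : 'I_q * 'I_p, exists x : R, P rc.1 rc.2 x by move=> rc; apply: exP.
by exists (\matrix_(r, c) F (r, c)) => r c; rewrite mxE; apply: (FP (r, c)).
Qed.

Definition elem_mx (R : nzRingType) q p (r : 'I_q) (c : 'I_p) (x : R) :
  'M[R]_(q, p) := \matrix_(i, j) (if (i == r) && (j == c) then x else 0).

Lemma mul_elem_mx (R : nzRingType) q p l (r : 'I_q) (c : 'I_p) (x : R)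
  (M : 'M[R]_(p, l)) i j :
  (elem_mx r c x *m M) i j = if i == r then x * M c j else 0.
Proof.
rewrite mxE (bigD1 c) //= mxE eqxx andbT big1 => [|c' ne_c].
  by rewrite addr0; case: ifP; rewrite ?mul0r.
by rewrite mxE (negPf ne_c) andbF mul0r.
Qed.

Lemma mulmx_elem (R : nzRingType) q p l (r : 'I_q) (c : 'I_p) (x : R)
  (M : 'M[R]_(l, q)) i j :
  (M *m elem_mx r c x) i j = if j == c then M i r * x else 0.
Proof.
rewrite mxE (bigD1 r) //= mxE eqxx /= big1 => [|r' ne_r].
  by rewrite addr0; case: ifP; rewrite ?mulr0.
by rewrite mxE (negPf ne_r) mulr0.
Qed.

Lemma elem_mx_sandwich (R : nzRingType) q p q' p' (r : 'I_q) (c : 'I_p)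
  (r' : 'I_q') (c' : 'I_p') (x y : R) M :
  elem_mx r c x *m M *m elem_mx r' c' y = elem_mx r c' (x * M c r' * y).
Proof.
apply/matrixP=> i j; rewrite mulmx_elem mul_elem_mx mxE.
by case: eqP; rewrite /= ?andbF //; case: eqP; rewrite ?mul0r // if_same.
Qed.

Section Minimal.
Variables (k : fieldType) (A : falgType k) (e : 'I_2 -> A).
Variable rho : 'I_2 -> {rmorphism A -> k}.
Hypothesis rs : residue_system e rho.
Let ee := rs_idem rs.

Lemma wt_elem q p (t : 'I_q -> 'I_2) (s : 'I_p -> 'I_2) r c x :
  e (t r) * x * e (s c) = x -> wt e t s (elem_mx r c x).
Proof.
move=> wx i j; rewrite mxE; case: andP => [[/eqP-> /eqP->] //|_].
by rewrite mulr0 mul0r.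
Qed.

Lemma rho_wt q p (t : 'I_q -> 'I_2) (s : 'I_p -> 'I_2) M i r c :
  wt e t s M -> rho i (M r c) != 0 -> t r = i /\ s c = i.
Proof.
move=> wM; rewrite wM !rmorphM !(rs_rho_e rs).
case: (i =P t r) => [<-|_]; last by rewrite !mul0r eqxx.
by case: (i =P s c) => [<-|_] //; rewrite mulr0 eqxx.
Qed.

(** The corner e_l A e_l is local with residue field k; after scaling the residue to 1, the
    geometric series applies to the 1 x 1 matrix of x. *)
Lemma corner_inv l x : e l * x * e l = x -> rho l x != 0 ->
  exists u, [/\ e l * u * e l = u, u * x = e l & x * u = e l].
Proof.
move=> ex nzx; pose F : 'M[A]_1 := const_mx ((rho l x)^-1 *: x).
pose s : 'I_1 -> 'I_2 := fun=> l.
have wF : wt e s s F.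
  by move=> i j; rewrite !mxE -scalerAr -scalerAl ex.
have radF : rad_mx rho (idm e s - F).
  move=> i; apply/matrixP=> r c; rewrite !mxE !ord1 eqxx mul1r rmorphB.
  rewrite /= (rs_scale rs) (rs_rho_e rs); case: eqVneq => [->|ne_il].
    by rewrite mulVf // subrr.
  by rewrite -ex !rmorphM (rs_rho_e rs i) (negPf ne_il) !mul0r mulr0 subrr.
have [S [wS /matrixP/(_ 0 0) FS /matrixP/(_ 0 0) SF]] := idm_near_inv rs wF radF.
exists ((rho l x)^-1 *: S 0 0); split.
- by rewrite -scalerAr -scalerAl -wS.
- by move: SF; rewrite !mxE big_ord1 eqxx mul1r !mxE -scalerAr -scalerAl.
by move: FS; rewrite !mxE big_ord1 eqxx mul1r !mxE -scalerAr -scalerAl.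
Qed.

Lemma card_lift n (s : 'I_n -> 'I_2) c i :
  #|[pred j | s j == i]| = ((s c == i) + #|[pred j | s (lift c j) == i]|)%N.
Proof.
rewrite -!sum1_card !big_mkcond /= (bigD1_ord c) //=.
rewrite [in RHS]big_mkcond inE.
by congr (_ + _)%N; case: (s c == i).
Qed.

Section Eliminate.
Variables (T : cpx k A) (r : 'I_(n0 T)) (c : 'I_(n1 T)) (u : A).
Let l := lab0 T r.
Hypotheses (cT : is_cpx e T) (eq_l : lab1 T c = l).
Hypotheses (eu : e l * u * e l = u).
Hypotheses (ud : u * dif T r c = e l) (du : dif T r c * u = e l).

Let E := elem_mx c r u.
Let D := dif T - dif T *m E *m dif T.

(** Row r and column c of [D] are zero, so deleting them loses nothing; what remains is the Schur
    complement of the invertible entry. *)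
Definition eliminate : cpx k A :=
  Cpx (fun j => lab1 T (lift c j)) (fun j => lab0 T (lift r j))
    (row' r (col' c D)).

Lemma eliminate_gvec : gvec eliminate = gvec T.
Proof.
apply/rowP=> i; rewrite !mxE /= (card_lift (lab0 T) r) (card_lift (lab1 T) c).
by rewrite eq_l !PoszD opprD addrACA subrr add0r.
Qed.

Let wE : wt e (lab1 T) (lab0 T) E.
Proof. by apply: wt_elem; rewrite eq_l. Qed.

Let wD : wt e (lab0 T) (lab1 T) D.
Proof. by apply: wtB => //; apply: wtM cT => //; apply: wtM cT wE. Qed.

Lemma eliminate_is_cpx : is_cpx e eliminate.
Proof.
move=> i j; have -> : dif eliminate i j = D (lift r i) (lift c j).
  by rewrite /= 2!mxE.
exact: wD.
Qed.

Let drop n (s : 'I_n -> 'I_2) (m : 'I_n) := row' m (idm e s).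
Let incl n (s : 'I_n -> 'I_2) (m : 'I_n) := col' m (idm e s).

Let wt_drop n s m : wt e (fun j => s (lift m j)) s (@drop n s m).
Proof.
move=> i j; rewrite !mxE; case: eqP => [<-|]; rewrite ?mul1r ?ee //.
by rewrite mul0r mulr0 mul0r.
Qed.

Let wt_incl n s m : wt e s (fun j => s (lift m j)) (@incl n s m).
Proof.
move=> i j; rewrite !mxE; case: eqP => [<-|]; rewrite ?mul1r ?ee //.
by rewrite mul0r mulr0 mul0r.
Qed.

Let drop_mul n s m p (M : 'M[A]_(n, p)) : idm e s *m M = M ->
  @drop n s m *m M = row' m M.
Proof. by move=> sM; rewrite /drop !row'Esub mul_rowsub_mx sM. Qed.

Let mul_incl n s m p (M : 'M[A]_(p, n)) : M *m idm e s = M ->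
  M *m @incl n s m = col' m M.
Proof. by move=> Ms; rewrite /incl !col'Esub mulmx_colsub Ms. Qed.

Let drop_incl n s m : @drop n s m *m incl s m = idm e (fun j => s (lift m j)).
Proof.
rewrite drop_mul; last first.
  by rewrite /incl col'Esub mulmx_colsub idm_idem.
by apply/matrixP=> i j; rewrite !mxE (inj_eq lift_inj).
Qed.

Let incl_drop n s m : @incl n s m *m drop s m = idm e s - elem_mx m m (e (s m)).
Proof.
apply/matrixP=> i j; rewrite !mxE.
transitivity (\sum_j' idm e s i j' * idm e s j' j - idm e s i m * idm e s m j).
  rewrite [in RHS](bigD1_ord m) //= addrAC subrr add0r.
  by apply: eq_bigr => j' _; rewrite !mxE.
congr (_ - _).
  by have /matrixP/(_ i j) := idm_idem ee s; rewrite mxE => ->; rewrite mxE.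
rewrite !mxE (eq_sym m); case: eqP => [->|_]; last by rewrite !mul0r.
by case: eqP; rewrite ?mul1r ?ee // mul0r mulr0.
Qed.

(* Gaussian elimination of the invertible entry at (r, c); the homotopy is - E. *)
Lemma eliminate_isoK : isoK e T eliminate.
Proof.
pose I1 := idm e (lab1 T); pose I0 := idm e (lab0 T).
pose dc := elem_mx c c (e l); pose dr := elem_mx r r (e l).
have EDc : E *m dif T *m dc = dc by rewrite elem_mx_sandwich ud ee.
have DrE : dr *m dif T *m E = dr.
  by rewrite elem_mx_sandwich -mulrA du ee.
have dropE : drop (lab1 T) c *m E = 0.
  rewrite drop_mul ?(wtL ee wE) //; apply/matrixP=> i j; rewrite !mxE.
  by rewrite eq_sym (negPf (neq_lift _ _)).
have Eincl : E *m incl (lab0 T) r = 0.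
  rewrite mul_incl ?(wtR ee wE) //; apply/matrixP=> i j; rewrite !mxE.
  by rewrite (eq_sym (lift _ _)) (negPf (neq_lift _ _)) andbF.
have Ddc : D *m dc = 0.
  by rewrite mulmxBl -!mulmxA (mulmxA E) EDc subrr.
have drD : dr *m D = 0.
  by rewrite mulmxBr !mulmxA DrE subrr.
have difE : dif eliminate = drop (lab0 T) r *m D *m incl (lab1 T) c.
  rewrite drop_mul ?(wtL ee wD) // mul_incl; last first.
    by rewrite row'Esub mul_rowsub_mx (wtR ee wD).
  by apply/matrixP=> i j; rewrite !mxE.
exists (drop (lab1 T) c), (drop (lab0 T) r *m (I0 - dif T *m E)),
  ((I1 - E *m dif T) *m incl (lab1 T) c), (incl (lab0 T) r).
have wDE : wt e (lab0 T) (lab0 T) (dif T *m E) := wtM ee cT wE.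
have wED : wt e (lab1 T) (lab1 T) (E *m dif T) := wtM ee wE cT.
split.
  split; first exact: wt_drop.
  split; first exact: wtM (wt_drop _ _) (wtB ee (wt_idm ee _) wDE).
  rewrite -mulmxA mulmxBl (wtL ee cT) -/D difE -!mulmxA incl_drop eq_l.
  by rewrite -/dc (mulmxBr D) Ddc subr0 (wtR ee wD).
split.
  split; first exact: wtM (wtB ee (wt_idm ee _) wED) (wt_incl _ _).
  split; first exact: wt_incl.
  have DE : dif T *m (I1 - E *m dif T) = D by rewrite mulmxBr (wtR ee cT) mulmxA.
  rewrite difE !mulmxA incl_drop -/l -/dr DE; congr (_ *m _).
  by rewrite mulmxBl drD subr0 (wtL ee wD).
split.
  exists (- E); split; first exact: wtN.
  rewrite mulmxA incl_drop -mulmxA incl_drop -/l eq_l -/dr -/dc.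
  rewrite mulmxN mulNmx mulmxBr mulmxBl !mulmxBr !mulmxBl.
  rewrite (idm_idem ee) (wtL ee wDE) (wtR ee wED) mulmxA DrE EDc.
  have -> : dr *m I0 = dr.
    apply/matrixP=> i j; rewrite mulmx_idmE !mxE.
    by case: andP => [[_ /eqP->]|]; rewrite ?ee ?mul0r.
  have -> : I1 *m dc = dc.
    apply/matrixP=> i j; rewrite idm_mulmxE !mxE.
    by case: andP => [[/eqP->]|]; rewrite ?eq_l ?ee ?mulr0.
  rewrite (idm_idem ee) subrr subr0 opprB addrA subrK.
  by split; rewrite addrAC subrr add0r.
have -> : drop (lab1 T) c *m ((I1 - E *m dif T) *m incl (lab1 T) c) = idm e (lab1 eliminate).
  rewrite mulmxA mulmxBr mulmxA dropE mul0mx subr0 (wtR ee (wt_drop _ _)).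
  exact: drop_incl.
have -> : drop (lab0 T) r *m (I0 - dif T *m E) *m incl (lab0 T) r = idm e (lab0 eliminate).
  rewrite -mulmxA mulmxBl -(mulmxA (dif T)) Eincl mulmx0 subr0 (wtL ee (wt_incl _ _)).
  exact: drop_incl.
exact: homotopic_refl.
Qed.

End Eliminate.

Lemma minimalP T : minimal rho T \/ exists i r c, rho i (dif T r c) != 0.
Proof.
case: (classic (exists i r c, rho i (dif T r c) != 0)) => [|noT]; first by right.
left; apply/rad_mxP => r c i; apply/eqP/negP=> /negP nz; apply: noT.
by exists i, r, c.
Qed.

(** Each elimination lowers [n0] by one and removes the same label from both degrees, so the process
    stops and the g-vector is kept. *)
Lemma minimal_replacement T : is_cpx e T ->
  exists T', [/\ is_cpx e T', minimal rho T', isoK e T T' & gvec T' = gvec T].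
Proof.
have [n] := ubnP (n0 T); elim: n T => // n IH T ltTn cT.
have [minT | [i [r [c nz]]]] := minimalP T.
  by exists T; split=> //; apply: isoK_refl.
have [eq0 eq1] := rho_wt cT nz.
have [|u [eu ud du]] := corner_inv (_ : e i * dif T r c * e i = dif T r c) nz.
  by rewrite [RHS]cT eq0 eq1.
have eq_l : lab1 T c = lab0 T r by rewrite eq0.
rewrite -eq0 in eu ud du.
have [|T' [cT' minT' isoT' gT']] := IH _ _ (eliminate_is_cpx cT eq_l eu).
  by rewrite /= -ltnS prednK //; apply: leq_ltn_trans (ltn_ord r).
exists T'; split=> //; last by rewrite gT' eliminate_gvec.
apply: (isoK_trans ee) isoT'; exact: eliminate_isoK.
Qed.

(** With radical differentials every null-homotopic map has zero residue, whereas the identity of a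
    projective common to T^{-1} and U^0 has not. *)
Lemma hom1_minimal_labels T U p q : minimal rho T -> minimal rho U ->
  hom1 e T U -> lab0 U p != lab1 T q.
Proof.
move=> minT minU hTU; apply/eqP=> eq_pq.
have [|h1 [h0 [_ _ /(congr1 (map_mx (rho (lab1 T q))))]]] := hTU (elem_mx p q (e (lab1 T q))).
  by apply: wt_elem; rewrite eq_pq !ee.
rewrite map_mxD !map_mxM minT minU mul0mx mulmx0 addr0.
move/matrixP/(_ p q)/eqP; rewrite !mxE !eqxx (rs_rho_e rs) eqxx.
by rewrite oner_eq0.
Qed.

(** The homotopy error has a radical differential as a factor, hence f g has exactly the residues of
    the identity. *)
Lemma isoK_minimal T U : minimal rho T -> minimal rho U -> isoK e T U ->
  exists f1 f0 g1 g0, [/\ @chain_map _ _ e T U f1 f0, @chain_map _ _ e U T g1 g0,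
    (forall i, map_mx (rho i) (f1 *m g1) = map_mx (rho i) (idm e (lab1 U)))
    & (forall i, map_mx (rho i) (f0 *m g0) = map_mx (rho i) (idm e (lab0 U)))].
Proof.
move=> minT minU [f1 [f0 [g1 [g0 [cf [cg [_ [h [wh [fg0 fg1]]]]]]]]]].
exists f1, f0, g1, g0; split=> // i; apply/subr0_eq; rewrite -map_mxB.
  by rewrite fg1 map_mxM minU mulmx0.
by rewrite fg0 map_mxM minU mul0mx.
Qed.

Lemma label_transfer n m (s : 'I_n -> 'I_2) (t : 'I_m -> 'I_2) f g j :
  wt e t s f -> map_mx (rho (t j)) (f *m g) = map_mx (rho (t j)) (idm e t) ->
  exists i, s i = t j.
Proof.
move=> wf fg; have [/existsP[i /eqP]|] := boolP [exists i, s i == t j].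
  by exists i.
rewrite negb_exists => /forallP nos.
have f0 : map_mx (rho (t j)) f = 0.
  apply/matrixP=> r c; rewrite !mxE; apply/eqP; apply: contraT.
  by case/(rho_wt wf) => _ eq_s; have /eqP := nos c.
move/matrixP/(_ j j)/eqP: fg; rewrite map_mxM f0 mul0mx !mxE eqxx mul1r.
by rewrite (rs_rho_e rs) eqxx eq_sym oner_eq0.
Qed.

(** Since f g has the residue of the identity, f has a nonzero residue at each label of U, and
    residues are nonzero only between equal labels. Knowing which labels occur is enough to control
    the shape of a complex. *)
Lemma isoK_minimal_labels T U : minimal rho T -> minimal rho U -> isoK e T U ->
  (forall q, exists p, lab0 T p = lab0 U q) /\ (forall q, exists p, lab1 T p = lab1 U q).
Proof.
move=> minT minU /(isoK_minimal minT minU)[f1 [f0 [g1 [g0 [cf cg fg1 fg0]]]]].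
by split=> q; [apply: label_transfer cf.2.1 (fg0 _) | apply: label_transfer cf.1 (fg1 _)].
Qed.

Lemma minimal_zeroK T : minimal rho T -> zeroK e T -> n0 T = 0%N /\ n1 T = 0%N.
Proof.
move=> minT [h [wh []]]; rewrite !subr0 => z0 z1; split.
  case n0T : (n0 T) => [//|n]; have r : 'I_(n0 T) by rewrite n0T; exact: ord0.
  have /(congr1 (fun M : 'M[A]_(n0 T) => rho (lab0 T r) (M r r)))/eqP := z0.
  have /rad_mxP -> := rad_mxMr h minT.
  by rewrite mxE eqxx mul1r (rs_rho_e rs) eqxx oner_eq0.
case n1T : (n1 T) => [//|n]; have r : 'I_(n1 T) by rewrite n1T; exact: ord0.
have /(congr1 (fun M : 'M[A]_(n1 T) => rho (lab1 T r) (M r r)))/eqP := z1.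
have /rad_mxP -> := rad_mxMl h minT.
by rewrite mxE eqxx mul1r (rs_rho_e rs) eqxx oner_eq0.
Qed.

End Minimal.

(** * Base change *)

Section BaseChange.
Variables (k : fieldType) (G L : falgType k) (eG : 'I_2 -> G) (eL : 'I_2 -> L).
Variables (rho : 'I_2 -> {rmorphism G -> k}) (phi : {rmorphism G -> L}).
Hypotheses (rs : residue_system eG rho) (eeL : forall i, eL i * eL i = eL i).
Hypotheses (phi_e : forall i, phi (eG i) = eL i).
Hypotheses (phi_surj : forall y, exists x, phi x = y).
Hypotheses (phi_ker : forall x, phi x = 0 -> in_rad rho x).
Let ee := rs_idem rs.

Definition base_change (T : cpx k G) : cpx k L :=
  Cpx (lab1 T) (lab0 T) (map_mx phi (dif T)).

Lemma map_idm n (s : 'I_n -> 'I_2) : map_mx phi (idm eG s) = idm eL s.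
Proof.
by apply/matrixP=> i j; rewrite !mxE rmorphM phi_e rmorph_nat.
Qed.

Lemma wt_map q p (t : 'I_q -> 'I_2) (s : 'I_p -> 'I_2) M :
  wt eG t s M -> wt eL t s (map_mx phi M).
Proof. by move=> wM r c; rewrite !mxE {1}wM !rmorphM !phi_e. Qed.

Lemma wt_lift q p (t : 'I_q -> 'I_2) (s : 'I_p -> 'I_2) M :
  wt eL t s M -> exists2 N, wt eG t s N & map_mx phi N = M.
Proof.
move=> wM; have [F FE] := mx_choice (fun r c => phi_surj (M r c)).
exists (idm eG t *m F *m idm eG s); first exact: wt_sandwich.
rewrite !map_mxM !map_idm.
have -> : map_mx phi F = M by apply/matrixP=> r c; rewrite !mxE.
by rewrite (wtL eeL wM) (wtR eeL wM).
Qed.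

Lemma ker_rad_mx q p (M : 'M[G]_(q, p)) : map_mx phi M = 0 -> rad_mx rho M.
Proof.
move=> M0; apply/rad_mxP => r c; apply: phi_ker.
by have /matrixP/(_ r c) := M0; rewrite !mxE.
Qed.

Lemma base_change_is_cpx T : is_cpx eG T -> is_cpx eL (base_change T).
Proof. exact: wt_map. Qed.

Lemma base_change_dsum T U :
  base_change (dsum T U) = dsum (base_change T) (base_change U).
Proof.
by congr (@Cpx _ _ _ _ _ _ _); rewrite /= map_block_mx !map_mx0.
Qed.

Lemma base_change_gvec T : gvec (base_change T) = gvec T.
Proof. by []. Qed.

Lemma chain_map_base_change T U f1 f0 : @chain_map _ _ eG T U f1 f0 ->
  @chain_map _ _ eL (base_change T) (base_change U) (map_mx phi f1) (map_mx phi f0).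
Proof.
case=> w1 [w0 cf]; split; first exact: wt_map.
by split; [exact: wt_map | rewrite /= -!map_mxM cf].
Qed.

Lemma homotopic_base_change T U f1 g1 f0 g0 :
  @homotopic _ _ eG T U f1 g1 f0 g0 ->
  @homotopic _ _ eL (base_change T) (base_change U)
    (map_mx phi f1) (map_mx phi g1) (map_mx phi f0) (map_mx phi g0).
Proof.
case=> h [wh [h0 h1]]; exists (map_mx phi h); split; first exact: wt_map.
by rewrite /= -!map_mxM -!map_mxB h0 h1.
Qed.

Lemma isoK_base_change T U : isoK eG T U -> isoK eL (base_change T) (base_change U).
Proof.
case=> f1 [f0 [g1 [g0 [cf [cg [gf fg]]]]]].
exists (map_mx phi f1), (map_mx phi f0), (map_mx phi g1), (map_mx phi g0).
split; first exact: chain_map_base_change.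
split; first exact: chain_map_base_change.
by rewrite -!map_mxM -!map_idm; split; apply: homotopic_base_change.
Qed.

Lemma hom1_base_change T U : hom1 eG T U -> hom1 eL (base_change T) (base_change U).
Proof.
move=> hTU f /wt_lift[F wF <-]; have [h1 [h0 [w1 w0 ->]]] := hTU F wF.
exists (map_mx phi h1), (map_mx phi h0).
by split; try exact: wt_map; rewrite map_mxD !map_mxM.
Qed.

(** Subtracting a lifted homotopy makes x congruent to the identity modulo the kernel. The kernel is
    radical, so the corrected map is strictly invertible, and its inverse inverts x up to homotopy
    on both sides. *)
Lemma endo_near_id T x1 x0 : is_cpx eG T -> @chain_map _ _ eG T T x1 x0 ->
  @homotopic _ _ eL (base_change T) (base_change T) (map_mx phi x1)
    (idm eL (lab1 T)) (map_mx phi x0) (idm eL (lab0 T)) ->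
  exists s1 s0, [/\ @chain_map _ _ eG T T s1 s0,
    homotopic eG (s1 *m x1) (idm eG (lab1 T)) (s0 *m x0) (idm eG (lab0 T))
    & homotopic eG (x1 *m s1) (idm eG (lab1 T)) (x0 *m s0) (idm eG (lab0 T))].
Proof.
move=> cT [wx1 [wx0 cx]] [h [/wt_lift[H wH <-] [hx0 hx1]]].
pose X1 := x1 - H *m dif T; pose X0 := x0 - dif T *m H.
have wX1 : wt eG (lab1 T) (lab1 T) X1 by apply: wtB => //; apply: wtM wH cT.
have wX0 : wt eG (lab0 T) (lab0 T) X0 by apply: wtB => //; apply: wtM cT wH.
have [|S1 [wS1 XS1 SX1]] := idm_near_inv rs wX1.
  apply: ker_rad_mx; rewrite !map_mxB map_mxM -hx1 map_idm.
  by rewrite subKr subrr.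
have [|S0 [wS0 XS0 SX0]] := idm_near_inv rs wX0.
  apply: ker_rad_mx; rewrite !map_mxB map_mxM -hx0 map_idm.
  by rewrite subKr subrr.
have X0d : X0 *m dif T = dif T *m X1.
  by rewrite mulmxBl mulmxBr cx !mulmxA.
have Sd : S0 *m dif T = dif T *m S1.
  transitivity (S0 *m (dif T *m (X1 *m S1))); first by rewrite XS1 (wtR ee cT).
  by rewrite !mulmxA -(mulmxA S0 (dif T)) -X0d mulmxA SX0 (wtL ee cT).
exists S1, S0; split=> //.
  exists (S1 *m H); split; first exact: wtM wS1 wH.
  by rewrite !mulmxA -Sd -{1}SX0 -{1}SX1 -!mulmxA -!mulmxBr /X0 /X1 !subKr.
exists (H *m S0); split; first exact: wtM wH wS0.
rewrite -[H *m S0 *m _]mulmxA Sd !mulmxA -{1}XS0 -{1}XS1 -!mulmxBl.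
by rewrite /X0 /X1 !subKr.
Qed.

(** The zero endomorphism of T becomes homotopic to the identity, hence is already invertible up to
    homotopy. *)
Lemma zeroK_of_base_change T : is_cpx eG T -> zeroK eL (base_change T) -> zeroK eG T.
Proof.
move=> cT zT; have c0 : @chain_map _ _ eG T T 0 0.
  by do 2?split; try exact: wt0; rewrite mul0mx mulmx0.
have [|s1 [s0 [_ _]]] := endo_near_id cT c0.
  by rewrite !map_mx0; apply: homotopic_sym.
by rewrite !mul0mx => /homotopic_sym; apply.
Qed.

(* The obstruction to lifting homotopies and chain maps T -> U along [phi]
   vanishes. *)
Definition lifts (T U : cpx k G) :=
  forall F, wt eG (lab0 U) (lab1 T) F -> map_mx phi F = 0 ->
  exists H1 H0, [/\ wt eG (lab1 U) (lab1 T) H1, wt eG (lab0 U) (lab0 T) H0,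
    map_mx phi H1 = 0, map_mx phi H0 = 0 & F = dif U *m H1 + H0 *m dif T].

Lemma hom1_lift T U : is_cpx eG T -> is_cpx eG U -> lifts T U ->
  hom1 eL (base_change T) (base_change U) -> hom1 eG T U.
Proof.
move=> cT cU lTU hTU F wF; have [h1 [h0]] := hTU _ (wt_map wF).
case=> /wt_lift[h1' w1 <-] /wt_lift[h0' w0 <-] FE.
have [||H1 [H0 [wH1 wH0 _ _ /eqP]]] := lTU (F - (dif U *m h1' + h0' *m dif T)).
- by apply: wtB => //; apply: (wtD ee); [exact: wtM cU w1 | exact: wtM w0 cT].
- by rewrite map_mxB FE map_mxD !map_mxM subrr.
rewrite subr_eq => /eqP->; exists (H1 + h1'), (H0 + h0').
by split; try exact: wtD; rewrite mulmxDr mulmxDl addrACA.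
Qed.

(** The defect [F0 dif T - dif U F1] of arbitrary lifts has entries in the kernel; the correcting
    maps lie in the kernel too, so the prescribed images do not change. *)
Lemma chain_map_lift T U f1 f0 : is_cpx eG T -> is_cpx eG U -> lifts T U ->
  @chain_map _ _ eL (base_change T) (base_change U) f1 f0 ->
  exists F1 F0, [/\ @chain_map _ _ eG T U F1 F0, map_mx phi F1 = f1 & map_mx phi F0 = f0].
Proof.
move=> cT cU lTU [/wt_lift[F1 w1 <-] [/wt_lift[F0 w0 <-] cF]].
have [||H1 [H0 [wH1 wH0 z1 z0 /eqP]]] := lTU (F0 *m dif T - dif U *m F1).
- by apply: (wtB ee); [exact: wtM w0 cT | exact: wtM cU w1].
- by rewrite map_mxB !map_mxM cF subrr.
rewrite subr_eq addrC addrA -mulmxDr -subr_eq -mulmxBl => /eqP defF.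
exists (F1 + H1), (F0 - H0); split; last 2 first.
- by rewrite map_mxD z1 addr0.
- by rewrite map_mxB z0 subr0.
by split; [exact: wtD | split; [exact: wtB | ]].
Qed.

(** Lifts of mutually inverse maps compose to endomorphisms near the identity; inverting these on
    suitable sides gives a left and a right inverse of [F]. *)
Lemma isoK_lift T U : is_cpx eG T -> is_cpx eG U -> lifts T U -> lifts U T ->
  isoK eL (base_change T) (base_change U) -> isoK eG T U.
Proof.
move=> cT cU lTU lUT [f1 [f0 [g1 [g0 []]]]].
case/(chain_map_lift cT cU lTU) => F1 [F0 [cF <- <-]] [].
case/(chain_map_lift cU cT lUT) => G1 [G0 [cG <- <-]] [].
rewrite -!map_mxM => gf fg.
have [s1 [s0 [cs sGF _]]] := endo_near_id cT (chain_map_comp ee cF cG) gf.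
have [t1 [t0 [ct _ FGt]]] := endo_near_id cU (chain_map_comp ee cG cF) fg.
apply: (isoK_of_one_sided ee cU cF (chain_map_comp ee cG cs) (chain_map_comp ee ct cG)).
  by rewrite -!mulmxA.
by rewrite !mulmxA.
Qed.

Lemma cpx_lift T : is_cpx eL T -> exists2 T', is_cpx eG T' & base_change T' = T.
Proof.
case: T => m1 m0 s1 s0 d /wt_lift[D wD dE].
by exists (Cpx s1 s0 D) => //; rewrite /base_change /= dE.
Qed.

End BaseChange.

Lemma ord2_case (i : 'I_2) : i = i1 \/ i = i2.
Proof. by case: i => [[|[|//]] lt_i]; [left | right]; apply: val_inj. Qed.

(** * The radical of an elementary algebra *)

Section Nilpotency.
Variables (k : fieldType) (A : falgType k) (J : {vspace A}).
Hypotheses (JidealL : (fullv * J <= J)%VS) (JidealR : (J * fullv <= J)%VS).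
Hypothesis Junit : forall x, x \in J -> 1 - x \is a GRing.unit.

(** Generators of V as a right module are discarded one at a time: v = v j + w with j in J and w in
    the module generated by the others, so v = w (1 - j)^-1. *)
Lemma nakayama (V : {vspace A}) : (V <= V * J)%VS -> V = 0%VS.
Proof.
move=> sVVJ; suff gen s : {subset s <= V} -> (V <= <<s>> * fullv)%VS -> V = 0%VS.
  apply: (gen (vbasis V)) => [v|]; first exact: vbasis_mem.
  rewrite (span_basis (vbasisP V)).
  by apply/subvP=> v Vv; rewrite -[v]mulr1 memv_mul ?memvf.
elim: s => [|v s IH] sV genV.
  by apply/eqP; rewrite -subv0 (subv_trans genV) // span_nil prod0v.
apply: IH => [x sx|]; first by apply: sV; rewrite inE sx orbT.
have {}genV := subv_trans sVVJ (prodvSl J genV).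
have {}genV : (V <= <<v :: s>> * J)%VS.
  by apply: subv_trans genV _; rewrite -prodvA prodvSr.
suff sv : v \in (<<s>> * fullv)%VS.
  apply: subv_trans genV _; rewrite span_cons prodvDl subv_add.
  rewrite (prodvSr _ (subvf _)) andbT; apply/prodvP=> _ y /vlineP[c ->] Jy.
  rewrite -scalerAl memvZ //.
  apply: (subvP (_ : <<s>> * fullv * fullv <= _)%VS).
    by rewrite -prodvA prodvSr // subvf.
  by rewrite memv_mul // memvf.
have /(subvP genV) : v \in V by apply: sV; rewrite mem_head.
rewrite span_cons prodvDl => /memv_addP[x vx [w sw defv]].
have /subvP sub : (<[v]> * J <= amull v @: J)%VS.
  apply/prodvP=> _ y /vlineP[c ->] Jy; rewrite -scalerAl memvZ //.
  by have -> : v * y = amull v y; [rewrite lfunE | apply: memv_img].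
have /memv_imgP[j Jj] := sub _ vx; rewrite lfunE /= => defx; rewrite {x}defx in vx defv.
have -> : v = w * (1 - j)^-1.
  by apply: (mulIr (Junit Jj)); rewrite divrK ?Junit // mulrBr mulr1 {1}defv addrC addKr.
apply: (subvP (_ : <<s>> * J * fullv <= _)%VS).
  by rewrite -prodvA prodvSr // subvf.
by rewrite memv_mul // memvf.
Qed.

Lemma expv_nilpotent : exists n, (J ^+ n = 0)%VS.
Proof.
(* The induction on dimension runs over all right ideals V: by Nakayama, V J is strictly smaller
   unless V is zero. *)
suff nilV (V : {vspace A}) : (V * fullv <= V)%VS -> exists n, (V * J ^+ n = 0)%VS.
  have [|n Vn] := nilV fullv; first exact: subvf.
  exists n; apply/eqP; rewrite -subv0 -Vn; apply/subvP=> x Jx.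
  by rewrite -[x]mul1r memv_mul ?memvf.
have [m] := ubnP (\dim V); elim: m V => // m IH V ltVm idV.
have [sVVJ | nsVVJ] := boolP (V <= V * J)%VS.
  by exists 0%N; rewrite (nakayama sVVJ) prod0v.
have sVJV : (V * J <= V)%VS by apply: subv_trans idV; rewrite prodvSr // subvf.
have [||n Vn] := IH (V * J)%VS.
- apply: leq_trans (ltVm : \dim V <= m)%N.
  rewrite ltn_neqAle dimvS // andbT; apply: contra nsVVJ => /eqP eqd.
  by rewrite (eqP (_ : V * J == V)%VS) // eqEdim sVJV eqd leqnn.
- by rewrite -prodvA prodvSr.
by exists n.+1; rewrite expvSl prodvA.
Qed.

Lemma prod_nilpotent : exists n, forall s : seq A, size s = n ->
  (forall x, x \in s -> x \in J) -> \prod_(x <- s) x = 0.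
Proof.
have [n Jn] := expv_nilpotent; exists n => s szs sJ; apply/eqP.
rewrite -memv0 -Jn -szs {szs}; elim: s sJ => [|x s IH] sJ.
  by rewrite big_nil expv0 memv_line.
rewrite big_cons expvSl memv_mul ?sJ ?mem_head // IH // => y sy.
by rewrite sJ // inE sy orbT.
Qed.

End Nilpotency.

Lemma rad_nilpotent (k : fieldType) (A : falgType k) (rho : 'I_2 -> {rmorphism A -> k}) :
  (forall i c x, rho i (c *: x) = c * rho i x) ->
  (forall x, in_rad rho x -> 1 - x \is a GRing.unit) ->
  exists n, forall s : seq A, size s = n ->
    (forall x, x \in s -> in_rad rho x) -> \prod_(x <- s) x = 0.
Proof.
move=> rhoZ rad_unit.
have lin i : linear (rho i : A -> k^o) by move=> c x y; rewrite rmorphD rhoZ.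
pose f i : {linear A -> k^o} := HB.pack (rho i : A -> k^o)
  (GRing.isLinear.Build k A k^o *:%R (rho i : A -> k^o) (lin i)).
pose J := (lker (linfun (f i1)) :&: lker (linfun (f i2)))%VS.
have memJ x : x \in J <-> in_rad rho x.
  rewrite memv_cap !memv_ker !lfunE /=; split=> [/andP[/eqP x1 /eqP x2] i | radx].
    by have [->|->] := ord2_case i.
  by rewrite !radx eqxx.
have [| | x /memJ/rad_unit //|n nilJ] := @prod_nilpotent _ _ J.
- by apply/prodvP=> x y _ /memJ Jy; apply/memJ=> i; rewrite rmorphM Jy mulr0.
- by apply/prodvP=> x y /memJ Jx _; apply/memJ=> i; rewrite rmorphM Jx mul0r.
by exists n => s szs sJ; apply: nilJ => // x /sJ/memJ.
Qed.

(** The isomorphism of A/J with k^2 lists the two characters in an unknown order. Each idempotent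
    takes the value 1 under one of them, a different one for each since e_1 + e_2 = 1, and [rho]
    relabels accordingly. *)
Lemma residue_system_exists (k : fieldType) (A : falgType k) (e : 'I_2 -> A) :
  elementary_rank k A 2 -> complete_prim2 k A e ->
  (forall x, e i2 * x * e i1 = 0) ->
  exists rho : 'I_2 -> {rmorphism A -> k}, residue_system e rho.
Proof.
case=> phi [phiD [phiM [phi1 [phiZ [_ phiJ]]]]].
case=> [[idem1 [nz1 _]] [[idem2 [nz2 _]] [o12 [o21 sum1]]]] tri.
have phi0 : phi 0 = 0 by apply: (addrI (phi 0)); rewrite -phiD !addr0.
have phiB x y : phi (x - y) = phi x - phi y.
  by apply: (addIr (phi y)); rewrite -phiD !subrK.
have zmod j : zmod_morphism (fun x => phi x j) by move=> x y; rewrite /= phiB !ffunE.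
have mult j : monoid_morphism (fun x => phi x j).
  by split=> [|x y]; rewrite /= ?phi1 ?phiM !ffunE.
pose psi j : {rmorphism A -> k} := HB.pack (fun x => phi x j)
  (GRing.isZmodMorphism.Build A k (fun x => phi x j) (zmod j))
  (GRing.isMonoidMorphism.Build A k (fun x => phi x j) (mult j)).
have psiE x j : psi j x = phi x j by [].
have psi_idem j i : e i * e i = e i -> psi j (e i) = 0 \/ psi j (e i) = 1.
  move=> /(congr1 (psi j)); rewrite rmorphM => /eqP; rewrite -subr_eq0 -[X in _ - X]mulr1.
  by rewrite -mulrBr mulf_eq0 subr_eq0 => /orP[] /eqP; [left | right].
(* An idempotent in the radical vanishes, because 1 - e_i would be a unit annihilated by e_i. *)
have nonrad i : e i * e i = e i -> e i != 0 -> exists j, psi j (e i) = 1.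
  move=> idem_i nz_i.
  have [z2|] := psi_idem i2 i idem_i; last by exists i2.
  have [z1|] := psi_idem i1 i idem_i; last by exists i1.
  have /phiJ/(_ 1) : phi (e i) = 0.
    by apply/ffunP=> j; rewrite ffunE -psiE; have [->|->] := ord2_case j.
  rewrite mul1r => unit_1e; case/eqP: nz_i; apply: (mulIr unit_1e).
  by rewrite mulrBr mulr1 idem_i subrr mul0r.
have [j1 psi11] := nonrad i1 idem1 nz1; have [j2 psi22] := nonrad i2 idem2 nz2.
have psi_sum j : psi j (e i1) + psi j (e i2) = 1 by rewrite -rmorphD sum1 rmorph1.
have psi12 : psi j1 (e i2) = 0 by apply: (addrI 1); rewrite -{1}psi11 psi_sum addr0.
have psi21 : psi j2 (e i1) = 0 by apply: (addIr 1); rewrite -{1}psi22 psi_sum add0r.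
have ne_j : j1 != j2 by apply/eqP=> eqj; move/eqP: psi12; rewrite eqj psi22 oner_eq0.
pose rho i := if i == i1 then psi j1 else psi j2.
have rhoE j x : exists i, rho i x = psi j x.
  have [|] := eqVneq j j1 => [-> | ne1]; first by exists i1.
  suff -> : j = j2 by exists i2.
  apply/eqP; move: ne_j ne1.
  by have [->|->] := ord2_case j; have [->|->] := ord2_case j1;
    have [->|->] := ord2_case j2.
have rhoZ i c x : rho i (c *: x) = c * rho i x.
  by rewrite /rho; case: ifP => _; rewrite !psiE phiZ ffunE.
exists rho; split=> //.
- by move=> i; have [->|->] := ord2_case i.
- by move=> i j; have [->|->] := ord2_case i; have [->|->] := ord2_case j.
apply: rad_nilpotent rhoZ _ => x radx; rewrite -[x]mul1r.
suff /phiJ : phi x = 0 by apply.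
by apply/ffunP=> j; rewrite ffunE -psiE; have [i <-] := rhoE j x.
Qed.

(** * The bimodule e_1 A e_2 and its top *)

Section TopFunctional.
Variables (k : fieldType) (A : falgType k) (e : 'I_2 -> A).
Variable rho : 'I_2 -> {rmorphism A -> k}.
Hypothesis rs : residue_system e rho.
Let ee := rs_idem rs.

Definition in12 (x : A) := e i1 * x * e i2 = x.

Definition type12 (T : cpx k A) :=
  (forall p, lab0 T p = i1) /\ (forall q, lab1 T q = i2).

Lemma type12_minimal T : is_cpx e T -> type12 T -> minimal rho T.
Proof.
move=> cT [l0 l1]; apply/rad_mxP=> r c i; apply/eqP; apply: contraT => nz.
by have [] := rho_wt rs cT nz; rewrite l0 l1 => <-.
Qed.

Lemma in12_entry T r c : is_cpx e T -> type12 T -> in12 (dif T r c).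
Proof. by move=> cT [l0 l1]; rewrite /in12 [RHS]cT l0 l1. Qed.

Lemma in12_rad x : in12 x -> in_rad rho x.
Proof.
move=> ex i; rewrite -ex !rmorphM !(rs_rho_e rs).
by have [->|->] := ord2_case i; rewrite ?mulr0 ?mul0r.
Qed.

Lemma in12_ell x : in12 x -> e i1 * x = x.
Proof. by move=> <-; rewrite !mulrA ee. Qed.

Lemma in12_elr x : in12 x -> x * e i2 = x.
Proof. by move=> <-; rewrite -!mulrA ee. Qed.

Lemma map_rho_idm_const n (s : 'I_n -> 'I_2) j :
  (forall r, s r = j) -> map_mx (rho j) (idm e s) = 1%:M.
Proof.
move=> sj; apply/matrixP=> r c; rewrite !mxE sj rmorphM (rs_rho_e rs) eqxx mulr1.
by rewrite rmorph_nat.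
Qed.

(** Over the local ring e_j A e_j a matrix is invertible once its residue is: [R], placed in the
    corner as scalar multiples of e_j, is an inverse modulo the radical. *)
Lemma corner_mx_inv q p (t : 'I_q -> 'I_2) (s : 'I_p -> 'I_2) j F (R : 'M[k]_(p, q)) :
  (forall r, t r = j) -> (forall c, s c = j) -> wt e t s F ->
  map_mx (rho j) F *m R = 1%:M -> R *m map_mx (rho j) F = 1%:M ->
  exists F', [/\ wt e s t F', F *m F' = idm e t & F' *m F = idm e s].
Proof.
move=> tj sj wF FR RF; pose H := map_mx (fun c => c *: e j) R.
have wH : wt e s t H.
  by move=> r c; rewrite !mxE sj tj -scalerAr -scalerAl !ee.
have rhoH : map_mx (rho j) H = R.
  by apply/matrixP=> r c; rewrite !mxE (rs_scale rs) (rs_rho_e rs) eqxx mulr1.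
have off (n : nat) (l : 'I_n -> 'I_2) (M : 'M[A]_n) :
    (forall r, l r = j) -> wt e l l M -> map_mx (rho j) M = 0 -> rad_mx rho M.
  move=> lj wM M0 i; apply/matrixP=> r c; have [-> | ne_ij] := eqVneq i j.
    by rewrite M0 mxE.
  rewrite !mxE; apply/eqP; apply: contraT => /(rho_wt rs wM)[+ _].
  by rewrite lj => eq_ij; rewrite eq_ij eqxx in ne_ij.
apply: (near_inv rs wF wH).
  apply: (off _ t) => //; first exact: (wtB ee (wt_idm ee _) (wtM ee wF wH)).
  by rewrite map_mxB map_mxM rhoH FR map_rho_idm_const // subrr.
apply: (off _ s) => //; first exact: (wtB ee (wt_idm ee _) (wtM ee wH wF)).
by rewrite map_mxB map_mxM rhoH RF map_rho_idm_const // subrr.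
Qed.

Lemma isoK_strict T U f1 f0 g1 g0 : is_cpx e T -> is_cpx e U ->
  @chain_map _ _ e T U f1 f0 ->
  wt e (lab1 T) (lab1 U) g1 -> wt e (lab0 T) (lab0 U) g0 ->
  g1 *m f1 = idm e (lab1 T) -> f1 *m g1 = idm e (lab1 U) ->
  g0 *m f0 = idm e (lab0 T) -> f0 *m g0 = idm e (lab0 U) -> isoK e T U.
Proof.
move=> cT cU cf w1 w0 gf1 fg1 gf0 fg0; exists f1, f0, g1, g0; split=> //.
split; last by rewrite gf1 fg1 gf0 fg0; split; apply: homotopic_refl.
split=> //; split=> //.
rewrite -(wtR ee cU) -fg1 !mulmxA -(mulmxA g0) -cf.2.2 mulmxA gf0.
by rewrite (wtL ee cT).
Qed.

(** A zero differential splits T into its terms in degrees 0 and -1. *)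
Lemma dif0_not_indec T : dif T = 0 -> indecK e T -> n0 T = 0%N \/ n1 T = 0%N.
Proof.
move=> dT0 [cT [_ decT]].
pose U : cpx k A := @Cpx k A 0 _ (fun=> i1) (lab0 T) 0.
pose V : cpx k A := @Cpx k A _ 0 (lab1 T) (fun=> i1) 0.
have cU : is_cpx e U by apply: wt0.
have cV : is_cpx e V by apply: wt0.
have minU : minimal rho U by move=> i; rewrite /= map_mx0.
have minV : minimal rho V by move=> i; rewrite /= map_mx0.
suff isoT : isoK e T (dsum U V).
  case: (decT U V cU cV isoT) => [/(minimal_zeroK rs minU)[] | /(minimal_zeroK rs minV)[]].
    by left.
  by right.
have cUV : is_cpx e (dsum U V) by apply/is_cpx_dsum.
apply: (@isoK_strict T (dsum U V) (col_mx 0 (idm e (lab1 T))) (col_mx (idm e (lab0 T)) 0)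
  (row_mx 0 (idm e (lab1 T))) (row_mx (idm e (lab0 T)) 0)) => //=.
- split; first by apply/wt_block_col => //; split; [exact: wt0 | exact: wt_idm].
  split; first by apply/wt_block_col => //; split; [exact: wt_idm | exact: wt0].
  by rewrite /= dT0 mulmx0 block_mx0 mul0mx.
- by apply/wt_block_row => //; split; [exact: wt0 | exact: wt_idm].
- by apply/wt_block_row => //; split; [exact: wt_idm | exact: wt0].
- by rewrite mul_row_col mul0mx add0r idm_idem.
- rewrite mul_col_row !mul0mx mulmx0 idm_idem // idm_lab_sum //.
  by congr (block_mx _ _ _ _); apply/matrixP=> -[].
- by rewrite mul_row_col mulmx0 addr0 idm_idem.
rewrite mul_col_row !mul0mx mulmx0 idm_idem // idm_lab_sum //.
by congr (block_mx _ _ _ _); apply/matrixP=> -[].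
Qed.

(** Nakayama for a mere predicate: unfolding N times writes y as a sum of terms ending in N radical
    factors, which vanish. *)
Lemma rad_absorb_right (P : A -> Prop) :
  (forall y, P y -> exists n (m j : 'I_n -> A),
     [/\ forall c, P (m c), forall c, in_rad rho (j c) & y = \sum_c m c * j c]) ->
  forall y, P y -> y = 0.
Proof.
move=> absorb; have [N nilN] := rs_nil rs.
suff yN m : forall s y, (size s + m = N)%N -> (forall x, x \in s -> in_rad rho x) ->
    P y -> y * \prod_(x <- s) x = 0.
  by move=> y Py; have := yN N [::] y; rewrite big_nil mulr1; apply.
elim: m => [|m IH] s y szs rads Py; first by rewrite nilN ?mulr0 // -szs addn0.
have [n [x [j [Px radj ->]]]] := absorb y Py.
rewrite mulr_suml big1 // => c _; rewrite -mulrA.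
have := IH (j c :: s) (x c); rewrite big_cons; apply=> //; first by rewrite /= addSnnS.
by move=> z; rewrite inE => /predU1P[-> | /rads].
Qed.

Lemma rad_absorb_left (P : A -> Prop) :
  (forall y, P y -> exists n (m j : 'I_n -> A),
     [/\ forall c, P (m c), forall c, in_rad rho (j c) & y = \sum_c j c * m c]) ->
  forall y, P y -> y = 0.
Proof.
move=> absorb; have [N nilN] := rs_nil rs.
suff yN m : forall s y, (size s + m = N)%N -> (forall x, x \in s -> in_rad rho x) ->
    P y -> (\prod_(x <- s) x) * y = 0.
  by move=> y Py; have := yN N [::] y; rewrite big_nil mul1r; apply.
elim: m => [|m IH] s y szs rads Py; first by rewrite nilN ?mul0r // -szs addn0.
have [n [x [j [Px radj ->]]]] := absorb y Py.
rewrite mulr_sumr big1 // => c _; rewrite mulrA.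
have := IH (rcons s (j c)) (x c); rewrite big_rcons /=; apply=> //.
  by rewrite size_rcons addSnnS.
by move=> z; rewrite mem_rcons inE => /predU1P[-> | /rads].
Qed.

Definition cyclic_right x := in12 x /\
  forall y, in12 y -> exists2 b, e i2 * b * e i2 = b & y = x * b.

Definition cyclic_left x := in12 x /\
  forall y, in12 y -> exists2 b, e i1 * b * e i1 = b & y = b * x.

End TopFunctional.

(** * Cyclicity of e_1 A e_2 from a pair of presilting summands *)

Section Cyclic.
Variables (k : fieldType) (A : falgType k) (e : 'I_2 -> A).
Variable rho : 'I_2 -> {rmorphism A -> k}.
Hypothesis rs : residue_system e rho.
Let ee := rs_idem rs.

Lemma mul_mx_scalarE q p (M : 'M[A]_(q, p)) x i j : (M *m x%:M) i j = M i j * x.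
Proof.
rewrite mxE (bigD1 j) //= mxE eqxx mulr1n big1 ?addr0 // => l /negPf ne_lj.
by rewrite mxE ne_lj mulr0n mulr0.
Qed.

Lemma in12_elem q p (t : 'I_q -> 'I_2) (s : 'I_p -> 'I_2) r c y :
  t r = i1 -> s c = i2 -> in12 e y -> wt e t s (elem_mx r c y).
Proof. by move=> tr sc ey; apply: wt_elem; rewrite tr sc. Qed.

Lemma indec_has_entry T : is_cpx e T -> type12 T -> indecK e T ->
  n0 T != 0%N -> n1 T != 0%N -> exists2 y, in12 e y & y != 0.
Proof.
move=> cT tT indT nz0 nz1.
case: (classic (exists2 y, in12 e y & y != 0)) => // noX.
have [|/eqP|/eqP] := dif0_not_indec rs _ indT; last 2 first.
- by rewrite (negPf nz0).
- by rewrite (negPf nz1).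
apply/matrixP=> r c; rewrite mxE; apply/eqP; apply: contraT => nz.
by case: noX; exists (dif T r c) => //; apply: in12_entry.
Qed.

(* Solve y I = dif T W for each y in e_1 A e_2. If the residue of W is
   invertible then y is a generator, otherwise y lies in (e_1 A e_2) J; the
   second case cannot hold for all y, J being nilpotent. *)
Lemma cyclic_right_exists T U : is_cpx e T -> type12 T -> indecK e T ->
  n0 T = n1 T -> n0 T != 0%N ->
  n0 U = 0%N -> n1 U != 0%N -> (forall q, lab1 U q = i2) -> hom1 e U T ->
  exists2 x, cyclic_right e x & x != 0.
Proof.
move=> cT tT indT eqn nz0 n0U nz1U lU hUT.
have nz1 : n1 T != 0%N by rewrite -eqn.
have [y0 ey0 nzy0] := indec_has_entry cT tT indT nz0 nz1.
have q0 : 'I_(n1 U) by case: (n1 U) nz1U => // n _; exact: ord0.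
have r0 : 'I_(n0 T) by case: (n0 T) nz0 => // n _; exact: ord0.
(* Here U is P_2^m[1], so the term [h0 dif U] is an empty sum and every column over e_1 A e_2
   factors through [dif T]; the columns of y I are solved one at a time. *)
have solve y : in12 e y ->
    exists2 W, wt e (lab1 T) (fun=> i2) W & y%:M = dif T *m W :> 'M_(n0 T).
  move=> ey; have solve1 r : exists w : 'cV[A]_(n1 T), (forall c, e i2 * w c 0 * e i2 = w c 0)
      /\ forall r', (if r' == r then y else 0) = (dif T *m w) r' 0.
    have [|h1 [h0 [w1 _ defy]]] := hUT (elem_mx r q0 y).
      by apply: in12_elem; rewrite ?tT.1 ?lU.
    exists (col q0 h1); split=> [c | r'].
      by rewrite !mxE [RHS]w1 lU tT.2.
    rewrite colEsub mulmx_colsub; move/matrixP/(_ r' q0): defy; rewrite mxE eqxx andbT => ->.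
    rewrite !mxE [X in _ + X]big1 ?addr0 // => i _.
    by have := ltn_ord i; rewrite {2}n0U.
  have [w wP] := fin_all_exists solve1.
  exists (\matrix_(i, j) w j i 0) => [i j | ].
    by rewrite !mxE tT.2 (wP j).1.
  apply/matrixP=> r' r; rewrite !mxE mulrb (wP r).2 mxE.
  by apply: eq_bigr => c _; rewrite !mxE.
case: (classic (exists2 x, cyclic_right e x & x != 0)) => // nocyc.
case/eqP: nzy0; move: y0 ey0; apply: (rad_absorb_right rs) => y ey.
have [-> | nzy] := eqVneq y 0.
  exists 0%N, (fun=> 0), (fun=> 0); split=> [[] // | [] // |].
  by rewrite big_ord0.
have [W wW yW] := solve y ey.
have [full | ] := boolP (row_full (map_mx (rho i2) W)); last first.
  rewrite -cokermx_eq0 => nzcoker.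
  have [c [l nzv]] : exists c l, cokermx (map_mx (rho i2) W) c l != 0.
    case: (classic (exists c l, cokermx (map_mx (rho i2) W) c l != 0)) => // no.
    case/eqP: nzcoker; apply/matrixP=> c l; rewrite [RHS]mxE; apply/eqP.
    by apply: contraT => nz; case: no; exists c, l.
  pose v : 'cV[k]_(n0 T) := col l (cokermx (map_mx (rho i2) W)).
  have nzvc : v c 0 != 0 by rewrite mxE.
  have Wv : map_mx (rho i2) W *m v = 0 
    by rewrite /v colEsub mulmx_colsub mulmx_coker; apply/matrixP=> i j; rewrite !mxE.
  (* Entry c of y v = dif T (W v) expresses y, up to the scalar v_c, with coefficients from W v,
     which are radical by the choice of v. *)
  pose j i := (v c 0)^-1 *: \sum_r v r 0 *: W i r.
  exists (n1 T), (dif T c), j; split=> [i | i i' | ].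
  - exact: in12_entry.
  - rewrite (rs_scale rs) rmorph_sum /=; have [-> | ->] := ord2_case i'.
      rewrite big1 ?mulr0 // => r _; rewrite (rs_scale rs) wW tT.2 rmorphM.
      by rewrite (rs_rho_e rs) mulr0 mulr0.
    have /matrixP/(_ i 0) := Wv; rewrite !mxE => Wv0; apply/eqP.
    rewrite mulf_eq0; apply/orP; right; apply/eqP; rewrite -[RHS]Wv0.
    by apply: eq_bigr => r _; rewrite (rs_scale rs) !mxE mulrC.
  apply: (scalerI nzvc); rewrite scaler_sumr.
  transitivity (\sum_i dif T c i * \sum_r v r 0 *: W i r); last first.
    apply: eq_bigr => i _; rewrite /j -[in RHS]scalerAr scalerA mulfV //.
    by rewrite scale1r.
  transitivity (\sum_r v r 0 *: (y%:M : 'M_(n0 T)) c r).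
    rewrite (bigD1 c) //= [X in _ *: X + _]mxE eqxx mulr1n big1 ?addr0 // => r ne_r.
    by rewrite [X in _ *: X]mxE eq_sym (negPf ne_r) mulr0n scaler0.
  rewrite yW; under eq_bigr => r _ do rewrite [X in _ *: X]mxE scaler_sumr.
  rewrite exchange_big; apply: eq_bigr => i _; rewrite mulr_sumr.
  by apply: eq_bigr => r _; rewrite scalerAr.
case: nocyc; exists y => //; split=> // y' ey'.
have free : row_free (map_mx (rho i2) W).
  by rewrite /row_free (eqP full) eqn.
have /row_fullP[R RW] := full.
have WR : map_mx (rho i2) W *m R = 1%:M.
  have /row_freeP[R' WR'] := free.
  by have <- : R' = R by rewrite -[R]mulmx1 -WR' mulmxA RW mul1mx.
have [W' [wW' WW' _]] := corner_mx_inv rs tT.2 (fun=> erefl) wW WR RW.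
have [V wV yV] := solve y' ey'.
(* From y I = dif T W follows dif T = y W'; then y' I = dif T V reads y' = y (W' V) at a diagonal
   position. *)
exists ((W' *m V) r0 r0).
  by have /(_ r0 r0) := wtM ee wW' wV.
transitivity ((y%:M *m W' *m V) r0 r0).
  rewrite yW -(mulmxA _ W) WW' (wtR ee cT) -yV.
  by rewrite mxE eqxx mulr1n.
by rewrite -mulmxA mul_scalar_mx mxE.
Qed.

(** Left-right dual: U is P_1^m in degree 0, the equation is y I = W dif T, and a left kernel vector
    of the residue of W writes y with radical coefficients on the left. *)
Lemma cyclic_left_exists T U : is_cpx e T -> type12 T -> indecK e T ->
  n0 T = n1 T -> n0 T != 0%N ->
  n1 U = 0%N -> n0 U != 0%N -> (forall q, lab0 U q = i1) -> hom1 e T U ->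
  exists2 x, cyclic_left e x & x != 0.
Proof.
move=> cT tT indT eqn nz0 n1U nz0U lU hUT.
have nz1 : n1 T != 0%N by rewrite -eqn.
have [y0 ey0 nzy0] := indec_has_entry cT tT indT nz0 nz1.
have q0 : 'I_(n0 U) by case: (n0 U) nz0U => // n _; exact: ord0.
have r0 : 'I_(n1 T) by case: (n1 T) nz1 => // n _; exact: ord0.
have solve y : in12 e y ->
    exists2 W, wt e (fun=> i1) (lab0 T) W & y%:M = W *m dif T :> 'M_(n1 T).
  move=> ey; have solve1 r : exists w : 'rV[A]_(n0 T), (forall c, e i1 * w 0 c * e i1 = w 0 c)
      /\ forall r', (if r' == r then y else 0) = (w *m dif T) 0 r'.
    have [|h1 [h0 [_ w0 defy]]] := hUT (elem_mx q0 r y).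
      by apply: in12_elem; rewrite ?tT.2 ?lU.
    exists (row q0 h0); split=> [c | r'].
      by rewrite !mxE [RHS]w0 lU tT.1.
    rewrite -row_mul; move/matrixP/(_ q0 r'): defy; rewrite mxE eqxx /= => ->.
    rewrite !mxE [X in X + _]big1 ?add0r // => i _.
    by have := ltn_ord i; rewrite {2}n1U.
  have [w wP] := fin_all_exists solve1.
  exists (\matrix_(i, j) w i 0 j) => [i j | ].
    by rewrite !mxE tT.1 (wP i).1.
  apply/matrixP=> r r'; rewrite !mxE mulrb eq_sym (wP r).2 mxE.
  by apply: eq_bigr => c _; rewrite !mxE.
case: (classic (exists2 x, cyclic_left e x & x != 0)) => // nocyc.
case/eqP: nzy0; move: y0 ey0; apply: (rad_absorb_left rs) => y ey.
have [-> | nzy] := eqVneq y 0.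
  exists 0%N, (fun=> 0), (fun=> 0); split=> [[] // | [] // |].
  by rewrite big_ord0.
have [W wW yW] := solve y ey.
have [free | ] := boolP (row_free (map_mx (rho i1) W)); last first.
  rewrite -kermx_eq0 => nzker.
  have [l [c nzv]] : exists l c, kermx (map_mx (rho i1) W) l c != 0.
    case: (classic (exists l c, kermx (map_mx (rho i1) W) l c != 0)) => // no.
    case/eqP: nzker; apply/matrixP=> l c; rewrite [RHS]mxE; apply/eqP.
    by apply: contraT => nz; case: no; exists l, c.
  pose v : 'rV[k]_(n1 T) := row l (kermx (map_mx (rho i1) W)).
  have nzvc : v 0 c != 0 by rewrite mxE.
  have vW : v *m map_mx (rho i1) W = 0 by rewrite -row_mul mulmx_ker row0.
  pose j i := (v 0 c)^-1 *: \sum_r v 0 r *: W r i.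
  exists (n0 T), (fun i => dif T i c), j; split=> [i | i i' | ].
  - exact: in12_entry.
  - rewrite (rs_scale rs) rmorph_sum /=; have [-> | ->] := ord2_case i'; last first.
      rewrite big1 ?mulr0 // => r _; rewrite (rs_scale rs) wW tT.1 rmorphM.
      by rewrite (rs_rho_e rs) mulr0 mulr0.
    have /matrixP/(_ 0 i) := vW; rewrite !mxE => vW0; apply/eqP.
    rewrite mulf_eq0; apply/orP; right; apply/eqP; rewrite -[RHS]vW0.
    by apply: eq_bigr => r _; rewrite (rs_scale rs) !mxE.
  apply: (scalerI nzvc); rewrite scaler_sumr.
  transitivity (\sum_i (\sum_r v 0 r *: W r i) * dif T i c); last first.
    apply: eq_bigr => i _; rewrite /j -[in RHS]scalerAl scalerA mulfV //.
    by rewrite scale1r.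
  transitivity (\sum_r v 0 r *: (y%:M : 'M_(n1 T)) r c).
    rewrite (bigD1 c) //= [X in _ *: X + _]mxE eqxx mulr1n big1 ?addr0 // => r ne_r.
    by rewrite [X in _ *: X]mxE (negPf ne_r) mulr0n scaler0.
  rewrite yW; under eq_bigr => r _ do rewrite [X in _ *: X]mxE scaler_sumr.
  rewrite exchange_big; apply: eq_bigr => i _; rewrite mulr_suml.
  by apply: eq_bigr => r _; rewrite scalerAl.
case: nocyc; exists y => //; split=> // y' ey'.
have full : row_full (map_mx (rho i1) W).
  by rewrite /row_full (eqP free) eqn.
have /row_fullP[R RW] := full.
have WR : map_mx (rho i1) W *m R = 1%:M.
  have /row_freeP[R' WR'] := free.
  by have <- : R' = R by rewrite -[R]mulmx1 -WR' mulmxA RW mul1mx.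
have [W' [wW' _ WW']] := corner_mx_inv rs (fun=> erefl) tT.1 wW WR RW.
have [V wV yV] := solve y' ey'.
exists ((V *m W') r0 r0).
  by have /(_ r0 r0) := wtM ee wV wW'.
transitivity ((V *m (W' *m y%:M)) r0 r0).
  rewrite yW (mulmxA W') WW' (wtL ee cT) -yV.
  by rewrite mxE eqxx mulr1n.
by rewrite mulmxA mul_mx_scalarE.
Qed.

End Cyclic.

(** * The map onto triangular matrices *)

Section Top.
Variables (k : fieldType) (A : falgType k) (e : 'I_2 -> A).
Variable rho : 'I_2 -> {rmorphism A -> k}.
Hypothesis rs : residue_system e rho.
Let ee := rs_idem rs.

(* [rho] and [xi] are the entries of an algebra map onto upper triangular 2x2
   matrices over k. *)
Record top_system (xi : {additive A -> k}) : Prop := TopSystem {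
  ts_scale : forall c x, xi (c *: x) = c * xi x;
  ts_corner : forall x, xi (e i1 * x * e i2) = xi x;
  ts_mul : forall x y, xi (x * y) = rho i1 x * xi y + xi x * rho i2 y;
  ts_unit : exists2 z, in12 e z & xi z = 1 }.

Lemma in_rad_nilpotent x : in_rad rho x -> exists n, x ^+ n = 0.
Proof.
move=> radx; have [n nil] := rs_nil rs; exists n.
have prodx m : \prod_(y <- nseq m x) y = x ^+ m.
  by elim: m => [|m IH] /=; rewrite ?big_nil // big_cons IH exprS.
rewrite -prodx; apply: nil; first by rewrite size_nseq.
by move=> y; rewrite mem_nseq => /andP[_ /eqP->].
Qed.

Lemma in12_mul x y :
  e i1 * (x * y) * e i2 = e i1 * x * e i1 * (e i1 * y * e i2)
                          + e i1 * x * e i2 * (e i2 * y * e i2).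
Proof.
rewrite -[x in LHS]mulr1 -(rs_sum rs) !(mulrDr, mulrDl) !mulrA.
by rewrite -(mulrA _ (e i1) (e i1)) -(mulrA _ (e i2) (e i2)) !ee.
Qed.

(** The functional sends x b to the residue of b. It is well defined because x b = 0 with b
    invertible in the corner would force x = 0. *)
Lemma top_system_right x : cyclic_right e x -> x != 0 ->
  exists xi : {additive A -> k}, top_system xi /\ xi x = 1.
Proof.
move=> [ex gen] nzx.
have wd b : e i2 * b * e i2 = b -> x * b = 0 -> rho i2 b = 0.
  move=> eb xb0; apply/eqP; apply: contraT => /(corner_inv rs eb)[u [_ _ bu]].
  by case/eqP: nzx; rewrite -(in12_elr rs ex) -bu mulrA xb0 mul0r.
pose P a b := (e i1 * a * e i2 == x * b) && (e i2 * b * e i2 == b).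
have exP a : exists b, P a b.
  have [|b eb ab] := gen (e i1 * a * e i2).
    by rewrite /in12 !mulrA ee -!mulrA ee.
  by exists b; rewrite /P ab eb !eqxx.
pose f a := rho i2 (xchoose (exP a)).
have fE a b : e i1 * a * e i2 = x * b -> e i2 * b * e i2 = b -> f a = rho i2 b.
  move=> ab eb; have /andP[/eqP ab' /eqP eb'] := xchooseP (exP a).
  apply/subr0_eq; rewrite -rmorphB; apply: wd.
    by rewrite mulrBr mulrBl eb eb'.
  by rewrite mulrBr -ab -ab' subrr.
have fP a : exists b, [/\ e i1 * a * e i2 = x * b, e i2 * b * e i2 = b & f a = rho i2 b].
  have /andP[/eqP ab /eqP eb] := xchooseP (exP a).
  by exists (xchoose (exP a)).
have fB : zmod_morphism f.
  move=> a a'; have [b [ab eb ->]] := fP a; have [b' [ab' eb' ->]] := fP a'.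
  rewrite -rmorphB; apply: fE; first by rewrite mulrBr mulrBl ab ab' mulrBr.
  by rewrite mulrBr mulrBl eb eb'.
pose xi : {additive A -> k} := HB.pack f (GRing.isZmodMorphism.Build A k f fB).
exists xi; have xix : xi x = 1.
  rewrite -(rmorph1 (rho i2)) -(rs_sum rs) rmorphD !(rs_rho_e rs) add0r.
  rewrite -[RHS](rs_rho_e rs i2 i2); apply: fE; last by rewrite !ee.
  by rewrite ex (in12_elr rs ex).
split=> //; split; last by exists x.
- move=> c a; have [b [ab eb fa]] := fP a; rewrite /= fa -(rs_scale rs).
  by apply: fE; rewrite -!scalerAr -!scalerAl ?ab ?eb // scalerAr.
- move=> a; have [b [ab eb fa]] := fP a; rewrite /= fa.
  by apply: fE => //; rewrite !mulrA ee -!mulrA ee mulrA.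
move=> a a'; have [b [ab eb fa]] := fP a; have [b' [ab' eb' fa']] := fP a'.
pose j := e i1 * a * e i1 - rho i1 a *: e i1.
have radj : in_rad rho j.
  move=> i; rewrite rmorphB (rs_scale rs) !rmorphM !(rs_rho_e rs).
  by have [->|->] := ord2_case i; rewrite /= ?mulr1 ?mul1r ?mulr0 ?mul0r subrr.
have [|d ed jd] := gen (j * x).
  rewrite /in12 mulrA mulrBr -!mulrA (in12_elr rs ex) !mulrA ee.
  by rewrite -scalerAr ee.
(* Left multiplication of x by the radical j becomes right multiplication by d, and j^n x = x d^n
   transfers nilpotency, so d has residue 0. The product rule rests on this. *)
have rhod : rho i2 d = 0.
  have jn n : j ^+ n * x = x * d ^+ n.
    elim: n => [|n IH]; first by rewrite !expr0 mul1r mulr1.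
    by rewrite exprSr -mulrA jd mulrA IH -mulrA -exprSr.
  have [[|n] jn0] := in_rad_nilpotent radj.
    by case/eqP: nzx; rewrite -[x]mul1r -(expr0 j) jn0 mul0r.
  have edn : e i2 * d ^+ n.+1 * e i2 = d ^+ n.+1.
    have eld : e i2 * d = d by rewrite -ed !mulrA ee.
    have erd : d * e i2 = d by rewrite -ed -!mulrA ee.
    by rewrite [in LHS]exprS mulrA eld -exprS exprSr -mulrA erd.
  have := wd _ edn; rewrite -jn jn0 mul0r rmorphXn => /(_ erefl)/eqP.
  by rewrite expf_eq0 => /eqP.
have edx : e i1 * a * e i1 * x = x * (d + rho i1 a *: e i2).
  rewrite mulrDr -jd mulrBl -scalerAl (in12_ell rs ex) -scalerAr (in12_elr rs ex).
  by rewrite subrK.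
rewrite /= fa fa'.
transitivity (rho i2 ((d + rho i1 a *: e i2) * b' + b * (e i2 * a' * e i2))).
  have eb2 : e i2 * b' = b' by rewrite -eb' !mulrA ee.
  have eb3 : b' * e i2 = b' by rewrite -eb' -!mulrA ee.
  apply: fE.
    by rewrite in12_mul ab ab' (mulrA _ x b') edx [RHS]mulrDr -!mulrA.
  have ebl : e i2 * b = b by rewrite -eb !mulrA ee.
  have edl : e i2 * d = d by rewrite -ed !mulrA ee.
  rewrite mulrDr mulrDl !mulrA ebl -!mulrA eb3 ee !mulrA; congr (_ + _).
  by rewrite mulrDr edl -scalerAr ee.
rewrite rmorphD !rmorphM rmorphD (rs_scale rs) rhod !(rs_rho_e rs).
by rewrite /= add0r mulr1 mul1r mulr1.
Qed.

(** Dual: b x is sent to the residue of b, and nilpotency is transferred through x j^n = d^n x. *)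
Lemma top_system_left x : cyclic_left e x -> x != 0 ->
  exists xi : {additive A -> k}, top_system xi /\ xi x = 1.
Proof.
move=> [ex gen] nzx.
have wd b : e i1 * b * e i1 = b -> b * x = 0 -> rho i1 b = 0.
  move=> eb xb0; apply/eqP; apply: contraT => /(corner_inv rs eb)[u [_ ub _]].
  by case/eqP: nzx; rewrite -(in12_ell rs ex) -ub -mulrA xb0 mulr0.
pose P a b := (e i1 * a * e i2 == b * x) && (e i1 * b * e i1 == b).
have exP a : exists b, P a b.
  have [|b eb ab] := gen (e i1 * a * e i2).
    by rewrite /in12 !mulrA ee -!mulrA ee.
  by exists b; rewrite /P ab eb !eqxx.
pose f a := rho i1 (xchoose (exP a)).
have fE a b : e i1 * a * e i2 = b * x -> e i1 * b * e i1 = b -> f a = rho i1 b.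
  move=> ab eb; have /andP[/eqP ab' /eqP eb'] := xchooseP (exP a).
  apply/subr0_eq; rewrite -rmorphB; apply: wd.
    by rewrite mulrBr mulrBl eb eb'.
  by rewrite mulrBl -ab -ab' subrr.
have fP a : exists b, [/\ e i1 * a * e i2 = b * x, e i1 * b * e i1 = b & f a = rho i1 b].
  have /andP[/eqP ab /eqP eb] := xchooseP (exP a).
  by exists (xchoose (exP a)).
have fB : zmod_morphism f.
  move=> a a'; have [b [ab eb ->]] := fP a; have [b' [ab' eb' ->]] := fP a'.
  rewrite -rmorphB; apply: fE; first by rewrite mulrBr mulrBl ab ab' mulrBl.
  by rewrite mulrBr mulrBl eb eb'.
pose xi : {additive A -> k} := HB.pack f (GRing.isZmodMorphism.Build A k f fB).
exists xi; have xix : xi x = 1.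
  rewrite -[RHS](rs_rho_e rs i1 i1); apply: fE; last by rewrite !ee.
  by rewrite ex (in12_ell rs ex).
split=> //; split; last by exists x.
- move=> c a; have [b [ab eb fa]] := fP a; rewrite /= fa -(rs_scale rs).
  by apply: fE; rewrite -!scalerAr -!scalerAl ?ab ?eb.
- move=> a; have [b [ab eb fa]] := fP a; rewrite /= fa.
  by apply: fE => //; rewrite !mulrA ee -!mulrA ee mulrA.
move=> a' a; have [b [ab eb fa]] := fP a; have [b' [ab' eb' fa']] := fP a'.
pose j := e i2 * a * e i2 - rho i2 a *: e i2.
have radj : in_rad rho j.
  move=> i; rewrite rmorphB (rs_scale rs) !rmorphM !(rs_rho_e rs).
  by have [->|->] := ord2_case i; rewrite /= ?mulr1 ?mul1r ?mulr0 ?mul0r subrr.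
have [|d ed jd] := gen (x * j).
  have jr : j * e i2 = j by rewrite /j mulrBl -!mulrA ee -scalerAl ee.
  by rewrite /in12 -!mulrA jr mulrA (in12_ell rs ex).
have rhod : rho i1 d = 0.
  have jn n : x * j ^+ n = d ^+ n * x.
    elim: n => [|n IH]; first by rewrite !expr0 mul1r mulr1.
    by rewrite exprS mulrA jd -mulrA IH mulrA -exprS.
  have [[|n] jn0] := in_rad_nilpotent radj.
    by case/eqP: nzx; rewrite -[x]mulr1 -(expr0 j) jn0 mulr0.
  have edn : e i1 * d ^+ n.+1 * e i1 = d ^+ n.+1.
    have eld : e i1 * d = d by rewrite -ed !mulrA ee.
    have erd : d * e i1 = d by rewrite -ed -!mulrA ee.
    by rewrite [in LHS]exprS mulrA eld -exprS exprSr -mulrA erd.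
  have := wd _ edn; rewrite -jn jn0 mulr0 rmorphXn => /(_ erefl)/eqP.
  by rewrite expf_eq0 => /eqP.
have edx : x * (e i2 * a * e i2) = (d + rho i2 a *: e i1) * x.
  rewrite mulrDl -jd mulrBr -scalerAr (in12_elr rs ex) -scalerAl (in12_ell rs ex).
  by rewrite subrK.
rewrite /= fa fa'.
transitivity (rho i1 (e i1 * a' * e i1 * b + b' * (d + rho i2 a *: e i1))).
  have ebr : b * e i1 = b by rewrite -eb -!mulrA ee.
  have ebl : e i1 * b' = b' by rewrite -eb' !mulrA ee.
  have edr : d * e i1 = d by rewrite -ed -!mulrA ee.
  apply: fE.
    by rewrite in12_mul ab ab' -[b' * x * _]mulrA edx [RHS]mulrDl !mulrA.
  rewrite mulrDr mulrDl !mulrA ebl ee -!mulrA ebr; congr (_ + _).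
  by rewrite mulrDl edr -scalerAl ee.
rewrite rmorphD !rmorphM rmorphD (rs_scale rs) rhod !(rs_rho_e rs).
by rewrite /= add0r mulr1 mul1r mulr1.
Qed.

End Top.

(** * Ranks of reduced matrices *)

Section Rank.
Variables (k : fieldType) (A : falgType k) (e : 'I_2 -> A).
Variables (rho : 'I_2 -> {rmorphism A -> k}) (xi : {additive A -> k}).
Hypotheses (rs : residue_system e rho) (ts : top_system e rho xi).
Let ee := rs_idem rs.

Definition topmx (T : cpx k A) := map_mx xi (dif T).

Lemma map_xiM q p l (M : 'M[A]_(q, p)) (N : 'M[A]_(p, l)) :
  map_mx xi (M *m N) =
  map_mx (rho i1) M *m map_mx xi N + map_mx xi M *m map_mx (rho i2) N.
Proof.
apply/matrixP=> i j; rewrite !mxE raddf_sum -big_split /=.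
by apply: eq_bigr => c _; rewrite (ts_mul ts) !mxE.
Qed.

Lemma mx_neq0_entry q p (M : 'M[k]_(q, p)) : M != 0 -> exists i j, M i j != 0.
Proof.
move=> nzM; case: (classic (exists i j, M i j != 0)) => // no.
case/eqP: nzM; apply/matrixP=> i j; rewrite [RHS]mxE; apply/eqP.
by apply: contraT => nz; case: no; exists i, j.
Qed.

(** A reduced null-homotopic map is [topmx U] times something plus something times [topmx T], so it
    dies between a left kernel of the first and a right kernel of the second. An elementary matrix
    placed where both kernels have nonzero entries survives. *)
Lemma hom1_rank T U : is_cpx e T -> is_cpx e U -> type12 T -> type12 U ->
  hom1 e T U -> row_free (topmx U) \/ row_full (topmx T).
Proof.
move=> cT cU tT tU hTU.
have [|] := boolP (row_free (topmx U)); first by left.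
rewrite -kermx_eq0 => /mx_neq0_entry[i [r nzr]].
have [|] := boolP (row_full (topmx T)); first by right.
rewrite -cokermx_eq0 => /mx_neq0_entry[c [j nzc]].
have [z ez xiz] := ts_unit ts.
have [|h1 [h0 [_ _ /(congr1 (map_mx xi))]]] := hTU (elem_mx r c z).
  by apply: in12_elem; rewrite ?tT.2 ?tU.1.
rewrite raddfD /= !map_xiM (type12_minimal rs cT tT) (type12_minimal rs cU tU).
rewrite mul0mx mulmx0 add0r addr0.
have := mulmx_ker (topmx U); have := mulmx_coker (topmx T).
move: (kermx _) (cokermx _) nzr nzc => K C nzr nzc TC KU /(congr1 (fun M => K *m M *m C)).
rewrite mulmxDr mulmxDl mulmxA KU mul0mx mul0mx add0r -/(topmx T).
rewrite -!mulmxA TC !mulmx0 mulmxA => /matrixP/(_ i j)/eqP.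
suff -> : map_mx xi (elem_mx r c z) = elem_mx r c 1.
  rewrite [X in X == _]mxE (bigD1 c) //= mulmx_elem eqxx mulr1 big1 ?addr0 => [|l ne_l].
    by rewrite mxE mulf_eq0 (negPf nzr) (negPf nzc).
  by rewrite mulmx_elem (negPf ne_l) mul0r.
apply/matrixP=> p q; rewrite !mxE; case: ifP => _ //; exact: raddf0.
Qed.

Section Iso.
Variables T U : cpx k A.
Hypotheses (cT : is_cpx e T) (cU : is_cpx e U) (tT : type12 T) (tU : type12 U).
Hypothesis isoTU : isoK e T U.

Lemma isoK_row_full : row_full (topmx T) -> row_full (topmx U).
Proof.
have minT := type12_minimal rs cT tT; have minU := type12_minimal rs cU tU.
have [f1 [f0 [g1 [g0 [cf cg fg1 _]]]]] := isoK_minimal minT minU isoTU.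
move=> /row_fullP[N NT]; apply/row_fullP.
exists (map_mx (rho i2) f1 *m N *m map_mx (rho i1) g0).
have := congr1 (map_mx xi) cg.2.2; rewrite !map_xiM minU minT mulmx0 mul0mx addr0 add0r.
rewrite -/(topmx U) -/(topmx T) -!mulmxA => ->; rewrite (mulmxA N) NT mul1mx -map_mxM fg1.
exact: (map_rho_idm_const rs tU.2).
Qed.

Lemma isoK_row_free : row_free (topmx T) -> row_free (topmx U).
Proof.
have minT := type12_minimal rs cT tT; have minU := type12_minimal rs cU tU.
have [f1 [f0 [g1 [g0 [cf cg _ fg0]]]]] := isoK_minimal minT minU isoTU.
move=> /row_freeP[N NT]; apply/row_freeP.
exists (map_mx (rho i2) f1 *m N *m map_mx (rho i1) g0).
have := congr1 (map_mx xi) cf.2.2; rewrite !map_xiM minU minT mulmx0 mul0mx addr0 add0r.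
rewrite -/(topmx U) -/(topmx T) !mulmxA => <-; rewrite -(mulmxA _ _ N) NT mulmx1 -map_mxM fg0.
exact: (map_rho_idm_const rs tU.1).
Qed.

End Iso.

Lemma row_free_complement q p (M : 'M[k]_(q, p)) : row_free M ->
  exists m (S : 'M[k]_(m, p)) R, [/\ (q + m = p)%N,
    col_mx M S *m R = 1%:M & R *m col_mx M S = 1%:M].
Proof.
move=> freeM; exists _, (row_base (M^C)%MS).
have rk : \rank (col_mx M (row_base (M^C)%MS)) = p.
  rewrite -addsmxE (adds_eqmx (eqmx_refl _) (eq_row_base _)).
  exact/eqP/addsmx_compl_full.
have eqp : (q + \rank (M^C)%MS = p)%N.
  by rewrite mxrank_compl (eqP freeM) subnKC // -(eqP freeM) rank_leq_col.
have /row_fullP[R RM] : row_full (col_mx M (row_base (M^C)%MS)) by rewrite /row_full rk.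
have /row_freeP[R' MR] : row_free (col_mx M (row_base (M^C)%MS)).
  by rewrite /row_free rk eqp.
exists R; split=> //.
by have <- : R' = R by rewrite -[R]mulmx1 -MR mulmxA RM mul1mx.
Qed.

Lemma rho_mx_off q p (t : 'I_q -> 'I_2) (s : 'I_p -> 'I_2) i j F :
  (forall r, t r = j) -> i != j -> wt e t s F -> map_mx (rho i) F = 0.
Proof.
move=> tj ne_ij wF; apply/matrixP=> r c; rewrite !mxE; apply/eqP; apply: contraT.
by move=> /(rho_wt rs wF)[+ _]; rewrite tj => eq_ij; rewrite eq_ij eqxx in ne_ij.
Qed.

Definition scal_mx q p j (M : 'M[k]_(q, p)) := map_mx (fun c => c *: e j) M.

Lemma wt_scal q p (t : 'I_q -> 'I_2) (s : 'I_p -> 'I_2) j M :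
  (forall r, t r = j) -> (forall c, s c = j) -> wt e t s (@scal_mx q p j M).
Proof. by move=> tj sj r c; rewrite !mxE tj sj -scalerAr -scalerAl !ee. Qed.

Lemma rho_scal q p j M : map_mx (rho j) (@scal_mx q p j M) = M.
Proof.
by apply/matrixP=> r c; rewrite !mxE (rs_scale rs) (rs_rho_e rs) eqxx mulr1.
Qed.

(** Cyclicity gives [dif T = x N], where the residue of [N] is the reduction of T. Completing [N] by
    scalar rows to a change of basis of T^{-1} exhibits T as copies of x : P_2 -> P_1 plus copies of
    P_2[1]; indecomposability leaves one kind only. *)
Lemma split_right x T : cyclic_right e x -> xi x = 1 -> is_cpx e T -> type12 T ->
  row_free (topmx T) -> indecK e T -> n0 T = 0%N \/ n0 T = n1 T.
Proof.
move=> [ex gen] xix cT tT freeT indT.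
have [N NE] : exists N : 'M[A]_(n0 T, n1 T), forall r c,
    e i2 * N r c * e i2 = N r c /\ dif T r c = x * N r c.
  apply: (mx_choice (P := fun r c b => e i2 * b * e i2 = b /\ dif T r c = x * b)).
  move=> r c; have [b ? ?] := gen _ (in12_entry r c cT tT).
  by exists b.
have difE : dif T = x%:M *m N.
  by apply/matrixP=> r c; rewrite mul_scalar_mx mxE (NE r c).2.
have wN : wt e (fun=> i2) (lab1 T) N.
  by move=> r c; rewrite tT.2 (NE r c).1.
have topN : map_mx (rho i2) N = topmx T.
  apply/matrixP=> r c; rewrite !mxE (NE r c).2 (ts_mul ts) xix mul1r.
  by rewrite (in12_rad rs ex) mul0r add0r.
have [m [S [R [eqm SR RS]]]] := row_free_complement freeT.
pose U : cpx k A := Cpx (fun _ : 'I_(n0 T) => i2) (lab0 T) x%:M.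
pose V : cpx k A := @Cpx k A m 0 (fun=> i2) (fun=> i1) 0.
have tU : type12 U by split=> // p; apply: tT.1.
have cU : is_cpx e U.
  move=> r c /=; rewrite !mxE tT.1; case: eqP => _; rewrite ?mulr1n ?ex //.
  by rewrite mulr0n mulr0 mul0r.
have cV : is_cpx e V by apply: wt0.
have minV : minimal rho V by move=> i; rewrite /= map_mx0.
have cUV : is_cpx e (dsum U V) by apply/is_cpx_dsum.
pose F := col_mx N (scal_mx i2 S).
have labUV r : lab1 (dsum U V) r = i2 by rewrite /= /lab_sum; case: split.
have wF : wt e (lab1 (dsum U V)) (lab1 T) F.
  by apply/(wt_block_col ee); split=> //; apply: wt_scal => //; apply: tT.2.
have rhoF : map_mx (rho i2) F = col_mx (topmx T) S.
  by rewrite map_col_mx topN rho_scal.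
have [F' [wF' FF' F'F]] : exists F', [/\ wt e (lab1 T) (lab1 (dsum U V)) F',
    F *m F' = idm e (lab1 (dsum U V)) & F' *m F = idm e (lab1 T)].
  by apply: (corner_mx_inv rs (j := i2) (R := R)); rewrite ?rhoF //; apply: tT.2.
have [] := indT.2.2 U V cU cV; last 2 first.
- by move/(minimal_zeroK rs (type12_minimal rs cU tU)) => [] /=; left.
- by move/(minimal_zeroK rs minV) => [_ /= m0]; right; rewrite -eqm m0 addn0.
apply: (@isoK_strict _ _ _ _ rs T (dsum U V) F (col_mx (idm e (lab0 T)) 0)
  F' (row_mx (idm e (lab0 T)) 0)) => //=.
- split=> //; split; first by apply/(wt_block_col ee); split; [exact: wt_idm | exact: wt0].
  rewrite /= mul_col_mx (wtL ee cT) mul0mx mul_block_col !mul0mx !addr0 difE.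
  by [].
- by apply/(wt_block_row ee); split; [exact: wt_idm | exact: wt0].
- by rewrite mul_row_col mulmx0 addr0 idm_idem.
rewrite mul_col_row !mul0mx mulmx0 idm_idem // idm_lab_sum //.
by congr (block_mx _ _ _ _); apply/matrixP=> -[].
Qed.

(** Dual: [dif T = N x], and [N] is completed by scalar columns to a change of basis of T^0, which
    splits off copies of P_1. *)
Lemma split_left x T : cyclic_left e x -> xi x = 1 -> is_cpx e T -> type12 T ->
  row_full (topmx T) -> indecK e T -> n1 T = 0%N \/ n1 T = n0 T.
Proof.
move=> [ex gen] xix cT tT fullT indT.
have [N NE] : exists N : 'M[A]_(n0 T, n1 T), forall r c,
    e i1 * N r c * e i1 = N r c /\ dif T r c = N r c * x.
  apply: (mx_choice (P := fun r c b => e i1 * b * e i1 = b /\ dif T r c = b * x)).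
  move=> r c; have [b ? ?] := gen _ (in12_entry r c cT tT).
  by exists b.
have difE : dif T = N *m x%:M.
  by apply/matrixP=> r c; rewrite mul_mx_scalarE (NE r c).2.
have wN : wt e (lab0 T) (fun=> i1) N.
  by move=> r c; rewrite tT.1 (NE r c).1.
have topN : map_mx (rho i1) N = topmx T.
  apply/matrixP=> r c; rewrite !mxE (NE r c).2 (ts_mul ts) xix mulr1.
  by rewrite (in12_rad rs ex) mulr0 addr0.
have freeT : row_free (topmx T)^T by rewrite /row_free mxrank_tr.
have [m [S [R [eqm SR RS]]]] := row_free_complement freeT.
pose U : cpx k A := Cpx (lab1 T) (fun _ : 'I_(n1 T) => i1) x%:M.
pose V : cpx k A := @Cpx k A 0 m (fun=> i2) (fun=> i1) 0.
have tU : type12 U by split=> // p; apply: tT.2.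
have cU : is_cpx e U.
  move=> r c /=; rewrite !mxE tT.2; case: eqP => _; rewrite ?mulr1n ?ex //.
  by rewrite mulr0n mulr0 mul0r.
have cV : is_cpx e V by apply: wt0.
have minV : minimal rho V by move=> i; rewrite /= map_mx0.
have cUV : is_cpx e (dsum U V) by apply/is_cpx_dsum.
pose F := row_mx N (scal_mx i1 S^T).
have labUV r : lab0 (dsum U V) r = i1 by rewrite /= /lab_sum; case: split.
have wF : wt e (lab0 T) (lab0 (dsum U V)) F.
  by apply/(wt_block_row ee); split=> //; apply: wt_scal => //; apply: tT.1.
have rhoF : map_mx (rho i1) F = (col_mx (topmx T)^T S)^T.
  by rewrite map_row_mx topN rho_scal tr_col_mx trmxK.
have [F' [wF' FF' F'F]] : exists F', [/\ wt e (lab0 (dsum U V)) (lab0 T) F',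
    F *m F' = idm e (lab0 T) & F' *m F = idm e (lab0 (dsum U V))].
  apply: (corner_mx_inv rs (j := i1) (R := R^T)) => //; first exact: tT.1.
    by rewrite rhoF -trmx_mul RS trmx1.
  by rewrite rhoF -trmx_mul SR trmx1.
have [] := indT.2.2 U V cU cV; last 2 first.
- by move/(minimal_zeroK rs (type12_minimal rs cU tU)) => [_ /=]; left.
- by move/(minimal_zeroK rs minV) => [/= m0 _]; right; rewrite -eqm m0 addn0.
apply: isoK_sym.
apply: (@isoK_strict _ _ _ _ rs (dsum U V) T (row_mx (idm e (lab1 T)) 0) F
  (col_mx (idm e (lab1 T)) 0) F') => //=.
- split; first by apply/(wt_block_row ee); split; [exact: wt_idm | exact: wt0].
  split=> //.
  by rewrite /= mul_mx_row (wtR ee cT) mulmx0 mul_row_block !mulmx0 !addr0 difE.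
- by apply/(wt_block_col ee); split; [exact: wt_idm | exact: wt0].
- rewrite mul_col_row !mul0mx mulmx0 idm_idem // idm_lab_sum //.
  by congr (block_mx _ _ _ _); apply/matrixP=> -[].
by rewrite mul_row_col mulmx0 addr0 idm_idem.
Qed.

End Rank.

(** * Vanishing of the lifting obstruction *)

Section LiftAlongFibre.
Variables (k : fieldType) (G L M : falgType k).
Variables (eG : 'I_2 -> G) (eM : 'I_2 -> M).
Variables (rhoG : 'I_2 -> {rmorphism G -> k}) (rho : 'I_2 -> {rmorphism M -> k}).
Variables (xiG : {additive G -> k}) (xi : {additive M -> k}).
Variables (phi : {rmorphism G -> L}) (psi : {rmorphism G -> M}).
Hypotheses (rsG : residue_system eG rhoG) (rs : residue_system eM rho).
Hypotheses (ts : top_system eM rho xi).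
Hypotheses (psi_e : forall i, psi (eG i) = eM i).
Hypothesis xi_psi : forall x, xi (psi x) = xiG x.
Hypothesis phi_ker : forall x, phi x = 0 -> xiG x = 0.
Hypothesis ker_lift : forall y, in_rad rho y -> xi y = 0 ->
  exists x, phi x = 0 /\ psi x = y.
Hypothesis joint_inj : forall x, phi x = 0 -> psi x = 0 -> x = 0.
Let eeG := rs_idem rsG.
Let ee := rs_idem rs.

Lemma orth12 : eM i1 * eM i2 = 0.
Proof.
apply: (addrI (eM i1)); rewrite addr0 -{1}(ee i1) -mulrDr (rs_sum rs).
exact: mulr1.
Qed.

Lemma xi_diag j x : xi (eM j * x * eM j) = 0.
Proof.
rewrite -(ts_corner ts); have [->|->] := ord2_case j.
  by rewrite -!mulrA orth12 !mulr0 raddf0.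
by rewrite !mulrA orth12 !mul0r raddf0.
Qed.

Lemma joint_inj_mx q p (F H : 'M[G]_(q, p)) :
  map_mx phi F = map_mx phi H -> map_mx psi F = map_mx psi H -> F = H.
Proof.
move=> eqphi eqpsi; apply/matrixP=> r c; apply/subr0_eq; apply: joint_inj.
  by have /matrixP/(_ r c) := eqphi; rewrite !mxE rmorphB => ->; rewrite subrr.
by have /matrixP/(_ r c) := eqpsi; rewrite !mxE rmorphB => ->; rewrite subrr.
Qed.

(** [xi] vanishes on diagonal corners, so a corner element of residue 0 is zero in the triangular
    quotient and comes from the kernel of [phi]. *)
Lemma ker_lift_mx q p (t : 'I_q -> 'I_2) (s : 'I_p -> 'I_2) j H :
  (forall r, t r = j) -> (forall c, s c = j) -> wt eM t s H ->
  map_mx (rho j) H = 0 ->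
  exists H', [/\ wt eG t s H', map_mx phi H' = 0 & map_mx psi H' = H].
Proof.
move=> tj sj wH H0; have /rad_mxP radH : rad_mx rho H.
  by move=> i; have [-> // | ne_ij] := eqVneq i j; apply: (rho_mx_off rs tj ne_ij wH).
have [H' HE] : exists H' : 'M[G]_(q, p), forall r c,
    phi (H' r c) = 0 /\ psi (H' r c) = H r c.
  apply: (mx_choice (P := fun r c x => phi x = 0 /\ psi x = H r c)) => r c.
  by apply: ker_lift; [apply: radH | rewrite wH tj sj xi_diag].
exists (idm eG t *m H' *m idm eG s); split; first exact: wt_sandwich.
  have phiH : map_mx phi H' = 0 by apply/matrixP=> r c; rewrite !mxE (HE r c).1.
  by rewrite !map_mxM phiH mulmx0 mul0mx.
have psiH : map_mx psi H' = H by apply/matrixP=> r c; rewrite !mxE (HE r c).2.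
by rewrite !map_mxM !(map_idm psi_e) psiH (wtL ee wH) (wtR ee wH).
Qed.

Lemma psi_in12 q p (t : 'I_q -> 'I_2) (s : 'I_p -> 'I_2) F r c :
  (forall r, t r = i1) -> (forall c, s c = i2) -> wt eG t s F ->
  in12 eM (psi (F r c)).
Proof.
by move=> t1 s2 wF; rewrite /in12 [in RHS]wF !rmorphM !psi_e t1 s2.
Qed.

(** Over M, F = C x and dif T = D x. As S lifts a left inverse of the reduction of T, the matrix S D
    has residue 1 and an inverse V, whence F = (C V S) dif T. The factor C V S has residue 0 because
    phi F = 0, so it lifts into the kernel of [phi]. *)
Lemma lifts_row_full x (T U : cpx k G) : cyclic_left eM x -> xi x = 1 ->
  is_cpx eG T -> type12 T -> type12 U -> row_full (topmx xiG T) ->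
  lifts eG phi T U.
Proof.
move=> [ex gen] xix cT tT tU /row_fullP[N NT] F wF phiF.
have factor q p (t : 'I_q -> 'I_2) (s : 'I_p -> 'I_2) (F1 : 'M[G]_(q, p)) :
    (forall r, t r = i1) -> (forall c, s c = i2) -> wt eG t s F1 ->
    exists C, [/\ wt eM t (fun=> i1) C, map_mx psi F1 = C *m x%:M
                & map_mx (rho i1) C = map_mx xiG F1].
  move=> t1 s2 wF1; have [C CE] : exists C : 'M[M]_(q, p), forall r c,
      eM i1 * C r c * eM i1 = C r c /\ psi (F1 r c) = C r c * x.
    apply: (mx_choice (P := fun r c b => eM i1 * b * eM i1 = b /\ psi (F1 r c) = b * x)).
    by move=> r c; have [b ? ?] := gen _ (psi_in12 r c t1 s2 wF1); exists b.
  exists C; split=> [r c||]; first by rewrite t1 (CE r c).1.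
    by apply/matrixP=> r c; rewrite mul_mx_scalarE mxE (CE r c).2.
  apply/matrixP=> r c; rewrite !mxE -xi_psi (CE r c).2 (ts_mul ts) xix mulr1.
  by rewrite (in12_rad rs ex) mulr0 addr0.
have [C [wC FC rhoC]] := factor _ _ _ _ _ tU.1 tT.2 wF.
have [D [wD TD rhoD]] := factor _ _ _ _ _ tT.1 tT.2 cT.
pose S := scal_mx eM i1 N.
have wS : wt eM (fun=> i1) (lab0 T) S by apply: (wt_scal rs) => //; apply: tT.1.
have rhoSD : map_mx (rho i1) (S *m D) = 1%:M.
  by rewrite map_mxM (rho_scal rs) rhoD NT.
have [V [wV _ VSD]] := corner_mx_inv rs (fun=> erefl) (fun=> erefl) (wtM ee wS wD)
  (etrans (mulmx1 _) rhoSD) (etrans (mul1mx _) rhoSD).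
have [|H [wH phiH psiH]] := ker_lift_mx tU.1 tT.1 (wtM ee (wtM ee wC wV) wS).
  rewrite !map_mxM rhoC; have -> : map_mx xiG F = 0; last by rewrite !mul0mx.
  apply/matrixP=> r c; rewrite !mxE; apply: phi_ker.
  by have /matrixP/(_ r c) := phiF; rewrite !mxE.
exists 0, H; rewrite !map_mx0; split=> //; first exact: wt0.
rewrite mulmx0 add0r; apply: joint_inj_mx; rewrite map_mxM.
  by rewrite phiF phiH mul0mx.
rewrite psiH TD FC !mulmxA -!(mulmxA C) -(mulmxA V) VSD.
by rewrite mulmxA (wtR ee wC).
Qed.

(** Dual factorisation F = dif U (S V C) over M, with S lifting a right inverse of the reduction of
    U. *)
Lemma lifts_row_free x (T U : cpx k G) : cyclic_right eM x -> xi x = 1 ->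
  is_cpx eG U -> type12 T -> type12 U -> row_free (topmx xiG U) ->
  lifts eG phi T U.
Proof.
move=> [ex gen] xix cU tT tU /row_freeP[N NU] F wF phiF.
have factor q p (t : 'I_q -> 'I_2) (s : 'I_p -> 'I_2) (F1 : 'M[G]_(q, p)) :
    (forall r, t r = i1) -> (forall c, s c = i2) -> wt eG t s F1 ->
    exists C, [/\ wt eM (fun=> i2) s C, map_mx psi F1 = x%:M *m C
                & map_mx (rho i2) C = map_mx xiG F1].
  move=> t1 s2 wF1; have [C CE] : exists C : 'M[M]_(q, p), forall r c,
      eM i2 * C r c * eM i2 = C r c /\ psi (F1 r c) = x * C r c.
    apply: (mx_choice (P := fun r c b => eM i2 * b * eM i2 = b /\ psi (F1 r c) = x * b)).
    by move=> r c; have [b ? ?] := gen _ (psi_in12 r c t1 s2 wF1); exists b.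
  exists C; split=> [r c||]; first by rewrite s2 (CE r c).1.
    by apply/matrixP=> r c; rewrite mul_scalar_mx !mxE (CE r c).2.
  apply/matrixP=> r c; rewrite !mxE -xi_psi (CE r c).2 (ts_mul ts) xix mul1r.
  by rewrite (in12_rad rs ex) mul0r add0r.
have [C [wC FC rhoC]] := factor _ _ _ _ _ tU.1 tT.2 wF.
have [D [wD UD rhoD]] := factor _ _ _ _ _ tU.1 tU.2 cU.
pose S := scal_mx eM i2 N.
have wS : wt eM (lab1 U) (fun=> i2) S by apply: (wt_scal rs) => //; apply: tU.2.
have rhoDS : map_mx (rho i2) (D *m S) = 1%:M.
  by rewrite map_mxM (rho_scal rs) rhoD NU.
have [V [wV DSV _]] := corner_mx_inv rs (fun=> erefl) (fun=> erefl) (wtM ee wD wS)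
  (etrans (mulmx1 _) rhoDS) (etrans (mul1mx _) rhoDS).
have [|H [wH phiH psiH]] := ker_lift_mx tU.2 tT.2 (wtM ee wS (wtM ee wV wC)).
  rewrite !map_mxM rhoC; have -> : map_mx xiG F = 0; last by rewrite !mulmx0.
  apply/matrixP=> r c; rewrite !mxE; apply: phi_ker.
  by have /matrixP/(_ r c) := phiF; rewrite !mxE.
exists H, 0; rewrite !map_mx0; split=> //; first exact: wt0.
rewrite mul0mx addr0; apply: joint_inj_mx; rewrite map_mxM.
  by rewrite phiF phiH mulmx0.
rewrite psiH UD FC -(mulmxA x%:M) (mulmxA D) (mulmxA (D *m S)) DSV.
by rewrite (wtL ee wC).
Qed.

End LiftAlongFibre.

Lemma lifts_no_hom (k : fieldType) (G L : falgType k) (eG : 'I_2 -> G)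
    (phi : {rmorphism G -> L}) (T U : cpx k G) :
  (forall x, eG i2 * x * eG i1 = 0) ->
  (forall p q, lab0 U p = i2 /\ lab1 T q = i1) -> lifts eG phi T U.
Proof.
move=> tri off F wF _; exists 0, 0; rewrite !map_mx0.
split=> //; try by move=> r c; rewrite mxE mulr0 mul0r.
rewrite mulmx0 mul0mx addr0; apply/matrixP=> r c; rewrite wF mxE.
by have [-> ->] := off r c.
Qed.

(** * Cones and fans *)

Local Notation RR := Rdefinitions.R.

Definition lform (p q : RR) (v : plane) : RR := p * v 0 i1 + q * v 0 i2.

Lemma lformD p q u v : lform p q (u + v) = lform p q u + lform p q v.
Proof. by rewrite /lform !mxE !mulrDr addrACA. Qed.

Lemma lformZ p q c v : lform p q (c *: v) = c * lform p q v.
Proof. by rewrite /lform !mxE mulrDr [p * _]mulrCA [q * _]mulrCA. Qed.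

Lemma lform_sum p q n (F : 'I_n -> plane) :
  lform p q (\sum_i F i) = \sum_i lform p q (F i).
Proof.
apply: (big_morph (lform p q) (lformD p q)).
by rewrite /lform !mxE !mulr0 addr0.
Qed.

Lemma planeP (u v : plane) : u 0 i1 = v 0 i1 -> u 0 i2 = v 0 i2 -> u = v.
Proof. by move=> h1 h2; apply/rowP=> i; have [->|->] := ord2_case i. Qed.

Section Cones.
Variable vs : seq plane.

Lemma cone_sum n (F : 'I_n -> plane) :
  (forall i, cone vs (F i)) -> cone vs (\sum_i F i).
Proof.
move=> /fin_all_exists[c cP]; exists (fun j => \sum_i c i j); split=> [j|].
  by apply: sumr_ge0 => i _; apply: (cP i).1.
under [RHS]eq_bigr => j _ do rewrite scaler_suml.
by rewrite exchange_big; apply: eq_bigr => i _; rewrite {1}(cP i).2.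
Qed.

Lemma cone_scale a x : 0 <= a -> cone vs x -> cone vs (a *: x).
Proof.
move=> a0 [c [c0 ->]]; exists (fun j => a * c j); split=> [j|].
  exact: mulr_ge0.
by rewrite scaler_sumr; apply: eq_bigr => j _; rewrite scalerA.
Qed.

Lemma cone_nth i : (i < size vs)%N -> cone vs (nth 0 vs i).
Proof.
move=> lti; exists (fun j => (j == Ordinal lti)%:R); split=> [j|].
  exact: ler0n.
rewrite (bigD1 (Ordinal lti)) //= eqxx scale1r big1 ?addr0 // => j /negPf->.
by rewrite scale0r.
Qed.

Lemma cone_lform_ge0 p q x : (forall i, (i < size vs)%N -> 0 <= lform p q (nth 0 vs i)) ->
  cone vs x -> 0 <= lform p q x.
Proof.
move=> ge0 [c [c0 ->]]; rewrite lform_sum; apply: sumr_ge0 => i _.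
by rewrite lformZ mulr_ge0 ?ge0.
Qed.

(** In a nonnegative combination on which the form vanishes, each generator with positive
    coefficient lies on the face; a nonzero point needs a nonzero one. *)
Lemma cone_lform_face p q x : (forall i, (i < size vs)%N -> 0 <= lform p q (nth 0 vs i)) ->
  cone vs x -> lform p q x = 0 -> x != 0 ->
  exists i, [/\ (i < size vs)%N, lform p q (nth 0 vs i) = 0 & nth 0 vs i != 0].
Proof.
move=> ge0 [c [c0 ->]]; rewrite lform_sum => /eqP; rewrite psumr_eq0; last first.
  by move=> i _; rewrite lformZ mulr_ge0 ?ge0.
move=> /allP face nz.
case: (classic (exists i,
  [/\ (i < size vs)%N, lform p q (nth 0 vs i) = 0 & nth 0 vs i != 0])) => // no.
case/eqP: nz; apply: big1 => i _.
have := face i (mem_index_enum i); rewrite lformZ mulf_eq0.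
case/orP=> /eqP z; first by rewrite z scale0r.
have [-> | nz] := eqVneq (nth 0 vs i) 0; first by rewrite scaler0.
by case: no; exists i.
Qed.

End Cones.

Lemma cone_trans vs ws x : (forall i, (i < size vs)%N -> cone ws (nth 0 vs i)) ->
  cone vs x -> cone ws x.
Proof. by move=> sub [c [c0 ->]]; apply: cone_sum => i; apply: cone_scale; auto. Qed.

Lemma dim2_not_line vs (w : plane) : (w 0 i1 != 0) || (w 0 i2 != 0) ->
  dim2 (cone vs) -> ~ (forall i, (i < size vs)%N -> exists a, nth 0 vs i = a *: w).
Proof.
move=> nzw [u [v [Cu [Cv /eqP det]]]] line.
have on_line x : cone vs x -> w 0 i1 * x 0 i2 = w 0 i2 * x 0 i1.
  move=> Cx; apply/eqP; rewrite eq_le; apply/andP; split.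
    have : 0 <= lform (w 0 i2) (- w 0 i1) x.
      apply: cone_lform_ge0 Cx => i /line[a ->]; rewrite /lform !mxE; lra.
    rewrite /lform; lra.
  have : 0 <= lform (- w 0 i2) (w 0 i1) x.
    apply: cone_lform_ge0 Cx => i /line[a ->]; rewrite /lform !mxE; lra.
  rewrite /lform; lra.
have hu := on_line u Cu; have hv := on_line v Cv.
case/orP: nzw => nz; apply: det; apply: (mulfI nz); rewrite mulr0 mulrBr.
  by rewrite [w 0 i1 * (u 0 i2 * _)]mulrA hu mulrCA hv; lra.
by rewrite [w 0 i2 * (u 0 i1 * _)]mulrA -hu [w 0 i2 * (u 0 i2 * _)]mulrCA -hv; lra.
Qed.

(** If no generator were a positive multiple of one of the two vectors, all generators would lie on
    the line of the other. *)
Lemma cone_eq_two vs (w1 w2 : plane) :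
  (w1 0 i1 != 0) || (w1 0 i2 != 0) -> (w2 0 i1 != 0) || (w2 0 i2 != 0) ->
  (forall i, (i < size vs)%N -> exists2 a, 0 <= a &
     nth 0 vs i = a *: w1 \/ nth 0 vs i = a *: w2) ->
  dim2 (cone vs) -> same_set (cone vs) (cone [:: w1; w2]).
Proof.
move=> nz1 nz2 two d2 x; split; apply: cone_trans => i.
  move=> /two[a a0 [] ->]; apply: cone_scale => //.
    exact: (@cone_nth [:: w1; w2] 0).
  exact: (@cone_nth [:: w1; w2] 1).
have hit (w w' : plane) : (w' 0 i1 != 0) || (w' 0 i2 != 0) ->
    (forall i, (i < size vs)%N -> exists2 a, 0 <= a &
       nth 0 vs i = a *: w \/ nth 0 vs i = a *: w') -> cone vs w.
  move=> nz two'.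
  case: (classic (exists i a, [/\ (i < size vs)%N, 0 < a & nth 0 vs i = a *: w])).
    move=> [j [a [ltj a0 vj]]].
    have -> : w = a^-1 *: nth 0 vs j by rewrite vj scalerA mulVf ?scale1r ?gt_eqF.
    by apply: cone_scale; [rewrite invr_ge0 ltW | apply: cone_nth].
  move=> no; case: (dim2_not_line nz d2) => j ltj.
  have [a a0 [vj | ->]] := two' j ltj; last by exists a.
  have [aeq0 | nza] := eqVneq a 0; first by exists 0; rewrite vj aeq0 !scale0r.
  by case: no; exists j, a; rewrite lt_neqAle a0 eq_sym nza.
case: i => [|[|//]] _ /=; first exact: hit nz2 two.
by apply: hit nz1 _ => i /two[a a0 []]; exists a => //; [right | left].
Qed.

(** These are the facet forms of sigma: each vanishes on one of its two rays. *)
Lemma sigma_coneP x : cone [:: vec2 0 (-1); vec2 1 (-1)] x ->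
  0 <= lform 1 0 x /\ 0 <= lform (-1) (-1) x.
Proof.
by move=> Cx; split; apply: cone_lform_ge0 Cx => -[|[|//]] _;
  rewrite /lform !mxE /=; lra.
Qed.

Lemma sigma'_coneP x : cone [:: vec2 1 (-1); vec2 1 0] x ->
  0 <= lform 0 (-1) x /\ 0 <= lform 1 1 x.
Proof.
by move=> Cx; split; apply: cone_lform_ge0 Cx => -[|[|//]] _;
  rewrite /lform !mxE /=; lra.
Qed.

Section Fan.
Variables (k : fieldType) (A : falgType k) (e : 'I_2 -> A).
Hypothesis ee : forall i, e i * e i = e i.

(** Summands are kept in a list and never added up, so that base change acts on each of them
    separately. *)
Definition fan_data (ts : seq (cpx k A)) :=
  [/\ forall i, (i < size ts)%N -> indecK e (nth cpx0 ts i),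
      forall i j, (i < size ts)%N -> (j < size ts)%N -> i != j ->
        ~ isoK e (nth cpx0 ts i) (nth cpx0 ts j)
    & forall i j, (i < size ts)%N -> (j < size ts)%N ->
        hom1 e (nth cpx0 ts i) (nth cpx0 ts j)].

Lemma in_gfanP C : in_gfan k A e C <->
  exists2 ts, fan_data ts & same_set C (cone (map gvec ts)).
Proof.
split=> [[ts [ind [niso [pre eqC]]]] | [ts [ind niso hom] eqC]].
  have [cts hom] := (presilting_bigdsum ee ts).1 pre.
  exists ts => //; split=> // i => [lti | j lti ltj ne_ij].
    exact: (ind (Ordinal lti)).
  exact: (niso (Ordinal lti) (Ordinal ltj) ne_ij).
exists ts; split; first by move=> i; apply: ind.
split; first by move=> i j ne_ij; apply: niso.
split=> //; apply/(presilting_bigdsum ee); split=> // i /ind; by case.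
Qed.

Lemma gvec_type12 (T : cpx k A) : type12 T -> gvec T = vec2 (n0 T)%:R (- (n1 T)%:R).
Proof.
case=> l0 l1; apply: planeP; rewrite !mxE /=.
  rewrite (eq_card (B := predT)) => [|j]; last by rewrite !inE l0 eqxx.
  rewrite [X in _ - Posz X](eq_card (B := pred0)) => [|j]; last by rewrite !inE l1.
  by rewrite card0 card_ord subr0.
rewrite (eq_card (B := pred0)) => [|j]; last by rewrite !inE l0.
rewrite [X in _ - Posz X](eq_card (B := predT)) => [|j]; last by rewrite !inE l1 eqxx.
by rewrite card0 card_ord sub0r rmorphN.
Qed.

End Fan.

Lemma fan_data_map (k : fieldType) (A B : falgType k) (e : 'I_2 -> A) (f : 'I_2 -> B)
    (F : cpx k A -> cpx k B) ts : fan_data e ts ->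
  (forall i, (i < size ts)%N -> indecK f (F (nth cpx0 ts i))) ->
  (forall i j, (i < size ts)%N -> (j < size ts)%N ->
     isoK f (F (nth cpx0 ts i)) (F (nth cpx0 ts j)) ->
     isoK e (nth cpx0 ts i) (nth cpx0 ts j)) ->
  (forall i j, (i < size ts)%N -> (j < size ts)%N ->
     hom1 f (F (nth cpx0 ts i)) (F (nth cpx0 ts j))) ->
  fan_data f (map F ts).
Proof.
case=> ind niso hom indF isoF homF; split.
- by move=> i; rewrite size_map => lti; rewrite (nth_map cpx0) //; apply: indF.
- move=> i j; rewrite size_map => lti ltj ne_ij; rewrite !(nth_map cpx0) //.
  by move=> /isoF-/(_ lti ltj); apply: niso.
by move=> i j; rewrite size_map => lti ltj; rewrite !(nth_map cpx0) //; apply: homF.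
Qed.

Lemma map_gvec (k : fieldType) (A B : falgType k) (F : cpx k A -> cpx k B) ts :
  (forall i, (i < size ts)%N -> gvec (F (nth cpx0 ts i)) = gvec (nth cpx0 ts i)) ->
  map gvec (map F ts) = map gvec ts.
Proof.
move=> FE; apply: (@eq_from_nth _ 0); rewrite !size_map // => i lti.
by rewrite !(nth_map cpx0) ?size_map // FE.
Qed.

Lemma fan_data_minimal (k : fieldType) (A : falgType k) (e : 'I_2 -> A)
    (rho : 'I_2 -> {rmorphism A -> k}) ts :
  residue_system e rho -> fan_data e ts ->
  exists ts', [/\ fan_data e ts', map gvec ts' = map gvec ts
    & forall i, (i < size ts')%N -> minimal rho (nth cpx0 ts' i)].
Proof.
move=> rs dts; have ee := rs_idem rs.
have exF T : exists T', is_cpx e T ->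
    [/\ is_cpx e T', minimal rho T', isoK e T T' & gvec T' = gvec T].
  case: (classic (is_cpx e T)) => [cT | ncT]; last by exists T.
  by have [T' ?] := minimal_replacement rs cT; exists T'.
pose F T := sval (constructive_indefinite_description _ (exF T)).
have FP T : is_cpx e T -> [/\ is_cpx e (F T), minimal rho (F T), isoK e T (F T)
    & gvec (F T) = gvec T].
  exact: svalP (constructive_indefinite_description _ (exF T)).
have [ind niso hom] := dts.
have cts i (lti : (i < size ts)%N) : is_cpx e (nth cpx0 ts i) by have [] := ind i lti.
exists (map F ts); split.
- apply: (fan_data_map dts) => [i lti | i j lti ltj isoF | i j lti ltj].
  + by have [cF _ isoTF _] := FP _ (cts i lti); apply: indecK_isoK (ind i lti).
  + have [_ _ iso_i _] := FP _ (cts i lti); have [_ _ iso_j _] := FP _ (cts j ltj).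
    apply: (isoK_trans ee iso_i); apply: (isoK_trans ee isoF).
    exact: isoK_sym.
  have [ci _ iso_i _] := FP _ (cts i lti); have [cj _ iso_j _] := FP _ (cts j ltj).
  exact: (hom1_isoK ee ci cj iso_i iso_j) (hom i j lti ltj).
- by apply: map_gvec => i lti; have [_ _ _ ->] := FP _ (cts i lti).
move=> i; rewrite size_map => lti; rewrite (nth_map cpx0) //.
by have [] := FP _ (cts i lti).
Qed.

(** * The fibre product *)

Section FibreProduct.
Variables (k : fieldType) (L M : falgType k).

HB.instance Definition _ := GRing.UnitAlgebra.on (L * M)%type.
HB.instance Definition _ := Vector.on (L * M)%type.

(** The three entries of the triangular matrix give three linear equations on L x M; their solutions
    form a subalgebra because both sides obey the same product rules. *)
Lemma fibre_product (rho : 'I_2 -> {rmorphism L -> k}) (rho' : 'I_2 -> {rmorphism M -> k})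
    (xi : {additive L -> k}) (xi' : {additive M -> k}) :
  (forall i c x, rho i (c *: x) = c * rho i x) ->
  (forall i c x, rho' i (c *: x) = c * rho' i x) ->
  (forall c x, xi (c *: x) = c * xi x) -> (forall c x, xi' (c *: x) = c * xi' x) ->
  (forall x y, xi (x * y) = rho i1 x * xi y + xi x * rho i2 y) ->
  (forall x y, xi' (x * y) = rho' i1 x * xi' y + xi' x * rho' i2 y) ->
  exists (G : falgType k) (phi : {rmorphism G -> L}) (psi : {rmorphism G -> M}),
  [/\ forall c x, phi (c *: x) = c *: phi x /\ psi (c *: x) = c *: psi x,
      forall x, (forall i, rho i (phi x) = rho' i (psi x)) /\ xi (phi x) = xi' (psi x),
      forall x y, phi x = phi y -> psi x = psi y -> x = y,
      forall a b, (forall i, rho i a = rho' i b) -> xi a = xi' b ->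
        exists x, phi x = a /\ psi x = b
    & forall x, phi x \is a GRing.unit -> psi x \is a GRing.unit ->
        x \is a GRing.unit].
Proof.
move=> rhoZ rhoZ' xiZ xiZ' xiM xiM'.
have lin_rho i : linear ((fun x : L * M => rho i x.1 - rho' i x.2) : _ -> k^o).
  move=> c x y; have : rho i (c *: x.1 + y.1) - rho' i (c *: x.2 + y.2) =
      c * (rho i x.1 - rho' i x.2) + (rho i y.1 - rho' i y.2) :> k; last by [].
  by rewrite !rmorphD rhoZ rhoZ' ?opprD addrACA -mulrBr.
have lin_xi : linear ((fun x : L * M => xi x.1 - xi' x.2) : _ -> k^o).
  move=> c x y; have : xi (c *: x.1 + y.1) - xi' (c *: x.2 + y.2) =
      c * (xi x.1 - xi' x.2) + (xi y.1 - xi' y.2) :> k; last by [].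
  by rewrite !raddfD /= xiZ xiZ' addrACA -mulrBr.
pose drho i : {linear (L * M)%type -> k^o} := HB.pack
  (fun x : L * M => rho i x.1 - rho' i x.2 : k^o)
  (GRing.isLinear.Build k (L * M)%type k^o *:%R _ (lin_rho i)).
pose dxi : {linear (L * M)%type -> k^o} := HB.pack (fun x : L * M => xi x.1 - xi' x.2 : k^o)
  (GRing.isLinear.Build k (L * M)%type k^o *:%R _ lin_xi).
pose V : {vspace (L * M)%type} :=
  (lker (linfun (drho i1)) :&: lker (linfun (drho i2)) :&: lker (linfun dxi))%VS.
have memV x : x \in V <-> (forall i, rho i x.1 = rho' i x.2) /\ xi x.1 = xi' x.2.
  rewrite !memv_cap !memv_ker !lfunE /= !subr_eq0; split.
    case/andP=> /andP[/eqP r1 /eqP r2] /eqP x12; split=> // i.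
    by have [->|->] := ord2_case i.
  by case=> r ->; rewrite !r !eqxx.
have V1 : 1 \in V.
  apply/memV; split=> [i|]; first by rewrite !rmorph1.
  (* The product rule applied to 1 = 1 * 1 gives f 1 = f 1 + f 1. *)
  have z (R : pzRingType) (r1 r2 : {rmorphism R -> k}) (f : {additive R -> k}) :
      (forall x y, f (x * y) = r1 x * f y + f x * r2 y) -> f 1 = 0.
    move=> fM; apply: (addrI (f 1)); rewrite addr0.
    by have := fM 1 1; rewrite mulr1 !rmorph1 mul1r mulr1.
  by rewrite (z _ _ _ _ xiM) (z _ _ _ _ xiM').
have VV : (V * V <= V)%VS.
  apply/prodvP=> x y /memV[rx xx] /memV[ry xy]; apply/memV; split=> [i|].
    by rewrite !rmorphM rx ry.
  by rewrite xiM xiM' !rx !ry xx xy.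
have asV : is_aspace V by rewrite /is_aspace has_algid1.
pose B := ASpace asV; pose G : falgType k := subvs_of B.
have one : vsval (1 : G) = 1 by apply/eqP; rewrite algid_eq1.
have phiB : zmod_morphism (fun x : G => (vsval x).1) by move=> x y.
have psiB : zmod_morphism (fun x : G => (vsval x).2) by move=> x y.
have phiM : monoid_morphism (fun x : G => (vsval x).1).
  by split=> [|x y //]; exact: (congr1 fst one).
have psiM : monoid_morphism (fun x : G => (vsval x).2).
  by split=> [|x y //]; exact: (congr1 snd one).
pose phi : {rmorphism G -> L} := HB.pack (fun x : G => (vsval x).1)
  (GRing.isZmodMorphism.Build G L (fun x : G => (vsval x).1) phiB)
  (GRing.isMonoidMorphism.Build G L (fun x : G => (vsval x).1) phiM).
pose psi : {rmorphism G -> M} := HB.pack (fun x : G => (vsval x).2)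
  (GRing.isZmodMorphism.Build G M (fun x : G => (vsval x).2) psiB)
  (GRing.isMonoidMorphism.Build G M (fun x : G => (vsval x).2) psiM).
exists G, phi, psi; split.
- by [].
- by move=> x; apply/memV/(subvsP x).
- move=> x y; rewrite /= => eq1 eq2; apply: val_inj => /=.
  by rewrite [LHS]surjective_pairing eq1 eq2 -surjective_pairing.
- move=> a b eqr eqx; have Vab : (a, b) \in B by apply/memV.
  by exists (Subvs Vab).
(* An element invertible in L x M has its inverse in the subalgebra, by finite dimension. *)
move=> x u1 u2; apply: vsval_unitr.
apply/unitrP; exists ((phi x)^-1, (psi x)^-1).
by split; rewrite [LHS]surjective_pairing /= ?mulVr ?divrr.
Qed.

End FibreProduct.

(** * Elementarity regained, and the shapes of presilting families *)

Section System.
Variables (k : fieldType) (A : falgType k) (e : 'I_2 -> A).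
Variable rho : 'I_2 -> {rmorphism A -> k}.
Hypothesis rs : residue_system e rho.
Let ee := rs_idem rs.

Lemma in_rad_unit x : in_rad rho x -> 1 - x \is a GRing.unit.
Proof.
move=> /(in_rad_nilpotent rs)[n xn0]; pose y := \sum_(i < n) x ^+ i.
have xy : x * y = y * x.
  by rewrite mulr_sumr mulr_suml; apply: eq_bigr => i _; rewrite -exprS exprSr.
have y1 : (1 - x) * y = 1.
  by have := subrX1 x n; rewrite xn0 sub0r => /(congr1 -%R); rewrite opprK -mulNr opprB.
apply/unitrP; exists y; split=> //.
by rewrite -[RHS]y1 mulrBl mulrBr mul1r mulr1 xy.
Qed.

Lemma elementary_of_residue_system : elementary_rank k A 2.
Proof.
exists (fun x => [ffun i => rho i x]); split.
  by move=> x y; apply/ffunP=> i; rewrite !ffunE rmorphD.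
split; first by move=> x y; apply/ffunP=> i; rewrite !ffunE rmorphM.
split; first by apply/ffunP=> i; rewrite !ffunE rmorph1.
split; first by move=> c x; apply/ffunP=> i; rewrite !ffunE (rs_scale rs).
split.
  move=> f; exists (f i1 *: e i1 + f i2 *: e i2); apply/ffunP=> i.
  rewrite ffunE rmorphD /= !(rs_scale rs) !(rs_rho_e rs).
  by have [->|->] := ord2_case i; rewrite /= mulr0 mulr1 ?addr0 ?add0r.
move=> x; split=> [/ffunP x0 y | jx].
  by apply: in_rad_unit => i; have := x0 i; rewrite !ffunE rmorphM => ->; rewrite mulr0.
apply/ffunP=> i; rewrite !ffunE; apply/eqP; apply: contraT => nz.
(* With y the inverse of the residue of x, 1 - y x would be a unit of residue 0. *)
have /(rmorph_unit (rho i)) := jx ((rho i x)^-1 *: 1).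
by rewrite rmorphB rmorph1 rmorphM (rs_scale rs) rmorph1 mulr1 mulVf // subrr unitr0.
Qed.

Lemma idem_rad0 a : a * a = a -> in_rad rho a -> a = 0.
Proof.
move=> idem_a /(in_rad_nilpotent rs)[n an0].
have an m : a ^+ m.+1 = a by elim: m => // m IH; rewrite exprS IH.
by rewrite -(an n) exprS an0 mulr0.
Qed.

(** If e_i = a + b orthogonally, all residues of a or all residues of b vanish; a radical idempotent
    is nilpotent, hence zero. *)
Lemma complete_of_residue_system : complete_prim2 k A e.
Proof.
have prim i : primitive_idem k A (e i).
  split; first exact: ee.
  split.
    apply/eqP=> /(congr1 (rho i))/eqP; rewrite (rs_rho_e rs) eqxx rmorph0.
    by rewrite oner_eq0.
  move=> a b idem_a idem_b ab0 ba0 eab.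
  have off j : j != i -> rho j a = 0 /\ rho j b = 0.
    move=> ne_ji; have := congr1 (rho j) eab; rewrite (rs_rho_e rs) (negPf ne_ji) rmorphD.
    move=> sum0; have rab : rho j a * rho j b = 0 by rewrite -rmorphM ab0 rmorph0.
    have ra : rho j a = 0.
      by rewrite -idem_a rmorphM -[LHS]addr0 -rab -mulrDr -sum0 mulr0.
    by split=> //; move: sum0; rewrite ra add0r.
  have /eqP : rho i a * rho i b = 0 by rewrite -rmorphM ab0 rmorph0.
  rewrite mulf_eq0 => /orP[] /eqP r0; [left | right]; apply: idem_rad0 => // j;
    by have [-> // | /off[]] := eqVneq j i.
split; first exact: prim; split; first exact: prim.
split; first exact: orth12 rs; split; last exact: rs_sum rs.
by have := rs_tri rs 1; rewrite mulr1.
Qed.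

(** No label occurs in both degrees, anywhere in the family. A label 1 in degree 0 together with a
    label 2 in degree -1 then excludes all others; without such a pair, only maps P_1 -> P_2 can
    join the two degrees. *)
Lemma fan_type12_or_off ts : fan_data e ts ->
  (forall i, (i < size ts)%N -> minimal rho (nth cpx0 ts i)) ->
  (forall i, (i < size ts)%N -> type12 (nth cpx0 ts i)) \/
  (forall i j p q, (i < size ts)%N -> (j < size ts)%N ->
     lab0 (nth cpx0 ts i) p = i2 /\ lab1 (nth cpx0 ts j) q = i1).
Proof.
move=> [_ _ hom] mints.
have disj i j p q : (i < size ts)%N -> (j < size ts)%N ->
    lab0 (nth cpx0 ts i) p != lab1 (nth cpx0 ts j) q.
  by move=> lti ltj; apply: (hom1_minimal_labels rs _ _ _ _ (hom j i ltj lti)); exact: mints.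
case: (classic (exists i j p q, [/\ (i < size ts)%N, (j < size ts)%N,
    lab0 (nth cpx0 ts i) p = i1 & lab1 (nth cpx0 ts j) q = i2])).
  move=> [i [j [p [q [lti ltj lp lq]]]]]; left=> l ltl; split=> r.
    have [//|lr] := ord2_case (lab0 (nth cpx0 ts l) r).
    by have := disj l j r q ltl ltj; rewrite lr lq.
  have [lr|//] := ord2_case (lab1 (nth cpx0 ts l) r).
  by have := disj i l p r lti ltl; rewrite lr lp.
move=> no; right=> i j p q lti ltj; have := disj i j p q lti ltj.
case: (ord2_case (lab0 (nth cpx0 ts i) p)) => lp;
  case: (ord2_case (lab1 (nth cpx0 ts j) q)) => lq; rewrite lp lq // => _.
by case: no; exists i, j, p, q.
Qed.

Lemma fan_rank (xi : {additive A -> k}) ts : top_system e rho xi -> fan_data e ts ->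
  (forall i, (i < size ts)%N -> type12 (nth cpx0 ts i)) ->
  (forall i, (i < size ts)%N -> row_full (topmx xi (nth cpx0 ts i))) \/
  (forall i, (i < size ts)%N -> row_free (topmx xi (nth cpx0 ts i))).
Proof.
move=> tsx [ind _ hom] t12.
case: (classic (forall i, (i < size ts)%N -> row_full (topmx xi (nth cpx0 ts i)))).
  by left.
move=> /not_all_ex_not[j nj]; right=> i lti; apply: contraT => nfree.
case: nj => ltj; have [ci _] := ind i lti; have [cj _] := ind j ltj.
have [free | //] := hom1_rank rs tsx cj ci (t12 j ltj) (t12 i lti) (hom j i ltj lti).
by rewrite free in nfree.
Qed.

End System.

(** * Transfer of fans along base change *)

Section Transfer.
Variables (k : fieldType) (G L : falgType k) (eG : 'I_2 -> G) (eL : 'I_2 -> L).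
Variables (rhoG : 'I_2 -> {rmorphism G -> k}) (rho : 'I_2 -> {rmorphism L -> k}).
Variable phi : {rmorphism G -> L}.
Hypotheses (rsG : residue_system eG rhoG) (rs : residue_system eL rho).
Hypotheses (phi_e : forall i, phi (eG i) = eL i).
Hypotheses (phi_surj : forall y, exists x, phi x = y).
Hypothesis phi_rho : forall i x, rho i (phi x) = rhoG i x.
Let eeG := rs_idem rsG.
Let ee := rs_idem rs.

Lemma phi_ker_rad x : phi x = 0 -> in_rad rhoG x.
Proof. by move=> x0 i; rewrite -phi_rho x0 rmorph0. Qed.

Lemma minimal_of_base_change T : minimal rho (base_change phi T) -> minimal rhoG T.
Proof.
move=> /rad_mxP minT; apply/rad_mxP=> r c i; rewrite -phi_rho.
by have := minT r c i; rewrite mxE.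
Qed.

Lemma base_change_minimal T : minimal rhoG T -> minimal rho (base_change phi T).
Proof.
by move=> /rad_mxP minT; apply/rad_mxP=> r c i; rewrite mxE phi_rho minT.
Qed.

Lemma base_change_zeroK T : zeroK eG T -> zeroK eL (base_change phi T).
Proof.
move/(homotopic_base_change phi_e).
by rewrite !(map_idm phi_e) !map_mx0.
Qed.

Lemma minimal_dsum T U : minimal rhoG T -> minimal rhoG U -> minimal rhoG (dsum T U).
Proof.
by move=> mT mU i; rewrite /= map_block_mx mT mU !map_mx0 block_mx0.
Qed.

Section Class.
Variable Q : cpx k G -> Prop.
Hypothesis Qlifts : forall T U, is_cpx eG T -> is_cpx eG U -> Q T -> Q U ->
  lifts eG phi T U.

(** A decomposition over L is made minimal and lifted. The hypothesis on [W] puts the lift into [Q],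
    so the isomorphism lifts as well and T itself decomposes. *)
Lemma indecK_base_change T : 
  (forall W, is_cpx eG W -> minimal rhoG W ->
     isoK eL (base_change phi T) (base_change phi W) -> Q W) ->
  Q T -> indecK eG T -> indecK eL (base_change phi T).
Proof.
move=> Qiso QT [cT [nzT decT]]; split; first exact: (base_change_is_cpx phi_e).
split; first by move/(zeroK_of_base_change rsG ee phi_e phi_surj phi_ker_rad cT).
move=> U V cU cV isoUV.
have [U1 [cU1 mU1 isoU _]] := minimal_replacement rs cU.
have [V1 [cV1 mV1 isoV _]] := minimal_replacement rs cV.
have [U2 cU2 defU] := cpx_lift rsG ee phi_e phi_surj cU1.
have [V2 cV2 defV] := cpx_lift rsG ee phi_e phi_surj cV1.
have cW : is_cpx eG (dsum U2 V2) by apply/is_cpx_dsum.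
have isoW : isoK eL (base_change phi T) (base_change phi (dsum U2 V2)).
  rewrite base_change_dsum defU defV.
  by apply: (isoK_trans ee isoUV); apply: dsum_isoK.
have mW : minimal rhoG (dsum U2 V2).
  by apply: minimal_dsum; apply: minimal_of_base_change; rewrite ?defU ?defV.
have QW := Qiso _ cW mW isoW.
have isoTW : isoK eG T (dsum U2 V2).
  by apply: (isoK_lift rsG ee phi_e phi_surj phi_ker_rad cT cW _ _ isoW); apply: Qlifts.
have [/base_change_zeroK | /base_change_zeroK] := decT U2 V2 cU2 cV2 isoTW.
  by rewrite defU => zU; left; apply: (zeroK_isoK ee (isoK_sym isoU)) zU.
by rewrite defV => zV; right; apply: (zeroK_isoK ee (isoK_sym isoV)) zV.
Qed.

Lemma indecK_of_base_change T : is_cpx eG T ->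
  indecK eL (base_change phi T) -> indecK eG T.
Proof.
move=> cT [_ [nzT decT]]; split=> //; split; first by move/base_change_zeroK.
move=> U V cU cV /(isoK_base_change phi_e); rewrite base_change_dsum.
case/decT; try exact: (base_change_is_cpx phi_e).
  by move/(zeroK_of_base_change rsG ee phi_e phi_surj phi_ker_rad cU); left.
by move/(zeroK_of_base_change rsG ee phi_e phi_surj phi_ker_rad cV); right.
Qed.

Lemma fan_down ts : fan_data eG ts ->
  (forall i, (i < size ts)%N -> Q (nth cpx0 ts i)) ->
  (forall i W, (i < size ts)%N -> is_cpx eG W -> minimal rhoG W ->
     isoK eL (base_change phi (nth cpx0 ts i)) (base_change phi W) -> Q W) ->
  fan_data eL (map (base_change phi) ts).
Proof.
move=> dts Qts Qiso; have [ind niso hom] := dts.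
apply: (fan_data_map dts) => [i lti | i j lti ltj | i j lti ltj].
- by apply: indecK_base_change (Qts i lti) (ind i lti) => W; apply: Qiso.
- have [ci _] := ind i lti; have [cj _] := ind j ltj.
  by apply: (isoK_lift rsG ee phi_e phi_surj phi_ker_rad ci cj); apply: Qlifts => //; apply: Qts.
exact: (hom1_base_change rsG ee phi_e phi_surj) (hom i j lti ltj).
Qed.

Lemma fan_up ts : fan_data eL ts ->
  (forall i T, (i < size ts)%N -> is_cpx eG T -> base_change phi T = nth cpx0 ts i -> Q T) ->
  exists2 ts', fan_data eG ts' & map gvec ts' = map gvec ts.
Proof.
move=> dts Qts; have [ind niso hom] := dts.
have exF T : exists T', is_cpx eL T -> is_cpx eG T' /\ base_change phi T' = T.
  case: (classic (is_cpx eL T)) => [cT | ncT]; last by exists cpx0.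
  by have [T' ? ?] := cpx_lift rsG ee phi_e phi_surj cT; exists T'.
pose F T := sval (constructive_indefinite_description _ (exF T)).
have FP T : is_cpx eL T -> is_cpx eG (F T) /\ base_change phi (F T) = T.
  exact: svalP (constructive_indefinite_description _ (exF T)).
have Fts i (lti : (i < size ts)%N) : [/\ is_cpx eG (F (nth cpx0 ts i)),
    base_change phi (F (nth cpx0 ts i)) = nth cpx0 ts i & Q (F (nth cpx0 ts i))].
  have [ci _] := ind i lti; have [cF FE] := FP _ ci.
  by split=> //; apply: Qts FE.
exists (map F ts); last first.
  apply: map_gvec => i lti; have [_ FE _] := Fts i lti.
  by rewrite -{2}FE base_change_gvec.
apply: (fan_data_map dts) => [i lti | i j lti ltj | i j lti ltj].
- have [cF FE _] := Fts i lti; apply: indecK_of_base_change => //.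
  by rewrite FE; apply: ind.
- have [ci Ei _] := Fts i lti; have [cj Ej _] := Fts j ltj.
  by move/(isoK_base_change phi_e); rewrite Ei Ej.
have [ci Ei Qi] := Fts i lti; have [cj Ej Qj] := Fts j ltj.
apply: (hom1_lift rsG ee phi_e phi_surj ci cj); first exact: Qlifts.
by rewrite Ei Ej; apply: hom.
Qed.

End Class.
End Transfer.

(** * Consequences of the two corner cones *)

Section Corner.
Variables (k : fieldType) (A : falgType k) (e : 'I_2 -> A).
Variable rho : 'I_2 -> {rmorphism A -> k}.
Hypothesis rs : residue_system e rho.
Let ee := rs_idem rs.

Lemma gvecE (T : cpx k A) i : gvec T 0 i =
  #|[pred j | lab0 T j == i]|%:R - #|[pred j | lab1 T j == i]|%:R.
Proof. by rewrite mxE rmorphB. Qed.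

(** The labels in the two degrees are disjoint, so nothing cancels in the g-vector and its signs
    tell in which degree each projective can occur. *)
Lemma gvec_quadrant_type12 T : minimal rho T -> hom1 e T T ->
  0 <= gvec T 0 i1 -> gvec T 0 i2 <= 0 -> type12 T.
Proof.
move=> minT homT; rewrite !gvecE => ge0 le0.
have disj := hom1_minimal_labels rs _ _ minT minT homT.
have pos n (s : 'I_n -> 'I_2) j i : s j = i -> (0 < #|[pred j | s j == i]|)%N.
  by move=> sj; apply/card_gt0P; exists j; rewrite inE sj.
split=> p.
  have [// | lp] := ord2_case (lab0 T p); move: le0.
  rewrite [X in _ - X%:R](eq_card0 (A := [pred j | lab1 T j == i2])) ?subr0.
    by rewrite lern0 => /eqP c0; have := pos _ _ _ _ lp; rewrite c0.
  by move=> q; rewrite !inE; have := disj p q; rewrite lp eq_sym => /negPf.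
have [lp | //] := ord2_case (lab1 T p); move: ge0.
rewrite (eq_card0 (A := [pred j | lab0 T j == i1])) ?sub0r.
  by rewrite oppr_ge0 lern0 => /eqP c0; have := pos _ _ _ _ lp; rewrite c0.
by move=> q; rewrite !inE; have := disj q p; rewrite lp => /negPf.
Qed.

(** Each ray of sigma carries the nonzero g-vector of a summand: on x = 0 a power of P_2 shifted, on
    x + y = 0 a square matrix from P_2^n to P_1^n. These two summands are fed to the cyclicity
    criterion. *)
Lemma sigma_cyclic_right : in_gfan k A e (cone [:: vec2 0 (-1); vec2 1 (-1)]) ->
  exists2 x, cyclic_right e x & x != 0.
Proof.
case/(in_gfanP ee) => ts0 /(fan_data_minimal rs)[ts [[ind _ hom] <- mints]] eqC.
have inS i (lti : (i < size ts)%N) : 0 <= lform 1 0 (gvec (nth cpx0 ts i)) /\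
    0 <= lform (-1) (-1) (gvec (nth cpx0 ts i)).
  apply: sigma_coneP; apply/eqC; rewrite -(nth_map _ 0 gvec) //.
  by apply: cone_nth; rewrite size_map.
have t12 i (lti : (i < size ts)%N) : type12 (nth cpx0 ts i).
  have [] := inS i lti; rewrite /lform => h1 h2.
  by apply: (gvec_quadrant_type12 (mints i lti) (hom i i lti lti)); lra.
have [||||i [lti gi0 nzi]] := @cone_lform_face (map gvec ts) 1 0 (vec2 0 (-1)).
- by move=> i; rewrite size_map => lti; rewrite (nth_map cpx0) //; have [] := inS i lti.
- by apply/eqC; apply: (@cone_nth [:: vec2 0 (-1); vec2 1 (-1)] 0).
- by rewrite /lform !mxE /=; lra.
- by apply/eqP=> /rowP/(_ i2); rewrite !mxE /=; lra.
have [||||j [ltj gj0 nzj]] := @cone_lform_face (map gvec ts) (-1) (-1) (vec2 1 (-1)).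
- by move=> j; rewrite size_map => ltj; rewrite (nth_map cpx0) //; have [] := inS j ltj.
- by apply/eqC; apply: (@cone_nth [:: vec2 0 (-1); vec2 1 (-1)] 1).
- by rewrite /lform !mxE /=; lra.
- by apply/eqP=> /rowP/(_ i2); rewrite !mxE /=; lra.
rewrite size_map in lti ltj; rewrite (nth_map cpx0) // in gi0 nzi.
rewrite (nth_map cpx0) // in gj0 nzj.
move: gi0 nzi gj0 nzj; rewrite (gvec_type12 (t12 i lti)) (gvec_type12 (t12 j ltj)).
rewrite /lform !mxE /= => gi0 nzi gj0 nzj.
have n0i : n0 (nth cpx0 ts i) = 0%N by apply/eqP; rewrite -(eqr_nat RR); apply/eqP; lra.
have eqn : n0 (nth cpx0 ts j) = n1 (nth cpx0 ts j).
  by apply/eqP; rewrite -(eqr_nat RR); apply/eqP; lra.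
have [cj _] := ind j ltj.
apply: (cyclic_right_exists rs cj (t12 j ltj) (ind j ltj) eqn _ n0i _ (t12 i lti).2).
- apply: contraNneq nzj => z; apply/eqP/planeP; rewrite !mxE /= -?eqn z ?oppr0 //.
- apply: contraNneq nzi => z; apply/eqP/planeP; rewrite !mxE /= ?n0i ?z ?oppr0 //.
exact: hom.
Qed.

Lemma sigma'_cyclic_left : in_gfan k A e (cone [:: vec2 1 (-1); vec2 1 0]) ->
  exists2 x, cyclic_left e x & x != 0.
Proof.
case/(in_gfanP ee) => ts0 /(fan_data_minimal rs)[ts [[ind _ hom] <- mints]] eqC.
have inS i (lti : (i < size ts)%N) : 0 <= lform 0 (-1) (gvec (nth cpx0 ts i)) /\
    0 <= lform 1 1 (gvec (nth cpx0 ts i)).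
  apply: sigma'_coneP; apply/eqC; rewrite -(nth_map _ 0 gvec) //.
  by apply: cone_nth; rewrite size_map.
have t12 i (lti : (i < size ts)%N) : type12 (nth cpx0 ts i).
  have [] := inS i lti; rewrite /lform => h1 h2.
  by apply: (gvec_quadrant_type12 (mints i lti) (hom i i lti lti)); lra.
have [||||i [lti gi0 nzi]] := @cone_lform_face (map gvec ts) 0 (-1) (vec2 1 0).
- by move=> i; rewrite size_map => lti; rewrite (nth_map cpx0) //; have [] := inS i lti.
- by apply/eqC; apply: (@cone_nth [:: vec2 1 (-1); vec2 1 0] 1).
- by rewrite /lform !mxE /=; lra.
- by apply/eqP=> /rowP/(_ i1); rewrite !mxE /=; lra.
have [||||j [ltj gj0 nzj]] := @cone_lform_face (map gvec ts) 1 1 (vec2 1 (-1)).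
- by move=> j; rewrite size_map => ltj; rewrite (nth_map cpx0) //; have [] := inS j ltj.
- by apply/eqC; apply: (@cone_nth [:: vec2 1 (-1); vec2 1 0] 0).
- by rewrite /lform !mxE /=; lra.
- by apply/eqP=> /rowP/(_ i1); rewrite !mxE /=; lra.
rewrite size_map in lti ltj; rewrite (nth_map cpx0) // in gi0 nzi.
rewrite (nth_map cpx0) // in gj0 nzj.
move: gi0 nzi gj0 nzj; rewrite (gvec_type12 (t12 i lti)) (gvec_type12 (t12 j ltj)).
rewrite /lform !mxE /= => gi0 nzi gj0 nzj.
have n1i : n1 (nth cpx0 ts i) = 0%N by apply/eqP; rewrite -(eqr_nat RR); apply/eqP; lra.
have eqn : n0 (nth cpx0 ts j) = n1 (nth cpx0 ts j).
  by apply/eqP; rewrite -(eqr_nat RR); apply/eqP; lra.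
have [cj _] := ind j ltj.
apply: (cyclic_left_exists rs cj (t12 j ltj) (ind j ltj) eqn _ n1i _ (t12 i lti).1).
- apply: contraNneq nzj => z; apply/eqP/planeP; rewrite !mxE /= -?eqn z ?oppr0 //.
- apply: contraNneq nzi => z; apply/eqP/planeP; rewrite !mxE /= ?n1i ?z ?oppr0 //.
exact: hom.
Qed.

End Corner.

(** [P0] and [P1] will collect the labels of an entire family, since lifts are needed between
    different summands. *)
Definition off_class (k : fieldType) (G : falgType k) (P0 P1 : 'I_2 -> Prop) (T : cpx k G) :=
  (forall p, P0 (lab0 T p)) /\ (forall q, P1 (lab1 T q)).

Definition labels0 (k : fieldType) (A : falgType k) (ts : seq (cpx k A)) (a : 'I_2) :=
  exists i, (i < size ts)%N /\ exists p, lab0 (nth cpx0 ts i) p = a.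
Definition labels1 (k : fieldType) (A : falgType k) (ts : seq (cpx k A)) (a : 'I_2) :=
  exists i, (i < size ts)%N /\ exists p, lab1 (nth cpx0 ts i) p = a.

(** * Transfer of families according to their shape *)

Section Glue.
Variables (k : fieldType) (G L : falgType k) (eG : 'I_2 -> G) (eL : 'I_2 -> L).
Variables (rhoG : 'I_2 -> {rmorphism G -> k}) (rho : 'I_2 -> {rmorphism L -> k}).
Variables (xiG : {additive G -> k}) (xi : {additive L -> k}).
Variable phi : {rmorphism G -> L}.
Hypotheses (rsG : residue_system eG rhoG) (rs : residue_system eL rho).
Hypotheses (tsG : top_system eG rhoG xiG) (ts : top_system eL rho xi).
Hypotheses (phi_e : forall i, phi (eG i) = eL i).
Hypotheses (phi_surj : forall y, exists x, phi x = y).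
Hypothesis phi_rho : forall i x, rho i (phi x) = rhoG i x.
Hypothesis phi_xi : forall x, xi (phi x) = xiG x.

Lemma topmx_base_change T : topmx xi (base_change phi T) = topmx xiG T.
Proof. by apply/matrixP=> r c; rewrite !mxE phi_xi. Qed.

Definition off_labels (P0 P1 : 'I_2 -> Prop) :=
  forall a b, P0 a -> P1 b -> a = i2 /\ b = i1.

Lemma off_class_lifts P0 P1 T U : off_labels P0 P1 -> off_class P0 P1 T ->
  off_class P0 P1 U -> lifts eG phi T U.
Proof.
move=> off [_ T1] [U0 _]; apply: lifts_no_hom => [|p q]; first exact: rs_tri rsG.
exact: off (U0 p) (T1 q).
Qed.

Lemma off_class_iso P0 P1 T W : minimal rhoG T -> minimal rhoG W ->
  isoK eL (base_change phi T) (base_change phi W) -> off_class P0 P1 T ->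
  off_class P0 P1 W.
Proof.
move=> mT mW /(isoK_minimal_labels rs (base_change_minimal phi_rho mT)
  (base_change_minimal phi_rho mW))[l0 l1] [T0 T1].
by split=> q; [have [p /= <-] := l0 q | have [p /= <-] := l1 q].
Qed.

Lemma type12_iso T W : minimal rhoG T -> minimal rhoG W ->
  isoK eL (base_change phi T) (base_change phi W) -> type12 T -> type12 W.
Proof. exact: (@off_class_iso (eq^~ i1) (eq^~ i2)). Qed.

Lemma fan_down_off ts0 : fan_data eG ts0 ->
  (forall i, (i < size ts0)%N -> minimal rhoG (nth cpx0 ts0 i)) ->
  off_labels (labels0 ts0) (labels1 ts0) ->
  fan_data eL (map (base_change phi) ts0).
Proof.
move=> dts mts off.
have Qts i : (i < size ts0)%N -> off_class (labels0 ts0) (labels1 ts0) (nth cpx0 ts0 i).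
  by move=> lti; split=> p; exists i; split=> //; exists p.
apply: (fan_down rsG rs phi_e phi_surj phi_rho _ dts Qts) => [T U _ _|i W lti cW mW isoW].
  exact: off_class_lifts.
exact: off_class_iso (mts i lti) mW isoW (Qts i lti).
Qed.

Lemma fan_up_off ts0 : fan_data eL ts0 -> off_labels (labels0 ts0) (labels1 ts0) ->
  exists2 ts', fan_data eG ts' & map gvec ts' = map gvec ts0.
Proof.
move=> dts off.
apply: (fan_up rsG rs phi_e phi_surj phi_rho (Q := off_class (labels0 ts0) (labels1 ts0))) => //.
  by move=> T U _ _; apply: off_class_lifts.
move=> i T lti cT ET.
split=> p; exists i; split=> //; rewrite -ET; by exists p.
Qed.

Section Ranked.
(** Instantiated by [row_full] towards L and by [row_free] towards L'. *)
Variable full : forall q p, 'M[k]_(q, p) -> bool.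
Hypothesis full_lifts : forall T U, is_cpx eG T -> is_cpx eG U -> type12 T -> type12 U ->
  full (topmx xiG T) -> full (topmx xiG U) -> lifts eG phi T U.
Hypothesis full_iso : forall T W, is_cpx eL T -> is_cpx eL W -> type12 T -> type12 W ->
  isoK eL T W -> full (topmx xi T) -> full (topmx xi W).

Lemma fan_down_rank ts0 : fan_data eG ts0 ->
  (forall i, (i < size ts0)%N -> type12 (nth cpx0 ts0 i)) ->
  (forall i, (i < size ts0)%N -> full (topmx xiG (nth cpx0 ts0 i))) ->
  fan_data eL (map (base_change phi) ts0).
Proof.
move=> dts t12 fts; have [ind _ _] := dts.
apply: (fan_down rsG rs phi_e phi_surj phi_rho
  (Q := fun T => type12 T /\ full (topmx xiG T))) => //.
- by move=> T U cT cU [? ?] [? ?]; apply: full_lifts.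
- by move=> i lti; split; [apply: t12 | apply: fts].
move=> i W lti cW mW isoW; have [ci _] := ind i lti.
have tW : type12 W.
  exact: type12_iso (type12_minimal rsG ci (t12 i lti)) mW isoW (t12 i lti).
split=> //; rewrite -topmx_base_change.
apply: full_iso isoW _; try exact: (base_change_is_cpx phi_e).
- exact: t12 lti.
- exact: tW.
by rewrite topmx_base_change fts.
Qed.

Lemma fan_up_rank ts0 : fan_data eL ts0 ->
  (forall i, (i < size ts0)%N -> type12 (nth cpx0 ts0 i)) ->
  (forall i, (i < size ts0)%N -> full (topmx xi (nth cpx0 ts0 i))) ->
  exists2 ts', fan_data eG ts' & map gvec ts' = map gvec ts0.
Proof.
move=> dts t12 fts.
apply: (fan_up rsG rs phi_e phi_surj phi_rho
  (Q := fun T => type12 T /\ full (topmx xiG T))) => //.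
  by move=> T U cT cU [? ?] [? ?]; apply: full_lifts.
move=> i T lti cT ET; move: (t12 i lti) (fts i lti); rewrite -ET => tT.
by rewrite topmx_base_change.
Qed.

End Ranked.
End Glue.

(** * Separation from sigma and sigma', and the gluing of the two fans *)

Lemma cone_neq C vs ws p q x : same_set C (cone vs) ->
  (forall i, (i < size vs)%N -> 0 <= lform p q (nth 0 vs i)) ->
  cone ws x -> lform p q x < 0 -> ~ same_set C (cone ws).
Proof.
move=> eqC ge0 wsx neg eqC'; have /eqC vsx : C x by apply/eqC'.
by have := cone_lform_ge0 ge0 vsx; rewrite leNgt neg.
Qed.

(** Either degree -1 is empty, and the cone lies in y >= 0, or P_1 is absent from degree 0, and it
    lies in x <= 0. Neither half-plane contains sigma. *)
Lemma off_cone_neq (k : fieldType) (A : falgType k) (ts : seq (cpx k A)) C :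
  off_labels (labels0 ts) (labels1 ts) -> same_set C (cone (map gvec ts)) ->
  ~ same_set C (cone [:: vec2 0 (-1); vec2 1 (-1)]).
Proof.
move=> off eqC; case: (classic (labels0 ts i1)) => [l1 | nl1].
  apply: (cone_neq (p := 0) (q := 1) (x := vec2 0 (-1)) eqC); last 2 first.
  - exact: (@cone_nth [:: vec2 0 (-1); vec2 1 (-1)] 0).
  - by rewrite /lform !mxE /=; lra.
  move=> i; rewrite size_map => lti; rewrite (nth_map cpx0) // /lform mul0r add0r mul1r gvecE.
  rewrite [X in _ - X%:R]eq_card0 ?subr0 ?ler0n // => q; rewrite !inE.
  by have [] := off i1 _ l1 (ex_intro _ i (conj lti (ex_intro _ q erefl))).
apply: (cone_neq (p := -1) (q := 0) (x := vec2 1 (-1)) eqC); last 2 first.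
- exact: (@cone_nth [:: vec2 0 (-1); vec2 1 (-1)] 1).
- by rewrite /lform !mxE /=; lra.
move=> i; rewrite size_map => lti; rewrite (nth_map cpx0) // /lform mul0r addr0 mulN1r gvecE.
rewrite (eq_card0 (A := [pred j | lab0 _ j == i1])) ?sub0r ?opprK ?ler0n // => q.
rewrite !inE; apply/eqP=> lq; apply: nl1; exists i; split=> //; by exists q.
Qed.

Lemma in_gfan_map (k : fieldType) (A B : falgType k) (f : 'I_2 -> B) ts ts' C :
  (forall i, f i * f i = f i) -> fan_data f ts' -> map gvec ts' = map gvec ts ->
  same_set C (cone (map (@gvec k A) ts)) -> in_gfan k B f C.
Proof. by move=> ff dts' eqg eqC; apply/(in_gfanP ff); exists ts' => //; rewrite eqg. Qed.

Unset Implicit Arguments.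

Theorem theorem6p3 (k : fieldType)
  (L : falgType k) (e : 'I_2 -> L) (L' : falgType k) (e' : 'I_2 -> L') :
  elementary_rank k L 2 -> complete_prim2 k L e ->
  elementary_rank k L' 2 -> complete_prim2 k L' e' ->
  (forall x : L, e i2 * x * e i1 = 0) ->
  (forall x : L', e' i2 * x * e' i1 = 0) ->
  in_gfan k L e (cone [:: vec2 0 (-1); vec2 1 (-1)]) ->
  in_gfan k L' e' (cone [:: vec2 1 (-1); vec2 1 0]) ->
  exists (G : falgType k) (f : 'I_2 -> G),
    elementary_rank k G 2 /\ complete_prim2 k G f /\
    forall C : plane -> Prop,
      (in_gfan k G f C /\ dim2 C) <->
      ((in_gfan k L e C /\ dim2 C /\ ~ same_set C (cone [:: vec2 0 (-1); vec2 1 (-1)])) \/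
       (in_gfan k L' e' C /\ dim2 C /\ ~ same_set C (cone [:: vec2 1 (-1); vec2 1 0]))).
Proof.
move=> elL cpL elL' cpL' tri tri' sig sig'.
have [rho rs] := residue_system_exists elL cpL tri.
have [rho' rs'] := residue_system_exists elL' cpL' tri'.
have [x cycx nzx] := sigma_cyclic_right rs sig.
have [x' cycx' nzx'] := sigma'_cyclic_left rs' sig'.
have [xi [tsx xix]] := top_system_right rs cycx nzx.
have [xi' [tsx' xix']] := top_system_left rs' cycx' nzx'.
have [G [phi [psi [scale agree inj glue unit]]]] := fibre_product (rs_scale rs)
  (rs_scale rs') (ts_scale tsx) (ts_scale tsx') (ts_mul tsx) (ts_mul tsx').
(* Corresponding idempotents agree in the triangular quotient because [xi] and [xi'] vanish on
   diagonal corners. *)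
have /fin_all_exists[f fE] (i : 'I_2) : exists y : G, phi y = e i /\ psi y = e' i.
  apply: glue => [j|].
    by rewrite (rs_rho_e rs) (rs_rho_e rs').
  have := xi_diag rs tsx i (e i); have := xi_diag rs' tsx' i (e' i).
  by rewrite !(rs_idem rs) !(rs_idem rs') => -> ->.
pose rhoG i : {rmorphism G -> k} := (rho i \o phi)%FUN.
pose xiG : {additive G -> k} := (xi \o phi)%FUN.
have phi_e i : phi (f i) = e i by have [] := fE i.
have psi_e i : psi (f i) = e' i by have [] := fE i.
have phi_rho i y : rho i (phi y) = rhoG i y by [].
have psi_rho i y : rho' i (psi y) = rhoG i y by rewrite -phi_rho (agree y).1.
have phi_xi y : xi (phi y) = xiG y by [].
have psi_xi y : xi' (psi y) = xiG y by rewrite -phi_xi (agree y).2.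
have rsG : residue_system f rhoG.
  split.
  - by move=> i; apply: inj; rewrite rmorphM ?phi_e ?psi_e ?(rs_idem rs) ?(rs_idem rs').
  - by apply: inj; rewrite rmorphD rmorph1 ?phi_e ?psi_e ?(rs_sum rs) ?(rs_sum rs').
  - move=> y; apply: inj; rewrite !rmorphM rmorph0 ?phi_e ?psi_e.
      exact: (rs_tri rs).
    exact: (rs_tri rs').
  - by move=> i c y; rewrite -!phi_rho (scale c y).1 (rs_scale rs).
  - by move=> i j; rewrite -phi_rho phi_e (rs_rho_e rs).
  apply: rad_nilpotent => [i c y | y rady].
    by rewrite -!phi_rho (scale c y).1 (rs_scale rs).
  apply: unit; rewrite rmorphB rmorph1.
    by apply: (in_rad_unit rs) => i; rewrite phi_rho rady.
  by apply: (in_rad_unit rs') => i; rewrite psi_rho rady.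
have [phi_surj psi_surj] : (forall y, exists z, phi z = y) /\ (forall y, exists z, psi z = y).
  split=> y.
    (* The partner of y in L' is the combination of e'_1, e'_2 and x' with the same triangular
       matrix. *)
    have [||z [zy _]] := glue y (rho i1 y *: e' i1 + rho i2 y *: e' i2 + xi y *: x').
    - move=> i; rewrite !rmorphD !(rs_scale rs') !(rs_rho_e rs') (in12_rad rs' cycx'.1).
      by have [->|->] := ord2_case i; rewrite /= ?mulr1 ?mulr0 ?addr0 ?add0r.
    - rewrite !raddfD /= !(ts_scale tsx') xix' mulr1.
      have := xi_diag rs' tsx' i1 (e' i1); have := xi_diag rs' tsx' i2 (e' i2).
      by rewrite !(rs_idem rs') => -> ->; rewrite !mulr0 !add0r.
    by exists z.
  have [||z [_ zy]] := glue (rho' i1 y *: e i1 + rho' i2 y *: e i2 + xi' y *: x) y.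
  - move=> i; rewrite !rmorphD !(rs_scale rs) !(rs_rho_e rs) (in12_rad rs cycx.1).
    by have [->|->] := ord2_case i; rewrite /= ?mulr1 ?mulr0 ?addr0 ?add0r.
  - rewrite !raddfD /= !(ts_scale tsx) xix mulr1.
    have := xi_diag rs tsx i1 (e i1); have := xi_diag rs tsx i2 (e i2).
    by rewrite !(rs_idem rs) => -> ->; rewrite !mulr0 !add0r.
  by exists z.
have tsG : top_system f rhoG xiG.
  split.
  - by move=> c y; rewrite -!phi_xi (scale c y).1 (ts_scale tsx).
  - by move=> y; rewrite -!phi_xi !rmorphM !phi_e (ts_corner tsx).
  - by move=> y z; rewrite -!phi_xi -!phi_rho rmorphM (ts_mul tsx).
  have [z zx] := phi_surj x; exists (f i1 * z * f i2).
    by rewrite /in12 !mulrA (rs_idem rsG) -!mulrA (rs_idem rsG).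
  by rewrite -phi_xi !rmorphM !phi_e (ts_corner tsx) zx.
have phi_ker y : phi y = 0 -> xiG y = 0 by move=> y0; rewrite -phi_xi y0 raddf0.
have psi_ker y : psi y = 0 -> xiG y = 0 by move=> y0; rewrite -psi_xi y0 raddf0.
have phi_ker_lift b : in_rad rho' b -> xi' b = 0 -> exists z, phi z = 0 /\ psi z = b.
  by move=> radb xib; apply: glue => [i|]; rewrite ?rmorph0 ?raddf0 ?radb ?xib.
have psi_ker_lift a : in_rad rho a -> xi a = 0 -> exists z, psi z = 0 /\ phi z = a.
  move=> rada xia; have [||z [za zb]] := glue a 0; last by exists z.
    by move=> i; rewrite rmorph0 rada.
  by rewrite raddf0.
have joint y : phi y = 0 -> psi y = 0 -> y = 0.
  by move=> y1 y2; apply: inj; rewrite ?y1 ?y2 rmorph0.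
have joint' y : psi y = 0 -> phi y = 0 -> y = 0 by move=> y1 y2; apply: joint.
(* The kernel of [phi] is that of L' onto triangular matrices, so lifting along [phi] uses the
   generator [x']. *)
have full_lifts T U : is_cpx f T -> is_cpx f U -> type12 T -> type12 U ->
    row_full (topmx xiG T) -> row_full (topmx xiG U) -> lifts f phi T U.
  move=> cT cU tT tU fT _.
  exact: (lifts_row_full rsG rs' tsx' psi_e psi_xi phi_ker phi_ker_lift joint
    cycx' xix' cT tT tU fT).
have free_lifts T U : is_cpx f T -> is_cpx f U -> type12 T -> type12 U ->
    row_free (topmx xiG T) -> row_free (topmx xiG U) -> lifts f psi T U.
  move=> cT cU tT tU _ fU.
  exact: (lifts_row_free rsG rs tsx phi_e phi_xi psi_ker psi_ker_lift joint'
    cycx xix cU tT tU fU).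
exists G, f; split; first exact: elementary_of_residue_system rsG.
split; first exact: complete_of_residue_system rsG.
move=> C; split.
  case=> /(in_gfanP (rs_idem rsG))[ts0 /(fan_data_minimal rsG)[ts [dts eqg mts]] eqC] d2.
  rewrite -eqg in eqC.
  have [t12 | off] := fan_type12_or_off rsG dts mts; last first.
    have offl : off_labels (labels0 ts) (labels1 ts).
      by move=> a b [i [lti [p <-]]] [j [ltj [q <-]]]; apply: off.
    (* Such cones come from L as well as from L'; L is chosen. *)
    left; split; last by split=> //; apply: off_cone_neq offl eqC.
    apply: (in_gfan_map (rs_idem rs)
      (fan_down_off rsG rs phi_e phi_surj phi_rho dts mts offl) _ eqC).
    exact: map_gvec.
  have [fts | fts] := fan_rank rsG tsG dts t12.
    left; split; last split=> //.
      suff dts' : fan_data e (map (base_change phi) ts).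
        by apply: (in_gfan_map (rs_idem rs) dts' _ eqC); apply: map_gvec.
      apply: (fan_down_rank rsG rs phi_e phi_surj phi_rho phi_xi
        (full := fun q p => @row_full k q p)) => //.
      by move=> T W cT cW tT tW isoTW; apply: (isoK_row_full rs tsx cT cW tT tW isoTW).
    (* Rank n1 forces n1 <= n0, so C lies in x + y >= 0 and misses the ray (0,-1) of sigma. *)
    apply: (cone_neq (p := 1) (q := 1) (x := vec2 0 (-1)) eqC); last 2 first.
    - exact: (@cone_nth [:: vec2 0 (-1); vec2 1 (-1)] 0).
    - by rewrite /lform !mxE /=; lra.
    move=> i; rewrite size_map => lti; rewrite (nth_map cpx0) // (gvec_type12 (t12 i lti)).
    rewrite /lform !mxE /= !mul1r subr_ge0 ler_nat -(eqP (fts i lti)).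
    exact: rank_leq_row.
  right; split; last split=> //.
    suff dts' : fan_data e' (map (base_change psi) ts).
      by apply: (in_gfan_map (rs_idem rs') dts' _ eqC); apply: map_gvec.
    apply: (fan_down_rank rsG rs' psi_e psi_surj psi_rho psi_xi
      (full := fun q p => @row_free k q p)) => //.
    by move=> T W cT cW tT tW isoTW; apply: (isoK_row_free rs' tsx' cT cW tT tW isoTW).
  (* Rank n0 forces n0 <= n1, so C lies in x + y <= 0 and misses the ray (1,0) of sigma'. *)
  apply: (cone_neq (p := -1) (q := -1) (x := vec2 1 0) eqC); last 2 first.
  - exact: (@cone_nth [:: vec2 1 (-1); vec2 1 0] 1).
  - by rewrite /lform !mxE /=; lra.
  move=> i; rewrite size_map => lti; rewrite (nth_map cpx0) // (gvec_type12 (t12 i lti)).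
  rewrite /lform !mxE /= !mulN1r opprK addrC subr_ge0 ler_nat -(eqP (fts i lti)).
  exact: rank_leq_col.
case=> [[inC [d2 neC]] | [inC [d2 neC]]].
  split=> //; case/(in_gfanP (rs_idem rs)): inC => ts0 /(fan_data_minimal rs)[ts [dts eqg mts]] eqC.
  rewrite -eqg in eqC.
  have [t12 | off] := fan_type12_or_off rs dts mts; last first.
    have offl : off_labels (labels0 ts) (labels1 ts).
      by move=> a b [i [lti [p <-]]] [j [ltj [q <-]]]; apply: off.
    have [ts' dts' eqg'] := fan_up_off rsG rs phi_e phi_surj phi_rho dts offl.
    exact: (in_gfan_map (rs_idem rsG) dts' eqg' eqC).
  have [fts | fts] := fan_rank rs tsx dts t12.
    have [ts' dts' eqg'] := fan_up_rank rsG rs phi_e phi_surj phi_rho phi_xi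
      (full := fun q p => @row_full k q p) full_lifts dts t12 fts.
    exact: (in_gfan_map (rs_idem rsG) dts' eqg' eqC).
  (* In rank n0 over L all g-vectors lie on the two rays of sigma, so C, being of dimension 2,
     equals sigma, which is excluded. *)
  case: neC => y; rewrite eqC; move: y; apply: cone_eq_two.
  - by rewrite !mxE /= oppr_eq0 oner_eq0 orbT.
  - by rewrite !mxE /= oner_eq0.
  - move=> i; rewrite size_map => lti; rewrite (nth_map cpx0) // (gvec_type12 (t12 i lti)).
    (* The g-vector is (0,-n1) or (n1,-n1), so n1 is the coefficient on either ray. *)
    exists (n1 (nth cpx0 ts i))%:R; first exact: ler0n.
    have [ind _ _] := dts; have [ci _] := ind i lti.
    have [n0i | eqn] := split_right rs tsx cycx xix ci (t12 i lti) (fts i lti) (ind i lti).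
      by left; apply: planeP; rewrite !mxE /= ?n0i ?mulr0 // mulrN1.
    by right; apply: planeP; rewrite !mxE /= ?eqn ?mulr1 // mulrN1.
  by have [u [v [/eqC Cu [/eqC Cv det]]]] := d2; exists u, v.
split=> //; case/(in_gfanP (rs_idem rs')): inC => ts0 /(fan_data_minimal rs')[ts [dts eqg mts]] eqC.
rewrite -eqg in eqC.
have [t12 | off] := fan_type12_or_off rs' dts mts; last first.
  have offl : off_labels (labels0 ts) (labels1 ts).
    by move=> a b [i [lti [p <-]]] [j [ltj [q <-]]]; apply: off.
  have [ts' dts' eqg'] := fan_up_off rsG rs' psi_e psi_surj psi_rho dts offl.
  exact: (in_gfan_map (rs_idem rsG) dts' eqg' eqC).
have [fts | fts] := fan_rank rs' tsx' dts t12; last first.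
  have [ts' dts' eqg'] := fan_up_rank rsG rs' psi_e psi_surj psi_rho psi_xi
    (full := fun q p => @row_free k q p) free_lifts dts t12 fts.
  exact: (in_gfan_map (rs_idem rsG) dts' eqg' eqC).
(* Over L', rank n1 leaves only the g-vectors (n0,0) and (n0,-n0), on the rays of sigma'. *)
case: neC => y; rewrite eqC; move: y; apply: cone_eq_two.
- by rewrite !mxE /= oner_eq0.
- by rewrite !mxE /= oner_eq0.
- move=> i; rewrite size_map => lti; rewrite (nth_map cpx0) // (gvec_type12 (t12 i lti)).
  exists (n0 (nth cpx0 ts i))%:R; first exact: ler0n.
  have [ind _ _] := dts; have [ci _] := ind i lti.
  have [n1i | eqn] := split_left rs' tsx' cycx' xix' ci (t12 i lti) (fts i lti) (ind i lti).
    by right; apply: planeP; rewrite !mxE /= ?n1i ?mulr0 ?oppr0 // mulr1.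
  by left; apply: planeP; rewrite !mxE /= ?eqn ?mulr1 // mulrN1.
by have [u [v [/eqC Cu [/eqC Cv det]]]] := d2; exists u, v.
Qed.
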